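(* Let $G=\mathbb{Z}^d$, and consider the systems of iceberg type described in the context. Let $\alpha_{n,\gamma}$ ($\gamma\in\Gamma_n/\Gamma_{n+1}$) be a family of independent random variables, $\alpha_{n,\gamma}$ being uniformly distributed on the finite set $M_n=G/\Gamma_n$. Then for a certain sequence $q_n\to\infty$ and for a set of (cylindric) functions $f$ dense in $L^2(X,\mu)$, the spectral measures $\sigma_f$ satisfy almost surely the condition $$\hat\sigma_f(t)=O\bigl(|t|^{-1/2+\varepsilon}\bigr)$$ for any $\varepsilon>0$. Moreover, $\hat\sigma_f\notin L^2(G)$, and $\hat\sigma_f\in L^p(G)$ for $p>2$.
   Context: Construction of systems of iceberg type for $G=\mathbb{Z}^d$. Let $h_1$ be a positive integer, let $q_n\ge 2$ be integers with $q_{n+1}>2q_n$, and put $h_{n+1}=q_nh_n$, $\Gamma_n=h_n\mathbb{Z}^d$ (so $\Gamma_{n+1}\subset\Gamma_n$), $M_n=G/\Gamma_n$, and $U_n=[0,h_n)^{d}\cap\mathbb{Z}^d$, a fundamental domain for $\Gamma_n$. Each point $a\in M_{n+1}$ can be written uniquely as $a=\gamma+u$ with $\gamma\in\Gamma_n/\Gamma_{n+1}$ and $u\in U_n$; write $\boldsymbol\gamma_n(a)=\gamma$ for this $\gamma$. Given parameters $\alpha_{n,\gamma}\in M_n$ ($n\ge1$, $\gamma\in\Gamma_n/\Gamma_{n+1}$), define $\phi_n: M_{n+1}\to M_n$ by $$\phi_n(\gamma+u)=u+\alpha_{n,\gamma} \pmod{\Gamma_n},\qquad \gamma\in\Gamma_n/\Gamma_{n+1},\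 u\in U_n.$$ Let $\mu_n$ be the normalized shift-invariant probability measure on $M_n$; then $\mu_{n+1}(\phi_n^{-1}(A))=\mu_n(A)$ for all $A\subset M_n$. Let $$X=\{x=(x_1,x_2,\dots): x_n\in M_n,\ \phi_n(x_{n+1})=x_n \text{ for all } n\}$$ be the inverse limit, with $\sigma$-algebra $\mathcal{B}$ generated by the cylindric sets $\{x: x_n\in A\}$, $A\subset M_n$, and with the probability measure $\mu$ determined by $\mu\{x:x_n\in A\}=\mu_n(A)$. The action: for fixed $t\in G$, for $\mu$-almost every $x$ there is $n_0(x)$ with $\boldsymbol\gamma_n(x_{n+1})=\boldsymbol\gamma_n(t+x_{n+1})$ for all $n\ge n_0(x)$. For such $x$ set $(T^tx)_n=t+x_n$ for $n\ge n_0(x)$, and recover the coordinates $(T^tx)_n$ for $n<n_0(x)$ from the relation $\phi_n((T^tx)_{n+1})=(T^tx)_n$. This gives an action of $G$ on $(X,\mathcal{B},\mu)$ by measure preserving transformations, called a system of iceberg type. When the parameters $\alpha_{n,\gamma}$ are random, the system is random, and ''almost surely'' refers to the choice of these parameters. A function $f$ on $X$ is cylindric if it depends on a single coordinate $x_{n_0}$, i.e. $f(x)=f_{n_0}(x_{n_0})$ for some $n_0$ and some function $f_{n_0}:M_{n_0}\to\mathbb{C}$. Spectral measure: with $\hat T^tf(x)=f(T^tx)$, for $f\in L^2(X,\mu)$ the spectral measure $\sigma_f$ is the unique finite positive Borel measure on the torus $\mathbb{T}^d=\mathbb{R}^d/\mathbb{Z}^d$ with $$\hat\sigma_f(t)=\int_{\mathbb{T}^d}e^{-2\pi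 i\langle x,t\rangle}\,d\sigma_f(x)=\langle\hat T^{-t}f,f\rangle,\qquad t\in\mathbb{Z}^d.$$ $L^p(G)$ is taken with respect to counting measure on $G=\mathbb{Z}^d$, and $|t|$ is the Euclidean norm.
   Formalization: Density is stated in the zero-mean subspace of L²(X,μ) rather than in all of L²(X,μ): decay of σ̂_f forces ∫f dμ = 0 (Cesàro averages of ⟨T^{-t}f,f⟩ tend to at least |∫f|²), so density in the full space is impossible. *)

(* Defs.v *)
(* Library: MathComp + MathComp-Analysis, complex numbers R[i] from real-closed. *)
From HB Require Import structures.
From mathcomp Require Import all_boot all_order all_algebra.
From mathcomp Require Import generic_quotient complex.
From mathcomp Require Import all_classical all_reals all_analysis.
Set Implicit Arguments.
Unset Strict Implicit.
Unset Printing Implicit Defensive.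
Import Order.TTheory GRing.Theory Num.Theory.
Import numFieldNormedType.Exports.
Local Open Scope classical_set_scope.
Local Open Scope ring_scope.

(* Sequences are indexed from 0: [q S 0], [h S 0 = h1 S] are the q_1, h_1 of the
   usual 1-based convention. *)
Record scales := Scales {
  h1 : nat;
  q : nat -> nat;
  h1_gt0 : (0 < h1)%N;
  q_ge2 : forall n, (2 <= q n)%N;
  q_growth : forall n, (2 * q n < q n.+1)%N }.

Fixpoint h (S : scales) (n : nat) : nat :=
  if n is m.+1 then (q S m * h S m)%N else h1 S.

Lemma h_gt0 (S : scales) n : (0 < h S n)%N.
Proof.
elim: n => [|n IHn] /=; first exact: h1_gt0.
by rewrite muln_gt0 IHn (leq_trans _ (q_ge2 S n)).
Qed.

Section Towers.
Context {d : nat} {S : scales}.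

(* G = Z^d is ['rV[int]_d].  M_n = G / h_n Z^d = (Z / h_n Z)^d; since h_n > 0,
   [(h S n).-1.+1] is h_n, written in the form for which ordinals carry the
   additive group structure of Z / h_n Z (also when h_n = 1). *)
Definition M (n : nat) := 'rV['I_(h S n).-1.+1]_d.

Definition projM (n : nat) (t : 'rV[int]_d) : M n :=
  \row_i inZp `|(t 0%R i %% (h S n)%:Z)%Z|%N.

(* Gamma_n / Gamma_{n+1}, as a subgroup of M_{n+1}: since h_n divides h_{n+1},
   a class lies in it iff its representatives are divisible by h_n. *)
Definition Gamma_quo (n : nat) :=
  {g : M n.+1 | [forall i, (h S n %| g 0%R i)%N]}.

(* The decomposition a = gamma + u, gamma in Gamma_n / Gamma_{n+1}, u in U_n,
   is Euclidean division by h_n of the coordinates of a in [0, h_{n+1}). *)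
Definition upart (n : nat) (a : M n.+1) : 'rV[int]_d :=
  \row_i (a 0%R i %% h S n)%N%:Z.

Definition gpart (n : nat) (a : M n.+1) : M n.+1 :=
  \row_i inZp (h S n * (a 0%R i %/ h S n))%N.

Lemma gpart_subproof n (a : M n.+1) :
  [forall i, (h S n %| gpart a 0%R i)%N].
Proof.
apply/forallP => i; rewrite mxE /= -/(h S n.+1).
move: (nat_of_ord (a 0 i)) => k.
by rewrite (prednK (h_gt0 S n.+1)) /dvdn modn_dvdm ?dvdn_mull// modnMr.
Qed.

Definition gam (n : nat) (a : M n.+1) : Gamma_quo n :=
  exist _ (gpart a) (gpart_subproof a).

Lemma decompE n (a : M n.+1) : a = val (gam a) + projM n.+1 (upart a).
Proof.
apply/rowP => i; rewrite !mxE; apply: val_inj => /=.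
rewrite -/(h S n.+1); have := ltn_ord (a 0 i).
move: (nat_of_ord (a 0 i)) => k; rewrite (prednK (h_gt0 S n.+1)) => lt_k.
by rewrite modz_nat absz_nat !modn_mod modnDm mulnC -divn_eq modn_small.
Qed.

Definition params := forall n : nat, Gamma_quo n -> M n.

Definition phi (alpha : params) (n : nat) (a : M n.+1) : M n :=
  projM n (upart a) + alpha n (gam a).

Definition tower (alpha : params) :=
  {x : forall n, M n | forall n, phi alpha (x n.+1) = x n}.

Definition coord (alpha : params) (x : tower alpha) (n : nat) : M n :=
  proj1_sig x n.

(* [measurableType] requires an inhabited carrier: X contains the point all
   whose coordinates of index > 0 lie in the zero block. *)
Section Inhabited.
Variable alpha : params.

Definition sect (n : nat) (b : M n) : M n.+1 :=
  \row_i inZp ((b - alpha (gam (0 : M n.+1)))%R 0%R i).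

Lemma phi_sect n (b : M n) : phi alpha (sect b) = b.
Proof.
have posn := h_gt0 S n; have posn1 := h_gt0 S n.+1.
set c := b - alpha (gam (0 : M n.+1)).
have ltc i : (c 0%R i < h S n)%N.
  by have := ltn_ord (c 0 i); rewrite {2}(prednK posn).
have ltc1 i : (c 0%R i < h S n.+1)%N.
  apply: (leq_trans (ltc i)); rewrite /= leq_pmull//.
  by rewrite (leq_trans _ (q_ge2 S n)).
have sE i : sect b 0 i = c 0 i :> nat.
  by rewrite mxE /= -/c (prednK posn1) modn_small.
have uE : projM n (upart (sect b)) = c.
  apply/rowP => i; rewrite [LHS]mxE; apply: val_inj => /=.
  rewrite [upart _ 0 i]mxE sE modz_nat absz_nat.
  by move: (nat_of_ord (c 0 i)) (ltc i) => k ltk; rewrite (prednK posn) !(modn_small ltk).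
have gE : gam (sect b) = gam (0 : M n.+1).
  apply: val_inj; apply/rowP => i; rewrite [LHS]mxE [RHS]mxE sE.
  by rewrite (divn_small (ltc i)) mxE div0n.
by rewrite /phi uE gE subrK.
Qed.

Fixpoint pt_seq (n : nat) : M n :=
  if n is m.+1 then sect (pt_seq m) else 0.

Definition tower_pt : tower alpha :=
  exist (fun x : forall n, M n => forall n, phi alpha (x n.+1) = x n)
    pt_seq (fun n => phi_sect (pt_seq n)).

End Inhabited.

HB.instance Definition _ (alpha : params) := gen_eqMixin (tower alpha).
HB.instance Definition _ (alpha : params) := gen_choiceMixin (tower alpha).
HB.instance Definition _ (alpha : params) :=
  isPointed.Build (tower alpha) (tower_pt alpha).

Definition cylinders (alpha : params) : set (set (tower alpha)) :=
  [set C | exists n (A : {set M n}), C = [set x | coord x n \in A]].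

Definition X (alpha : params) := g_sigma_algebraType (@cylinders alpha).

Definition is_iceberg_measure (R : realType) (alpha : params)
    (mu : probability (X alpha) R) : Prop :=
  forall n (A : {set M n}),
    mu [set x | coord x n \in A] = (#|A|%:R / #|{: M n}|%:R)%:E.

(* y = T^t x, for x in the full-measure set where T^t is defined; the
   coordinates of y below n0 are determined by y being in X. *)
Definition is_shift (alpha : params) (t : 'rV[int]_d) (x y : X alpha) : Prop :=
  exists n0 : nat,
    (forall n, (n0 <= n)%N ->
       gam (coord x n.+1) = gam (projM n.+1 t + coord x n.+1)) /\
    (forall n, (n0 <= n)%N -> coord y n = projM n t + coord x n).

(* Off the null set where T^t is undefined, the value is x by convention. *)
Definition Tpow (alpha : params) (t : 'rV[int]_d) (x : X alpha) : X alpha :=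
  xget x [set y | is_shift t x y].

Definition measurable_params (disp : measure_display)
    (Omega : measurableType disp)
    (alpha : forall n, Gamma_quo n -> Omega -> M n) : Prop :=
  forall n g (a : M n), measurable [set w | alpha n g w = a].

Definition uniform_params (R : realType) (disp : measure_display)
    (Omega : measurableType disp) (P : probability Omega R)
    (alpha : forall n, Gamma_quo n -> Omega -> M n) : Prop :=
  forall n g (a : M n), P [set w | alpha n g w = a] = (#|{: M n}|%:R^-1)%:E.

Definition independent_params (R : realType) (disp : measure_display)
    (Omega : measurableType disp) (P : probability Omega R)
    (alpha : forall n, Gamma_quo n -> Omega -> M n) : Prop :=
  forall (J : seq {n : nat & Gamma_quo n})
         (A : forall j : {n : nat & Gamma_quo n}, {set M (tag j)}),
    uniq J ->
    P (\bigcap_(j in [set` J]) [set w | alpha (tag j) (tagged j) w \in A j]) =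
    (\prod_(j <- J) P [set w | alpha (tag j) (tagged j) w \in A j])%E.

End Towers.

Arguments M : clear implicits.
Arguments Gamma_quo : clear implicits.
Arguments params : clear implicits.

Section ComplexIntegral.
Context {R : realType} {disp : measure_display} {E : measurableType disp}.

Definition Cintegral (mu : {measure set E -> \bar R}) (f : E -> R[i]) : R[i] :=
  Complex (\int[mu]_x complex.Re (f x)) (\int[mu]_x complex.Im (f x)).

Definition Cmeasurable (f : E -> R[i]) : Prop :=
  measurable_fun setT (fun x => complex.Re (f x)) /\
  measurable_fun setT (fun x => complex.Im (f x)).

Definition L2norm (mu : {measure set E -> \bar R}) (f : E -> R[i]) : \bar R :=
  Lnorm mu 2%:E (fun x => (Normc.normc (f x))%:E).

(* The orthocomplement of the constants in L^2(mu). Decay of the correlations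
   forces zero mean, so this is the largest space in which the functions of the
   theorem can be dense. *)
Definition in_L20 (mu : {measure set E -> \bar R}) (f : E -> R[i]) : Prop :=
  [/\ Cmeasurable f, (L2norm mu f < +oo)%E & Cintegral mu f = 0].

Definition dense_in_L20 (mu : {measure set E -> \bar R})
    (D : set (E -> R[i])) : Prop :=
  (forall f, D f -> in_L20 mu f) /\
  forall g, in_L20 mu g -> forall eps : R, 0 < eps ->
    exists2 f, D f & (L2norm mu (fun x => (g x - f x)%R) < eps%:E)%E.

Definition inner (mu : {measure set E -> \bar R}) (f g : E -> R[i]) : R[i] :=
  Cintegral mu (fun x => f x * conjc (g x)).

End ComplexIntegral.

Section Torus.
Context (R : realType) (d : nat).

Definition torus_equiv (x y : 'rV[R]_d) : bool :=
  [forall i, x 0 i - y 0 i \is a Num.int].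

Lemma torus_equiv_refl : reflexive torus_equiv.
Proof. by move=> x; apply/forallP => i; rewrite subrr rpred0. Qed.

Lemma torus_equiv_sym : symmetric torus_equiv.
Proof.
by move=> x y; apply: eq_forallb => i; rewrite -[in RHS]opprB rpredN.
Qed.

Lemma torus_equiv_trans : transitive torus_equiv.
Proof.
move=> y x z /forallP xy /forallP yz; apply/forallP => i.
by rewrite -(subrK (y 0 i) (x 0 i)) -addrA rpredD.
Qed.

Canonical torus_equivRel :=
  EquivRel torus_equiv torus_equiv_refl torus_equiv_sym torus_equiv_trans.

Definition torus_top :=
  quotient_topology {eq_quot torus_equivRel}%qT.

(* R^d / Z^d with the Borel sigma-algebra of the quotient topology *)
Definition torus := g_sigma_algebraType (@open torus_top).

(* e^{-2 i pi <x, t>}; by periodicity the choice of representative of x is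
   irrelevant. *)
Definition echar (t : 'rV[int]_d) (x : torus) : R[i] :=
  let theta := 2 * pi * \sum_i (repr (x : torus_top) : 'rV[R]_d) 0 i * (t 0 i)%:~R in
  Complex (cos (- theta)) (sin (- theta)).

Definition fourier (sigma : {finite_measure set torus -> \bar R})
    (t : 'rV[int]_d) : R[i] :=
  Cintegral sigma (echar t).

Definition enorm (t : 'rV[int]_d) : R :=
  Num.sqrt (\sum_i ((t 0 i)%:~R : R) ^+ 2).

(* a(t) = O(|t|^s) as |t| tends to infinity *)
Definition bigO_power (a : 'rV[int]_d -> R[i]) (s : R) : Prop :=
  exists C r : R, forall t, r < enorm t -> Normc.normc (a t) <= C * enorm t `^ s.

(* Membership in L^p(Z^d) for the counting measure, 0 < p < oo *)
Definition in_Lp (p : R) (a : 'rV[int]_d -> R[i]) : Prop :=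
  (\esum_(t in [set: 'rV[int]_d]) (Normc.normc (a t) `^ p)%:E < +oo)%E.

Definition is_spectral_measure (S : scales) (alpha : params d S)
    (mu : probability (X alpha) R) (f : X alpha -> R[i])
    (sigma : {finite_measure set torus -> \bar R}) : Prop :=
  forall t, fourier sigma t = inner mu (fun x => f (Tpow (- t) x)) f.

(* A cylindric function is given by an index n0 and a function on M_{n0}; this
   data makes sense simultaneously for all values of the random parameters. *)
Definition cyl_data (S : scales) := {n : nat & M d S n -> R[i]}.

Definition cyl_fun (S : scales) (alpha : params d S) (c : cyl_data S) :
    X alpha -> R[i] :=
  fun x => tagged c (coord x (tag c)).

End Torus.

Arguments cyl_fun {R d S alpha}.

(* Main.v *)
(* For a cylindric f let f_n be the function it induces on M_n, and
   corr_n(t) = |M_n|^-1 sum_a f_n(a + t) conj f_n(a). Almost every orbit is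
   translated by t at all large levels (Borel-Cantelli), so corr_n(t) tends to
   <T^t f, f>, the Fourier transform of sigma_f at -t.

   In corr_{n+1}(t) the points y such that y and y + t lie in the same block
   contribute nearly their proportion times corr_n(t). The other points
   contribute a sum over the independent alpha_{n,gamma} with mean zero, of size
   q_n^(-d/2) up to powers of log q_n outside an event of tiny probability
   (exponential moments after decoupling). With log_4 q_n larger than |M_n| there
   is room for a union bound over all the possible f_n, so that no conditioning
   on the lower levels is needed.

   Hence, for h_n <= max |t_i| < h_{n+1}, the correlation is q_n^(-d/2) up to
   logarithms, except for the few t within h_n of the lattice h_{n+1} Z^d,
   where one only gets the factor 1/q_n, at the next level. This gives
   the decay and the L^p bounds. For the lower bound, the second moment of the
   contribution of distinct blocks is computed for t in a box of volume
   proportional to |M_{n+1}|, and its sum over the box concentrates by the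
   Efron-Stein inequality: each zone adds a fixed positive amount to
   sum |corr|^2.

   Functions with values in Q + iQ form a countable dense family, which takes
   care of the null sets. *)

Require Import Defs.
From HB Require Import structures.
From mathcomp Require Import all_boot all_order all_algebra.
From mathcomp Require Import generic_quotient complex.
From mathcomp Require Import all_classical all_reals all_analysis.
From mathcomp Require Import measurable_realfun.
From mathcomp Require Import ring lra zify.
Import Defs.
Set Implicit Arguments.
Unset Strict Implicit.
Unset Printing Implicit Defensive.
Import Order.TTheory GRing.Theory Num.Theory.
Local Open Scope ring_scope.

(** * Averages over finite product spaces *)

(** The exponent 2 is critical: up to logarithms a zone has q_n^d points with correlations of size
    q_n^(-d/2), so it contributes an amount of order one to the sum of squares. Tail bounds, which
    lose logarithms, settle p > 2 but give nothing from below; hence the separate second moment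
    computation. The deviation threshold uses K = l^2 with l = log_4 q_n. This costs a factor l^2,
    while exp(-l^2) beats the powers of |M_{n+1}| that occur. Such a gain is required twice: in the
    union over all t, and in the variance estimate, where only trivial bounds hold on the
    exceptional event. What a zone shows at its own level has to survive the passage to the limit.
    The errors of successive levels at least halve, so their sum is controlled by the first one. The
    error of the level after the zone, squared and multiplied by |M_{n+1}|, tends to 0, since
    [log4q] at n + 1 is at least |M_{n+1}|. *)

Section FiniteAverage.
Variable K : numFieldType.
Implicit Types T : finType.

Definition avg T (X : T -> K) : K := (\sum_t X t) / #|T|%:R.

Lemma eq_avg T (X Y : T -> K) : X =1 Y -> avg X = avg Y.
Proof. by move=> eqXY; rewrite /avg (eq_bigr Y). Qed.

Lemma avgD T (X Y : T -> K) : avg (fun t => X t + Y t) = avg X + avg Y.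
Proof. by rewrite /avg big_split mulrDl. Qed.

Lemma avgN T (X : T -> K) : avg (fun t => - X t) = - avg X.
Proof. by rewrite /avg sumrN mulNr. Qed.

Lemma avgB T (X Y : T -> K) : avg (fun t => X t - Y t) = avg X - avg Y.
Proof. by rewrite avgD avgN. Qed.

Lemma avgZ T (c : K) (X : T -> K) : avg (fun t => c * X t) = c * avg X.
Proof. by rewrite /avg -mulr_sumr mulrA. Qed.

Lemma avg_sum T (J : Type) (s : seq J) (P : pred J) (X : J -> T -> K) :
  avg (fun t => \sum_(j <- s | P j) X j t) = \sum_(j <- s | P j) avg (X j).
Proof. by rewrite /avg exchange_big mulr_suml. Qed.

Lemma exchange_avg T T' (X : T -> T' -> K) :
  avg (fun t => avg (X t)) = avg (fun t' => avg (X^~ t')).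
Proof.
rewrite /avg -!mulr_suml exchange_big /= -!mulrA; congr (_ * _).
by rewrite mulrC.
Qed.

Lemma card_gt0_neq0 T : (0 < #|T|)%N -> #|T|%:R != 0 :> K.
Proof. by move=> T0; rewrite pnatr_eq0 -lt0n. Qed.

Lemma avg_cst T (c : K) : (0 < #|T|)%N -> avg (fun _ : T => c) = c.
Proof.
move=> T0; rewrite /avg sumr_const -(mulr_natr c) mulfK //.
exact: card_gt0_neq0.
Qed.

Lemma ler_avg T (X Y : T -> K) : (forall t, X t <= Y t) -> avg X <= avg Y.
Proof.
by move=> le; rewrite /avg ler_wpM2r ?invr_ge0 ?ler0n //; apply: ler_sum.
Qed.

Lemma avg_ge0 T (X : T -> K) : (forall t, 0 <= X t) -> 0 <= avg X.
Proof. by move=> ge; rewrite /avg divr_ge0 ?ler0n ?sumr_ge0. Qed.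

Lemma avg_le_cst T (X : T -> K) c : (0 < #|T|)%N -> (forall t, X t <= c) ->
  avg X <= c.
Proof. by move=> T0 le; rewrite -[leRHS](avg_cst c T0); apply: ler_avg. Qed.

Lemma sum_avg T (X : T -> K) : (0 < #|T|)%N -> \sum_t X t = #|T|%:R * avg X.
Proof. by move=> T0; rewrite /avg mulrC divfK // card_gt0_neq0. Qed.

End FiniteAverage.

Section Resampling.
Variables (K : numFieldType) (I T : finType).
Hypothesis T_gt0 : (0 < #|T|)%N.
Local Notation W := {ffun I -> T}.
Implicit Types (X Y : W -> K) (i j : I) (w : W).

Definition upd w i (a : T) : W := [ffun j => if j == i then a else w j].

Lemma upd_id w i : upd w i (w i) = w.
Proof. by apply/ffunP => j; rewrite ffunE; case: eqP => [->|]. Qed.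

Lemma upd_upd w i a b : upd (upd w i a) i b = upd w i b.
Proof. by apply/ffunP => j; rewrite !ffunE; case: eqP. Qed.

Lemma updC w i j a b : i != j -> upd (upd w i a) j b = upd (upd w j b) i a.
Proof.
move=> ij; apply/ffunP => k; rewrite !ffunE.
by case: (eqVneq k j) => [->|//]; rewrite eq_sym (negPf ij).
Qed.

Lemma upd_eq w i a : upd w i a i = a.
Proof. by rewrite ffunE eqxx. Qed.

Lemma upd_neq w i j a : j != i -> upd w i a j = w j.
Proof. by move=> ji; rewrite ffunE (negPf ji). Qed.

Lemma card_ffun_gt0 : (0 < #|{: W}|)%N.
Proof. by rewrite card_ffun expn_gt0 T_gt0. Qed.

(* Conditional expectation given all the coordinates except the i-th. *)
Definition res i X : W -> K := fun w => avg (fun a => X (upd w i a)).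

Definition indep (V : Type) i (X : W -> V) := forall w a, X (upd w i a) = X w.

Lemma avg_res i X : avg (res i X) = avg X.
Proof.
rewrite /res exchange_avg /avg -mulr_suml exchange_big /=.
rewrite pair_big /= -[RHS](mulfK (card_gt0_neq0 K T_gt0)); congr (_ / _).
(* Exchanging the i-th coordinate with the resampled value is an involution of W * T, so both double
   sums have the same terms. *)
pose u (p : W * T) := (upd p.1 i p.2, p.1 i).
have uK : involutive u.
  by move=> [w a]; rewrite /u /= upd_upd upd_id upd_eq.
rewrite mulrAC; congr (_ / _).
rewrite (reindex_inj (inv_inj uK)) /=.
under eq_bigr do rewrite upd_upd upd_id.
rewrite -(pair_big predT predT (fun w _ => X w)) /=.
by under eq_bigr do rewrite sumr_const -(mulr_natr (X _)); rewrite mulr_suml.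
Qed.

Lemma res_indep i X : indep i X -> res i X =1 X.
Proof. by move=> iX w; rewrite /res (eq_avg (iX w)) avg_cst. Qed.

Lemma indep_res i X : indep i (res i X).
Proof. by move=> w a; apply: eq_avg => b; rewrite upd_upd. Qed.

Lemma indep_res2 i j X : indep i X -> indep i (res j X).
Proof.
case: (eqVneq i j) => [->|ij] iX w a; first exact: indep_res.
by apply: eq_avg => b; rewrite updC // iX.
Qed.

Lemma resC i j X : res i (res j X) = res j (res i X).
Proof.
case: (eqVneq i j) => [->//|ij].
apply/boolp.funext => w; rewrite /res exchange_avg.
by apply: eq_avg => a; apply: eq_avg => b; rewrite updC.
Qed.

Lemma resB i X Y w : res i (fun w => X w - Y w) w = res i X w - res i Y w.
Proof. by rewrite /res avgB. Qed.

Lemma res_mull i X Y w : indep i X ->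
  res i (fun w => X w * Y w) w = X w * res i Y w.
Proof.
by move=> iX; rewrite /res -avgZ; apply: eq_avg => a; rewrite iX.
Qed.

Lemma res_mulr i X Y w : indep i Y ->
  res i (fun w => X w * Y w) w = res i X w * Y w.
Proof.
move=> iY; rewrite mulrC -res_mull //; apply: eq_avg => a; exact: mulrC.
Qed.

Lemma avg_res0 i X : (forall w, res i X w = 0) -> avg X = 0.
Proof.
by move=> r0; rewrite -(avg_res i) (eq_avg r0) avg_cst // card_ffun_gt0.
Qed.

(** The coordinates of w are replaced by those of w' one at a time. *)
Lemma indep_all_cst (V : Type) (X : W -> V) :
  (forall i, indep i X) -> forall w w', X w = X w'.
Proof.
move=> iX w w'.
have H (s : seq I) : X [ffun j => if j \in s then w' j else w j] = X w.
  elim: s => [|i s <-]; first by congr X; apply/ffunP => j; rewrite ffunE.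
  rewrite -[RHS](iX i _ (w' i)); congr X; apply/ffunP => j.
  by rewrite !ffunE inE; case: eqP => [->|].
rewrite -(H (enum I)); congr X; apply/ffunP => j.
by rewrite ffunE mem_enum.
Qed.

Definition resl (s : seq I) X : W -> K := foldr res X s.

Lemma resl_cat_res s i X : resl s (res i X) = res i (resl s X).
Proof. by elim: s => //= j s ->; rewrite resC. Qed.

Lemma indep_resl s i X : i \in s -> indep i (resl s X).
Proof.
elim: s => //= j s IHs; rewrite inE => /predU1P[->|/IHs]; first exact: indep_res.
exact: indep_res2.
Qed.

Lemma avg_resl s X : avg (resl s X) = avg X.
Proof. by elim: s => //= i s IHs; rewrite avg_res. Qed.

Lemma reslB s X Y : resl s (fun w => X w - Y w) = (fun w => resl s X w - resl s Y w).
Proof.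
elim: s => //= i s ->; apply/boolp.funext => w; exact: resB.
Qed.

Lemma resl_enum X w : resl (enum I) X w = avg X.
Proof.
rewrite -(avg_resl (enum I) X).
have cst := @indep_all_cst _ (resl (enum I) X)
  (fun i => @indep_resl (enum I) i X (mem_enum I i)).
by rewrite (eq_avg (fun w' => cst w' w)) avg_cst // card_ffun_gt0.
Qed.

End Resampling.

(** * Exponential moments, Efron-Stein and Chebyshev inequalities *)

Section Concentration.
Variables (R : realType) (I T : finType).
Hypothesis T_gt0 : (0 < #|T|)%N.
Local Notation W := {ffun I -> T}.
Implicit Types (X Y : W -> R) (i j : I) (w : W).

Let W_gt0 : (0 < #|{: W}|)%N := card_ffun_gt0 I T_gt0.

Definition pr (A : pred W) : R := avg (fun w => (A w)%:R).

Lemma prS (A B : pred W) : (forall w, A w -> B w) -> pr A <= pr B.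
Proof. by move=> AB; apply: ler_avg => w; rewrite ler_nat; case: (A w) (AB w) => //= ->. Qed.

Lemma prU (A B : pred W) : pr (fun w => A w || B w) <= pr A + pr B.
Proof.
rewrite /pr -avgD; apply: ler_avg => w; rewrite -natrD ler_nat.
by case: (A w); case: (B w).
Qed.

Lemma pr_exists (J : finType) (A : J -> pred W) :
  pr (fun w => [exists j, A j w]) <= \sum_j pr (A j).
Proof.
rewrite /pr -avg_sum; apply: ler_avg => w.
case: existsP => [[j Aj]|_]; last by rewrite sumr_ge0.
by rewrite (bigD1 j) //= Aj lerDl sumr_ge0.
Qed.

Lemma markov_avg X (c : R) (A : pred W) : 0 < c -> (forall w, 0 <= X w) ->
  (forall w, A w -> c <= X w) -> pr A <= avg X / c.
Proof.
move=> c0 X0 AX; rewrite ler_pdivlMr // mulrC -avgZ; apply: ler_avg => w.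
by case: (boolP (A w)) => [/AX|_]; rewrite ?mulr1 ?mulr0.
Qed.

Lemma avg_sqr_le (S : finType) (X : S -> R) : (0 < #|S|)%N ->
  avg X ^+ 2 <= avg (fun s => X s ^+ 2).
Proof.
move=> S0; have : 0 <= avg (fun s => (X s - avg X) ^+ 2).
  by apply: avg_ge0 => s; apply: sqr_ge0.
have -> : avg (fun s => (X s - avg X) ^+ 2) =
          avg (fun s => X s ^+ 2 - ((2 * avg X) * X s - avg X ^+ 2)).
  by apply: eq_avg => s; ring.
by rewrite !avgB avgZ avg_cst //; nra.
Qed.

(** From exp(-x) >= 1 - x one gets exp(x) <= 1 / (1 - x), and (1 - x)(1 + x + 2x^2) = 1 + x^2 (1 -
    2x) >= 1. There is no lower restriction on x. *)
Lemma expR_le_quad (x : R) : x <= 2^-1 -> expR x <= 1 + x + 2 * x ^+ 2.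
Proof.
move=> x_le; have x1 : 0 < 1 - x by lra.
have := expR_ge1Dx (- x); rewrite expRN => h.
have : expR x <= (1 - x)^-1 by rewrite -[expR x]invrK lef_pV2 ?posrE ?invr_gt0 ?expR_gt0.
move=> /le_trans; apply; rewrite -[leLHS]mul1r ler_pdivrMr //.
have : 0 <= x ^+ 2 * (1 - 2 * x) by rewrite mulr_ge0 ?sqr_ge0 //; lra.
nra.
Qed.

(** Among the coordinates of s, the term Z i depends on the i-th alone; it may depend on those
    outside s in any way, and they act as frozen. Averaging over one coordinate of s at a time
    splits off one factor, bounded by [expR_le_quad] since the linear term averages to 0. *)
Lemma avg_expR_sum (s : seq I) (Z : I -> W -> R) (c theta : R) :
  uniq s -> 0 <= theta -> theta * c <= 2^-1 ->
  (forall i, i \in s -> forall w, `|Z i w| <= c) ->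
  (forall i, i \in s -> forall w, res i (Z i) w = 0) ->
  (forall i j, i \in s -> j \in s -> j != i -> indep j (Z i)) ->
  avg (fun w => expR (theta * \sum_(i <- s) Z i w)) <=
    expR (2 * theta ^+ 2 * c ^+ 2 * (size s)%:R).
Proof.
move=> + th0 thc; elim: s => [|i s IHs] /=.
  move=> _ _ _ _; rewrite mulr0 expR0 avg_le_cst // => w.
  by rewrite big_nil mulr0 expR0.
move=> /andP[i_s us] Zc Z0 Zi.
have ins j : j \in s -> j \in i :: s by rewrite inE orbC => ->.
rewrite -(avg_res T_gt0 i).
have le w : res i (fun w => expR (theta * \sum_(j <- i :: s) Z j w)) w <=
    expR (2 * theta ^+ 2 * c ^+ 2) * expR (theta * \sum_(j <- s) Z j w).
  have -> : (fun w => expR (theta * \sum_(j <- i :: s) Z j w)) =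
    (fun w => expR (theta * Z i w) * expR (theta * \sum_(j <- s) Z j w)).
    by apply/boolp.funext => v; rewrite big_cons mulrDr expRD.
  rewrite res_mulr => [|v a]; last first.
    congr (expR (_ * _)); apply: eq_big_seq => j js.
    by apply: Zi; rewrite ?inE ?eqxx ?js ?orbT //; apply: contraNneq i_s => ->.
  rewrite ler_wpM2r ?expR_ge0 //.
  apply: (@le_trans _ _ (avg (fun a => 1 + theta * Z i (upd w i a) + 2 * theta ^+ 2 * c ^+ 2))).
    apply: ler_avg => a; have Zle := Zc i (mem_head _ _) (upd w i a).
    have c0 : 0 <= c := le_trans (normr_ge0 _) Zle.
    move: Zle; set z := Z i _ => Zle.
    have zz : theta * z <= 2^-1.
      by rewrite (le_trans _ thc) // ler_wpM2l // (le_trans (ler_norm _)).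
    rewrite (le_trans (expR_le_quad zz)) // lerD2l exprMn mulrA ler_wpM2l //.
      by rewrite mulr_ge0 ?sqr_ge0.
    by rewrite -ler_sqrt ?sqr_ge0 // !sqrtr_sqr (ger0_norm c0).
  rewrite !avgD avgZ !avg_cst // -/(res i (Z i) w) Z0 ?mem_head // mulr0 addr0.
  exact: expR_ge1Dx.
apply: le_trans (ler_avg le) _; rewrite avgZ.
have -> : (size s).+1%:R = 1 + (size s)%:R :> R by rewrite -natr1 addrC.
rewrite mulrDr mulr1 expRD ler_wpM2l ?expR_ge0 //.
apply: IHs => // [j /ins|j /ins|j k /ins js /ins ks]; [exact: Zc|exact: Z0|exact: Zi].
Qed.

Lemma res_sqr_le i X : avg (fun w => res i X w ^+ 2) <= avg (fun w => X w ^+ 2).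
Proof.
rewrite -[leRHS](avg_res T_gt0 i); apply: ler_avg => w; exact: avg_sqr_le.
Qed.

Lemma resl_sqr_le s X : avg (fun w => resl s X w ^+ 2) <= avg (fun w => X w ^+ 2).
Proof.
elim: s => [|i s IHs] //=; apply: le_trans IHs; exact: res_sqr_le.
Qed.

Lemma avg_sqrB_res i X : avg (fun w => (X w - res i X w) ^+ 2) =
  avg (fun w => X w ^+ 2) - avg (fun w => res i X w ^+ 2).
Proof.
have -> : avg (fun w => (X w - res i X w) ^+ 2) =
          avg (fun w => X w ^+ 2 - (2 * (res i X w * X w) - res i X w ^+ 2)).
  by apply: eq_avg => w; ring.
rewrite !avgB avgZ -(avg_res T_gt0 i (fun w => res i X w * X w)).
rewrite (eq_avg (fun w => res_mull _ w (@indep_res _ _ _ i X))).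
have -> : avg (fun w => res i X w * res i X w) = avg (fun w => res i X w ^+ 2).
  by apply: eq_avg => w; rewrite expr2.
by ring.
Qed.

(** Averaging out the coordinates one after the other, the second moment falls from that of X to the
    square of its mean. Since [res] contracts in mean square and commutes with itself, the loss at i
    is at most the mean square of X - res i X. As res i X is the best approximation of X not
    depending on i, any such function [X0 i] can take its place. *)
Lemma efron_stein X (X0 : I -> W -> R) : (forall i, indep i (X0 i)) ->
  avg (fun w => (X w - avg X) ^+ 2) <= \sum_i avg (fun w => (X w - X0 i w) ^+ 2).
Proof.
move=> iX0.
have step i : avg (fun w => (X w - res i X w) ^+ 2) <= avg (fun w => (X w - X0 i w) ^+ 2).
  pose V w := X w - X0 i w.
  have -> : avg (fun w => (X w - res i X w) ^+ 2) = avg (fun w => (V w - res i V w) ^+ 2).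
    apply: eq_avg => w; rewrite /V resB (res_indep T_gt0 (iX0 i)).
    by congr (_ ^+ 2); ring.
  rewrite avg_sqrB_res lerBlDr lerDl; apply: avg_ge0 => w; exact: sqr_ge0.
have tele s : avg (fun w => X w ^+ 2) - avg (fun w => resl s X w ^+ 2) <=
    \sum_(i <- s) avg (fun w => (X w - res i X w) ^+ 2).
  elim: s => [|i s IHs]; first by rewrite big_nil subrr.
  rewrite big_cons /= -(subrK (avg (fun w => resl s X w ^+ 2)) (avg _)) -addrA addrC.
  apply: lerD => //; rewrite -avg_sqrB_res -resl_cat_res.
  apply: le_trans (resl_sqr_le s _).
  by rewrite reslB.
have := tele (enum I); rewrite big_enum /= => le1.
have {}le1 := le_trans le1 (ler_sum _ (fun i _ => step i)).
apply: le_trans le1.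
have -> : avg (fun w => resl (enum I) X w ^+ 2) = avg X ^+ 2.
  by rewrite -[RHS](avg_cst _ W_gt0); apply: eq_avg => w; rewrite resl_enum.
have -> : avg (fun s => (X s - avg X) ^+ 2) =
          avg (fun s => X s ^+ 2 - ((2 * avg X) * X s - avg X ^+ 2)).
  by apply: eq_avg => s; ring.
by rewrite !avgB avgZ avg_cst //; nra.
Qed.

Lemma chebyshev_lower X (mu0 V : R) : 0 < mu0 -> mu0 <= avg X ->
  avg (fun w => (X w - avg X) ^+ 2) <= V ->
  pr (fun w => X w < mu0 / 2) <= 4 * V / mu0 ^+ 2.
Proof.
move=> mu0_gt0 le_mu leV.
(* Only a lower bound of the mean is known; X < mu0 / 2 still puts X at distance at least mu0 / 2
   from its mean. *)
have := @markov_avg (fun w => (X w - avg X) ^+ 2) (mu0 ^+ 2 / 4)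
  (fun w => X w < mu0 / 2).
move=> /(_ _ (fun w => sqr_ge0 _)) h.
apply: le_trans (h _ _) _; first by rewrite divr_gt0 ?exprn_gt0.
  by move=> w /= lt; nra.
rewrite [leRHS](_ : _ = V / (mu0 ^+ 2 / 4)); last by field; rewrite gt_eqF.
by rewrite ler_wpM2r // invr_ge0 divr_ge0 // sqr_ge0.
Qed.

End Concentration.

Arguments pr {R I T} A.
Arguments prU {R I T} A B.
Arguments pr_exists {R I T J} A.

Notation nc := Normc.normc.

(** * Real and imaginary parts and moduli of complex sums *)

Section ComplexFacts.
Variable R : realType.
Implicit Types x y z : R[i].
Local Notation Re := (@complex.Re R).
Local Notation Im := (@complex.Im R).

Lemma ReD x y : Re (x + y) = Re x + Re y. Proof. by case: x y => [? ?] []. Qed.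
Lemma ImD x y : Im (x + y) = Im x + Im y. Proof. by case: x y => [? ?] []. Qed.
Lemma ReN x : Re (- x) = - Re x. Proof. by case: x. Qed.
Lemma ImN x : Im (- x) = - Im x. Proof. by case: x. Qed.

(** Stated for an arbitrary additive [ell] because the tail bounds are proved once and then applied
    to Re, -Re, Im and -Im. *)
Lemma additive_sum (ell : R[i] -> R) : (forall x y, ell (x + y) = ell x + ell y) ->
  forall (J : Type) (s : seq J) (P : pred J) (G : J -> R[i]),
  ell (\sum_(j <- s | P j) G j) = \sum_(j <- s | P j) ell (G j).
Proof.
move=> ellD J s P G.
have ell0 : ell 0 = 0 by have := ellD 0 0; rewrite addr0 => h; lra.
exact: (big_morph ell ellD ell0).
Qed.

Lemma Re_sum (J : Type) (s : seq J) (P : pred J) (G : J -> R[i]) :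
  Re (\sum_(j <- s | P j) G j) = \sum_(j <- s | P j) Re (G j).
Proof. exact: (additive_sum ReD). Qed.

Lemma Im_sum (J : Type) (s : seq J) (P : pred J) (G : J -> R[i]) :
  Im (\sum_(j <- s | P j) G j) = \sum_(j <- s | P j) Im (G j).
Proof. exact: (additive_sum ImD). Qed.

Lemma natCE n : (n%:R : R[i]) = Complex (n%:R : R) 0.
Proof. by elim: n => // n IHn; rewrite -!natr1 IHn /= [LHS]/(_ + _) /= addr0. Qed.

Lemma divnCE z n : z / n%:R = Complex (Re z / n%:R) (Im z / n%:R).
Proof.
case: n => [|n]; first by rewrite !invr0 !mulr0.
apply: (@mulIf _ (n.+1%:R)); first by rewrite pnatr_eq0.
rewrite divfK ?pnatr_eq0 // natCE; case: z => a b /=.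
rewrite [RHS]/(_ * _) /= !mulr0 subr0 add0r !divfK ?pnatr_eq0 //.
Qed.

Lemma Re_avg (T : finType) (X : T -> R[i]) : Re (avg X) = avg (fun t => Re (X t)).
Proof. by rewrite /avg divnCE /= Re_sum. Qed.

Lemma Im_avg (T : finType) (X : T -> R[i]) : Im (avg X) = avg (fun t => Im (X t)).
Proof. by rewrite /avg divnCE /= Im_sum. Qed.

Lemma conjc_sum (J : Type) (s : seq J) (P : pred J) (G : J -> R[i]) :
  conjc (\sum_(j <- s | P j) G j) = \sum_(j <- s | P j) conjc (G j).
Proof. exact: raddf_sum. Qed.

Lemma conjcM x y : conjc (x * y) = conjc x * conjc y.
Proof. exact: rmorphM. Qed.

Lemma avg_conjc (T : finType) (X : T -> R[i]) :
  avg (fun t => conjc (X t)) = conjc (avg X).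
Proof.
rewrite /avg -conjc_sum !divnCE; case: (\sum_t X t) => a b /=.
by rewrite mulNr.
Qed.

Lemma nc_sqr z : nc z ^+ 2 = Re z ^+ 2 + Im z ^+ 2.
Proof. by case: z => a b /=; rewrite sqr_sqrtr // addr_ge0 ?sqr_ge0. Qed.

Lemma nc_ge0 z : 0 <= nc z.
Proof. by case: z => a b /=; rewrite sqrtr_ge0. Qed.

Lemma nc_sqrE z : nc z ^+ 2 = Re (z * conjc z).
Proof. by rewrite nc_sqr; case: z => a b /=; ring. Qed.

Lemma mul_conjc z : z * conjc z = Complex (nc z ^+ 2) 0.
Proof.
by rewrite nc_sqr; case: z => a b /=; rewrite [LHS]/(_ * _) /=; congr Complex; ring.
Qed.

Lemma ncJ z : nc (conjc z) = nc z.
Proof. by case: z => a b /=; rewrite sqrrN. Qed.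

Lemma Re_le_nc z : `|Re z| <= nc z.
Proof.
rewrite -ler_sqr ?nnegrE ?nc_ge0 // nc_sqr real_normK ?num_real //.
by rewrite lerDl sqr_ge0.
Qed.

Lemma Im_le_nc z : `|Im z| <= nc z.
Proof.
rewrite -ler_sqr ?nnegrE ?nc_ge0 // nc_sqr real_normK ?num_real //.
by rewrite lerDr sqr_ge0.
Qed.

Lemma nc_le_ReIm z : nc z <= `|Re z| + `|Im z|.
Proof.
rewrite -ler_sqr ?nnegrE ?nc_ge0 ?addr_ge0 // nc_sqr sqrrD.
rewrite !real_normK ?num_real // addrAC lerDl.
by rewrite mulrn_wge0 // mulr_ge0.
Qed.

Lemma ncM x y : nc (x * y) = nc x * nc y.
Proof. exact: Normc.normcM. Qed.

Lemma nc0 : nc (0 : R[i]) = 0. Proof. exact: Normc.normc0. Qed.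

Lemma ncD x y : nc (x + y) <= nc x + nc y.
Proof. exact: le_normcD. Qed.

Lemma ncN x : nc (- x) = nc x.
Proof. exact: normcN. Qed.

Lemma nc_nat n : nc (n%:R : R[i]) = n%:R.
Proof. by rewrite natCE /= expr0n /= addr0 sqrtr_sqr ger0_norm. Qed.

Lemma nc_eq0 z : (nc z == 0) = (z == 0).
Proof. by apply/eqP/eqP => [/Normc.eq0_normc //|->]; exact: nc0. Qed.

Lemma nc_sum (J : Type) (s : seq J) (P : pred J) (G : J -> R[i]) :
  nc (\sum_(j <- s | P j) G j) <= \sum_(j <- s | P j) nc (G j).
Proof.
elim/big_ind2: _ => [|x u y v hx hy|//]; first by rewrite nc0.
by rewrite (le_trans (ncD _ _)) // lerD.
Qed.

Lemma nc_sum_le (J : finType) (P : pred J) (G : J -> R[i]) c :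
  (forall j, P j -> nc (G j) <= c) -> nc (\sum_(j | P j) G j) <= #|P|%:R * c.
Proof.
move=> le; rewrite (le_trans (nc_sum _ _ _)) // (le_trans (ler_sum _ le)) //.
by rewrite sumr_const mulr_natl.
Qed.

Lemma nc_avg_le (J : finType) (G : J -> R[i]) c : (0 < #|J|)%N ->
  (forall j, nc (G j) <= c) -> nc (avg G) <= c.
Proof.
move=> J0 le; have Jp : 0 < #|J|%:R :> R by rewrite ltr0n.
rewrite /avg ncM Normc.normcV nc_nat ler_pdivrMr // mulrC.
by apply: (@nc_sum_le J predT) => j _.
Qed.

(** Cauchy-Schwarz against the constant 1, obtained from the sum of the squares (n G_j - S)^2. *)
Lemma sqr_sum_le (J : finType) (P : pred J) (G : J -> R) :
  (\sum_(j | P j) G j) ^+ 2 <= #|P|%:R * \sum_(j | P j) G j ^+ 2.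
Proof.
set n := #|P|%:R; have [n0|n0] := eqVneq (#|P|) 0%N.
  by rewrite /n n0 mul0r big1 ?expr0n // => j Pj; move: n0; rewrite (cardD1 j) unfold_in Pj.
have np : 0 < n by rewrite ltr0n lt0n.
set S := \sum_(j | P j) G j.
have : 0 <= \sum_(j | P j) (n * G j - S) ^+ 2 by apply: sumr_ge0 => j _; apply: sqr_ge0.
have -> : \sum_(j | P j) (n * G j - S) ^+ 2 =
  n ^+ 2 * (\sum_(j | P j) G j ^+ 2) - 2 * n * S * S + n * S ^+ 2.
  rewrite mulr_sumr [2 * n * S * S]mulrC [X in X * _](_ : S = \sum_(j | P j) G j) //.
  rewrite mulr_suml -sumrB (_ : n * S ^+ 2 = \sum_(j | P j) S ^+ 2); last first.
    by rewrite sumr_const mulr_natl.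
  by rewrite -big_split /=; apply: eq_bigr => j _; ring.
move=> h; have : 0 <= n * (n * (\sum_(j | P j) G j ^+ 2) - S ^+ 2) by nra.
by rewrite pmulr_rge0 // subr_ge0.
Qed.

Lemma nc_sum_sqr_le (J : finType) (P : pred J) (G : J -> R[i]) :
  nc (\sum_(j | P j) G j) ^+ 2 <= #|P|%:R * \sum_(j | P j) nc (G j) ^+ 2.
Proof.
apply: le_trans (sqr_sum_le P (fun j => nc (G j))).
by rewrite ler_sqr ?nnegrE ?nc_ge0 ?sumr_ge0 //; [exact: nc_sum|move=> ? _; exact: nc_ge0].
Qed.

End ComplexFacts.

Section ConvexExp.
Variable R : realType.

(** Jensen's inequality, from the tangent line of exp at the mean. *)
Lemma expR_avg_le (T : finType) (X : T -> R) : (0 < #|T|)%N ->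
  expR (avg X) <= avg (fun t => expR (X t)).
Proof.
move=> T0; set a := avg X.
have -> : expR a = avg (fun t => expR a * (1 + (X t - a))).
  rewrite avgZ avgD avgB !avg_cst // -/a; ring.
apply: ler_avg => t; rewrite [in leRHS](_ : X t = a + (X t - a)); last by ring.
by rewrite expRD ler_wpM2l ?expR_ge0 // expR_ge1Dx.
Qed.

Lemma avg_bool_split (I : finType) (i j : I) :
  avg (fun B : {ffun I -> bool} => ((B i && ~~ B j)%:R : R)) =
  if i == j then 0 else 4^-1.
Proof.
have b0 : (0 < #|{: bool}|)%N by rewrite card_bool.
case: eqVneq => [->|ij].
  rewrite -[RHS](@avg_cst _ {ffun I -> bool}) ?card_ffun_gt0 //.
  by apply: eq_avg => B; rewrite andbN.
rewrite -(avg_res b0 i) -(avg_res b0 j).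
rewrite -[RHS](@avg_cst _ {ffun I -> bool}) ?card_ffun_gt0 //.
apply: eq_avg => B; rewrite /res /avg !big_bool !card_bool.
have ji : j != i by rewrite eq_sym.
rewrite !upd_eq !(upd_neq _ _ ji) !upd_eq /=.
by field.
Qed.

End ConvexExp.

(** * Random sums over blocks *)

Section BlockModel.
Variables (R : realType) (Y M : finZmodType) (I : finType).
Variables (pi : Y -> M) (b : Y -> I) (F : M -> R[i]).
Local Notation W := {ffun I -> M}.

(* One level of the tower, abstractly: Y = M_{n+1}, M = M_n, [pi] is reduction
   mod h_n, [b y] is the block gamma_n(y), and w is the family of the
   alpha_{n,gamma}; [block_lift w] is then F o phi_n. *)
Definition block_lift (w : W) (y : Y) : R[i] := F (pi y + w (b y)).

Definition block_term (w : W) (t y : Y) : R[i] := block_lift w (y + t) * conjc (block_lift w y).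

Definition offblock_sum (w : W) (t : Y) : R[i] :=
  \sum_(y | b (y + t) != b y) block_term w t y.

Definition inblock_sum (w : W) (t : Y) : R[i] :=
  \sum_(y | b (y + t) == b y) block_term w t y.

Definition block_sum (w : W) (t : Y) : R[i] := \sum_y block_term w t y.

Definition autocorr (s : M) : R[i] := avg (fun a => F (a + s) * conjc (F a)).

Definition near_count (t : Y) : nat := #|[pred y | b (y + t) == b y]|.

(** The two sums are compared with their means: points in different blocks carry independent
    parameters and give 0, points in the same block share theirs and give [autocorr (pi t)] each.
    One event covers all t. *)
Definition deviates (E : R) (w : W) : bool :=
  [exists t : Y, (E < nc (offblock_sum w t)) ||
     (E < nc (inblock_sum w t - (near_count t)%:R * autocorr (pi t)))].

Lemma block_sumE w t : block_sum w t = inblock_sum w t + offblock_sum w t.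
Proof. by rewrite /block_sum (bigID (fun y => b (y + t) == b y)). Qed.

Variables (C : R) (m : nat).
Hypothesis piD : {morph pi : x y / x + y}.
Hypothesis C_gt0 : 0 < C.
Hypothesis F_le : forall a, nc (F a) <= C.
Hypothesis F_mean0 : \sum_a F a = 0.
Hypothesis fiber_le : forall i, (#|[pred y | b y == i]| <= m)%N.
Hypothesis m_gt0 : (0 < m)%N.

Let M_gt0 : (0 < #|{: M}|)%N.
Proof. by apply/card_gt0P; exists 0. Qed.

Let W_gt0 : (0 < #|{: W}|)%N := card_ffun_gt0 I M_gt0.

Lemma sum_shift (s : M) : \sum_a F (s + a) = 0.
Proof. by rewrite -[RHS]F_mean0 [RHS](reindex_inj (addrI s)). Qed.

Lemma autocorr_le s : nc (autocorr s) <= C ^+ 2.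
Proof.
apply: nc_avg_le => // a; rewrite ncM ncJ expr2.
by rewrite ler_pM ?nc_ge0.
Qed.

Lemma block_lift_le w y : nc (block_lift w y) <= C.
Proof. exact: F_le. Qed.

Lemma block_term_le w t y : nc (block_term w t y) <= C ^+ 2.
Proof. by rewrite /block_term ncM ncJ expr2 ler_pM ?nc_ge0 ?block_lift_le. Qed.

Lemma block_lift_upd_neq w i a y : b y != i -> block_lift (upd w i a) y = block_lift w y.
Proof. by move=> yi; rewrite /block_lift upd_neq. Qed.

Lemma block_lift_upd_eq w i a y : b y = i -> block_lift (upd w i a) y = F (pi y + a).
Proof. by move=> yi; rewrite /block_lift yi upd_eq. Qed.

Section Tail.
Variable ell : R[i] -> R.
Hypothesis ellD : forall x y, ell (x + y) = ell x + ell y.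
Hypothesis ell_le : forall z, `|ell z| <= nc z.
Variable K : R.

Let N := #|I|.
Let c := 4 * m%:R * C ^+ 2.
Let theta := (2 * c * Num.sqrt N%:R)^-1.

Let ell0 : ell 0 = 0.
Proof. by have := ellD 0 0; rewrite addr0 => h; lra. Qed.

Let c_gt0 : 0 < c.
Proof. by rewrite /c !mulr_gt0 ?ltr0n ?exprn_gt0. Qed.

(** J is the space of random splittings; Jensen's inequality takes the average over J out of the
    exponential. The value of [theta] makes the exponential moment at most exp(1/2), as [s B] has at
    most N elements, and turns the threshold into K. *)
Lemma tail_bound (J : finType) (s : J -> seq I) (Z : J -> I -> W -> R) (V : W -> R) :
  (0 < #|J|)%N -> (0 < #|I|)%N ->
  (forall w, V w = avg (fun B => \sum_(i <- s B) Z B i w)) ->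
  (forall B, uniq (s B)) ->
  (forall B i, i \in s B -> forall w, `|Z B i w| <= c) ->
  (forall B i, i \in s B -> forall w, res i (Z B i) w = 0) ->
  (forall B i j, i \in s B -> j \in s B -> j != i -> indep j (Z B i)) ->
  pr (fun w => 2 * c * Num.sqrt N%:R * K < V w) <= expR (2^-1 - K).
Proof.
move=> J0 I0 VE us Zc Z0 Zi.
have rt_gt0 : 0 < Num.sqrt N%:R :> R by rewrite sqrtr_gt0 ltr0n.
have rt_ge1 : 1 <= Num.sqrt N%:R :> R by rewrite -[leLHS]sqrtr1 ler_sqrt ?ler1n.
have th_gt0 : 0 < theta.
  by rewrite /theta invr_gt0; apply: mulr_gt0 => //; apply: mulr_gt0.
have := @markov_avg R I M (fun w => expR (theta * V w)) (expR K)
  (fun w => 2 * c * Num.sqrt N%:R * K < V w) (expR_gt0 _) (fun w => expR_ge0 _).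
move=> /(_ _) h; apply: le_trans (h _) _.
  move=> w /= lt; rewrite ler_expR -ler_pdivrMl // /theta invrK; exact: ltW.
rewrite expRD expRN ler_wpM2r ?invr_ge0 ?expR_ge0 //.
apply: (@le_trans _ _ (avg (fun B => avg (fun w => expR (theta * \sum_(i <- s B) Z B i w))))).
  rewrite exchange_avg; apply: ler_avg => w; rewrite VE -avgZ.
  exact: expR_avg_le.
apply: avg_le_cst => // B.
apply: le_trans (avg_expR_sum M_gt0 (us B) (ltW th_gt0) _ (Zc B) (Z0 B) (Zi B)) _.
  have -> : theta * c = (2 * Num.sqrt N%:R)^-1.
    by rewrite /theta; field; rewrite !gt_eqF.
  by rewrite lef_pV2 ?posrE ?mulr_gt0 // -[leLHS]mulr1 ler_wpM2l.
rewrite ler_expR.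
have -> : 2 * theta ^+ 2 * c ^+ 2 * (size (s B))%:R = (size (s B))%:R / N%:R / 2.
  rewrite /theta exprVn exprMn sqr_sqrtr ?ler0n // exprMn.
  have cn : c != 0 by rewrite gt_eqF.
  have Nn : N%:R != 0 :> R by rewrite pnatr_eq0 -lt0n.
  by field; rewrite Nn cn.
rewrite -[leRHS]mul1r ler_wpM2r ?invr_ge0 // ler_pdivrMr ?ltr0n // mul1r ler_nat.
by rewrite -(card_uniqP (us B)) max_card.
Qed.

Lemma ell_sum_le (P : pred Y) (G : Y -> R[i]) i (e : R) : 0 <= e ->
  (forall y, P y -> b y = i) -> (forall y, P y -> nc (G y) <= e) ->
  `|ell (\sum_(y | P y) G y)| <= m%:R * e.
Proof.
move=> e0 Pi Ge; rewrite (le_trans (ell_le _)) // (le_trans (nc_sum_le Ge)) //.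
rewrite ler_wpM2r // ler_nat (leq_trans _ (fiber_le i)) //.
by apply: subset_leq_card; apply/fintype.subsetP => y Py; rewrite inE; apply/eqP/Pi.
Qed.

(* Decoupling: a pair of distinct blocks is split by a random set B of blocks with
   probability 1/4. Given the parameters outside B, the contributions of the
   blocks in B are independent and centred, which is what [tail_bound] uses. *)
Lemma tail_ne t : (0 < #|I|)%N ->
  pr (fun w => 2 * c * Num.sqrt N%:R * K < ell (offblock_sum w t)) <= expR (2^-1 - K).
Proof.
move=> I0.
pose J := {ffun I -> bool}.
pose s (B : J) := [seq i <- enum I | B i].
pose P (B : J) i := [pred y | (b y == i) && ~~ B (b (y + t))].
pose Z (B : J) i w := 4 * ell (\sum_(y | P B i y) block_term w t y).
have b0 : (0 < #|{: bool}|)%N by rewrite card_bool.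
apply: (@tail_bound J s Z).
- exact: card_ffun_gt0.
- by [].
- move=> w.
  have SE B : \sum_(i <- s B) Z B i w =
     \sum_y (4 * ell (block_term w t y)) * (B (b y) && ~~ B (b (y + t)))%:R.
    rewrite /s big_filter big_enum_cond /Z /=.
    under eq_bigr => i Bi do rewrite (additive_sum ellD) mulr_sumr.
    rewrite (exchange_big_dep predT) //=; apply: eq_bigr => y _.
    case: (boolP (B (b y) && ~~ B (b (y + t)))) => [/andP[By Byt]|nB].
      rewrite (big_pred1 (b y)) ?mulr1 // => i /=.
      rewrite Byt andbT; case: (eqVneq i (b y)) => [->|ne].
        by rewrite By.
      by rewrite andbF.
    rewrite mulr0 big_pred0 // => i; apply: contraNF nB.
    by case/and3P=> Bi /eqP -> ->; rewrite Bi.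
  rewrite (eq_avg SE) avg_sum /offblock_sum (additive_sum ellD) big_mkcond.
  apply: eq_bigr => y _; rewrite avgZ avg_bool_split eq_sym.
  by case: eqP => _ /=; [rewrite mulr0|field].
- by move=> B; rewrite filter_uniq ?enum_uniq.
- move=> B i _ w; rewrite /Z normrM ger0_norm // /c -mulrA ler_wpM2l //.
  apply: (@ell_sum_le _ _ i); first exact: sqr_ge0.
    by move=> y /andP[/eqP].
  by move=> y _; exact: block_term_le.
- move=> B i; rewrite mem_filter => /andP[Bi _] w.
  rewrite /res /Z avgZ /avg -(additive_sum ellD) exchange_big big1 ?ell0 ?mul0r ?mulr0 //=.
  move=> y /andP[/eqP yi Byt].
  have yti : b (y + t) != i by apply: contraNneq Byt => ->.
  under eq_bigr do rewrite /block_term (block_lift_upd_neq _ _ yti) (block_lift_upd_eq _ _ yi).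
  by rewrite -mulr_sumr -conjc_sum sum_shift conjc0 mulr0.
- move=> B i j; rewrite !mem_filter => /andP[Bi _] /andP[Bj _] ji w a.
  rewrite /Z; congr (4 * ell _); apply: eq_bigr => y /andP[/eqP yi Byt].
  rewrite /block_term !block_lift_upd_neq //; first by rewrite yi eq_sym.
  by apply: contraNneq Byt => ->.
Qed.

Lemma tail_eq t : (0 < #|I|)%N ->
  pr (fun w => 2 * c * Num.sqrt N%:R * K <
    ell (inblock_sum w t - (near_count t)%:R * autocorr (pi t))) <= expR (2^-1 - K).
Proof.
move=> I0.
pose P i := [pred y | (b y == i) && (b (y + t) == i)].
pose Z (_ : unit) i w := ell (\sum_(y | P i y) (block_term w t y - autocorr (pi t))).
apply: (@tail_bound unit (fun _ => enum I) Z).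
- by rewrite card_unit.
- by [].
- move=> w; rewrite /Z /= avg_cst ?card_unit // big_enum /=.
  rewrite -(additive_sum ellD); congr ell.
  rewrite (exchange_big_dep (fun y => b (y + t) == b y)) /=; last first.
    by move=> i y _ /andP[/eqP -> /eqP ->].
  rewrite /inblock_sum /near_count -sum1_card natr_sum mulr_suml -sumrB.
  apply: eq_big => y; first by [].
  move=> /eqP yty; rewrite (big_pred1 (b y)) ?mul1r // => i /=.
  by rewrite /= yty andbb eq_sym.
- by move=> _; rewrite enum_uniq.
- move=> B i _ w; apply: le_trans (@ell_sum_le _ _ i (4 * C ^+ 2) _ _ _) _.
  + by rewrite mulr_ge0 ?sqr_ge0.
  + by move=> y /andP[/eqP].
  + move=> y _; rewrite (le_trans (ncD _ _)) // ncN.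
    have h1 := block_term_le w t y; have h2 := autocorr_le (pi t).
    by apply: le_trans (lerD h1 h2) _; have := sqr_ge0 C; lra.
  + by rewrite /c le_eqVlt; apply/orP; left; apply/eqP; ring.
- move=> B i _ w; rewrite /res /Z /avg -(additive_sum ellD) exchange_big.
  rewrite big1 ?ell0 ?mul0r //= => y /andP[/eqP yi /eqP yti].
  rewrite sumrB sumr_const -mulr_natl -sum_avg //.
  under eq_bigr do rewrite /block_term (block_lift_upd_eq _ _ yi) (block_lift_upd_eq _ _ yti).
  apply/eqP; rewrite subr_eq0; apply/eqP.
  rewrite [RHS](reindex_inj (addrI (pi y))) /=; apply: eq_bigr => a _.
  by rewrite piD -!addrA (addrC a).
- move=> B i j _ _ ji w a; rewrite /Z; congr (ell _).
  apply: eq_bigr => y /andP[/eqP yi /eqP yti].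
  by rewrite /block_term !block_lift_upd_neq // ?yi ?yti eq_sym.
Qed.

End Tail.

Lemma nc_gt_split (z : R[i]) (l : R) : 2 * l < nc z ->
  [|| l < complex.Re z, l < - complex.Re z, l < complex.Im z | l < - complex.Im z].
Proof.
move=> lt; apply/negPn; rewrite !negb_or -!leNgt; apply/negP => /and4P[h1 h2 h3 h4].
have := nc_le_ReIm z; apply/negP; rewrite -ltNge.
apply: le_lt_trans lt; rewrite mulr_natl mulr2n lerD // ler_norml.
  by rewrite h1 andbT lerNl.
by rewrite h3 andbT lerNl.
Qed.

(** The 8 counts four signed real parts for each of the two sums. In 16 = 4 * 2 * 2, the 4 comes
    from the bound c on one block, one 2 from [theta], the other from bounding a modulus by |Re| +
    |Im|. *)
Lemma pr_deviates (K : R) : (0 < #|I|)%N ->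
  pr (deviates (16 * m%:R * C ^+ 2 * Num.sqrt (#|I|%:R) * K)) <=
  #|{: Y}|%:R * (8 * expR (2^-1 - K)).
Proof.
move=> I0; apply: le_trans (pr_exists _) _.
apply: (@le_trans _ _ (\sum_(t : Y) (8 * expR (2^-1 - K)))); last first.
  by rewrite sumr_const -[leLHS]mulr_natl.
apply: ler_sum => t _.
set l := 2 * (4 * m%:R * C ^+ 2) * Num.sqrt (#|I|%:R) * K.
have -> : 16 * m%:R * C ^+ 2 * Num.sqrt (#|I|%:R) * K = 2 * l by rewrite /l; ring.
have ReN' (x y : R[i]) : - complex.Re (x + y) = - complex.Re x + - complex.Re y.
  by rewrite ReD opprD.
have ImN' (x y : R[i]) : - complex.Im (x + y) = - complex.Im x + - complex.Im y.
  by rewrite ImD opprD.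
have ReNle (z : R[i]) : `|- complex.Re z| <= nc z by rewrite normrN Re_le_nc.
have ImNle (z : R[i]) : `|- complex.Im z| <= nc z by rewrite normrN Im_le_nc.
have four (V : W -> R[i]) :
   pr (fun w => l < complex.Re (V w)) <= expR (2^-1 - K) ->
   pr (fun w => l < - complex.Re (V w)) <= expR (2^-1 - K) ->
   pr (fun w => l < complex.Im (V w)) <= expR (2^-1 - K) ->
   pr (fun w => l < - complex.Im (V w)) <= expR (2^-1 - K) ->
   pr (fun w => 2 * l < nc (V w)) <= 4 * expR (2^-1 - K).
  move=> h1 h2 h3 h4; apply: (@le_trans _ _ (pr (fun w => [|| l < complex.Re (V w),
      l < - complex.Re (V w), l < complex.Im (V w) | l < - complex.Im (V w)]))).
    by apply: prS => w; exact: nc_gt_split.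
  apply: le_trans (prU _ _) _; rewrite [4](_ : _ = 1 + (1 + (1 + 1))); last by ring.
  rewrite !mulrDl !mul1r lerD // (le_trans (prU _ _)) // lerD //.
  by rewrite (le_trans (prU _ _)) // lerD.
apply: le_trans (prU _ _) _; have -> : 8 * expR (2^-1 - K) = 4 * expR (2^-1 - K) + 4 * expR (2^-1 - K) by ring.
by apply: lerD; apply: four;
  [exact: (tail_ne (@ReD R) (@Re_le_nc R))|exact: (tail_ne ReN' ReNle)
  |exact: (tail_ne (@ImD R) (@Im_le_nc R))|exact: (tail_ne ImN' ImNle)
  |exact: (tail_eq (@ReD R) (@Re_le_nc R))|exact: (tail_eq ReN' ReNle)
  |exact: (tail_eq (@ImD R) (@Im_le_nc R))|exact: (tail_eq ImN' ImNle)].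
Qed.

End BlockModel.

(** * Lower bound for the second moment of a correlation *)

Section SecondMoment.
Variables (R : realType) (Y M : finZmodType) (I : finType).
Variables (pi : Y -> M) (b : Y -> I) (F : M -> R[i]).
Local Notation W := {ffun I -> M}.
Local Notation lift := (block_lift pi b F).
Local Notation prod_term := (block_term pi b F).
Local Notation corr_sum := (block_sum pi b F).
Hypothesis piD : {morph pi : x y / x + y}.
Hypothesis F_mean0 : \sum_a F a = 0.

Let M_gt0 : (0 < #|{: M}|)%N.
Proof. by apply/card_gt0P; exists 0. Qed.

Let W_gt0 : (0 < #|{: W}|)%N := card_ffun_gt0 I M_gt0.

Definition mean_sqr : R := avg (fun a => nc (F a) ^+ 2).

(* The second clause rules out that the blocks of y, y + t, z + t, z pair up
   crosswise in the fourth order moments. *)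
Definition separated (t : Y) : Prop := (forall y, b (y + t) != b y) /\
  (forall y z, b (z + t) = b y -> b z != b (y + t)).

Lemma avg_site (p : I) (V : M -> R[i]) : avg (fun w : W => V (w p)) = avg V.
Proof.
rewrite -(avg_res M_gt0 p) -[RHS](avg_cst _ W_gt0); apply: eq_avg => w.
by apply: eq_avg => a; rewrite upd_eq.
Qed.

Let H (w : W) (t y z : Y) : R[i] := prod_term w t y * conjc (prod_term w t z).

(** The parameter of block i enters exactly one of the four factors of H, and averaging over it
    kills that factor because F has mean zero. *)
Lemma avg_H_lone_site (i : I) t y z :
  (b (y + t) == i) != (b y == i) -> b (z + t) != i -> b z != i ->
  avg (fun w => H w t y z) = 0.
Proof.
move=> p12 p3 p4.
have HE w : H w t y z = lift w (y + t) * (conjc (lift w y) *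
      (conjc (lift w (z + t)) * lift w z)).
  by rewrite /H /prod_term conjcM conjcK -!mulrA.
rewrite (eq_avg HE); apply: (avg_res0 M_gt0 (i := i)) => w.
case: (eqVneq (b (y + t)) i) p12 => [p1|p1] p2.
- have {}p2 : b y != i by case: (b y == i) p2.
  rewrite res_mulr; last by move=> v a; rewrite !block_lift_upd_neq.
  rewrite /res /avg; under eq_bigr do rewrite (block_lift_upd_eq _ _ _ _ p1).
  by rewrite (sum_shift F_mean0) !mul0r.
- have {}p2 : b y = i by apply/eqP; case: (b y == i) p2.
  rewrite res_mull; last by move=> v a; rewrite !block_lift_upd_neq.
  rewrite res_mulr; last by move=> v a; rewrite !block_lift_upd_neq.
  rewrite /res /avg; under eq_bigr do rewrite (block_lift_upd_eq _ _ _ _ p2).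
  by rewrite -conjc_sum (sum_shift F_mean0) conjc0 !mul0r mulr0.
Qed.

Lemma autocorr_subE (s s' : M) :
  avg (fun a => F (s + a) * conjc (F (s' + a))) = autocorr F (s - s').
Proof.
rewrite /autocorr /avg; congr (_ / _).
rewrite [RHS](reindex_inj (addrI s')) /=; apply: eq_bigr => a _.
by congr (F _ * _); rewrite addrAC addrC [s' + _]addrC subrK addrC.
Qed.

(** Unless every parameter occurs at least twice, [avg_H_lone_site] gives 0. For a separated t the
    only remaining pairing is y + t with z + t and y with z. The two independent averages then both
    equal the autocorrelation at pi y - pi z, the shift by t cancelling. *)
Lemma avg_H t y z : separated t ->
  avg (fun w => H w t y z) = 0 \/
  avg (fun w => H w t y z) =
    autocorr F (pi y - pi z) * conjc (autocorr F (pi y - pi z)).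
Proof.
move=> [sep1 sep2].
have n12 := sep1 y; have n34 := sep1 z.
case: (eqVneq (b (y + t)) (b (z + t))) => [e13|n13].
- case: (eqVneq (b y) (b z)) => [e24|n24]; [right|left].
  + have HE w : H w t y z = (lift w (y + t) * conjc (lift w (z + t))) *
       conjc (lift w y * conjc (lift w z)).
      by rewrite /H /prod_term !conjcM !conjcK; ring.
    rewrite (eq_avg HE) -(avg_res M_gt0 (b (y + t))).
    have -> : avg (res (b (y + t)) (fun w => (lift w (y + t) * conjc (lift w (z + t))) *
       conjc (lift w y * conjc (lift w z)))) =
       avg (fun w : W => autocorr F (pi y - pi z) *
         conjc (F (pi y + w (b y)) * conjc (F (pi z + w (b y))))).
      apply: eq_avg => w; rewrite res_mulr; last first.
        by move=> v a; rewrite !block_lift_upd_neq // -?e24 eq_sym.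
      congr (_ * _); last by rewrite /block_lift -e24.
      rewrite /res; under eq_avg do rewrite !block_lift_upd_eq //.
      rewrite autocorr_subE !piD; congr (autocorr F _).
      by rewrite opprD addrACA subrr addr0.
    rewrite avgZ avg_conjc; congr (_ * conjc _).
    rewrite (avg_site (b y) (fun a => F (pi y + a) * conjc (F (pi z + a)))).
    exact: autocorr_subE.
  + apply: (@avg_H_lone_site (b y)); first by rewrite (negPf n12) eqxx.
    * by rewrite -e13.
    * by rewrite eq_sym.
- left; case: (eqVneq (b (y + t)) (b z)) => [e14|n14].
  + have n23 : b (z + t) != b y.
      by apply/eqP => e; have := sep2 _ _ e; rewrite e14 eqxx.
    apply: (@avg_H_lone_site (b y)) => //; first by rewrite (negPf n12) eqxx.
    by rewrite -e14.
  + apply: (@avg_H_lone_site (b (y + t))); [|by rewrite eq_sym|by rewrite eq_sym].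
    by rewrite eqxx [b y == _]eq_sym (negPf n12).
Qed.

Lemma autocorr0 : autocorr F 0 = Complex mean_sqr 0.
Proof.
rewrite /autocorr /mean_sqr /avg divnCE Re_sum Im_sum.
rewrite (eq_bigr (fun a => nc (F a) ^+ 2)); last first.
  by move=> a _; rewrite addr0 mul_conjc.
rewrite [in X in Complex _ X]big1 ?mul0r // => a _.
by rewrite addr0 mul_conjc.
Qed.

(** All terms of the double sum are squared moduli or 0, so keeping the diagonal y = z gives a lower
    bound. *)
Lemma second_moment_ge t : separated t ->
  #|{: Y}|%:R * mean_sqr ^+ 2 <= avg (fun w : W => nc (corr_sum w t) ^+ 2).
Proof.
move=> sep.
have -> : avg (fun w : W => nc (corr_sum w t) ^+ 2) =
    \sum_y \sum_z complex.Re (avg (fun w => H w t y z)).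
  under [RHS]eq_bigr do under eq_bigr do rewrite Re_avg.
  under [RHS]eq_bigr do rewrite -avg_sum.
  rewrite -avg_sum; apply: eq_avg => w.
  rewrite nc_sqrE /block_sum conjc_sum mulr_suml Re_sum; apply: eq_bigr => y _.
  by rewrite mulr_sumr Re_sum.
rewrite mulr_natl -sumr_const; apply: ler_sum => y _.
have ge0 z : 0 <= complex.Re (avg (fun w => H w t y z)).
  case: (avg_H y z sep) => -> //.
  by rewrite -nc_sqrE sqr_ge0.
rewrite (bigD1 y) //= -[leLHS]addr0 lerD ?sumr_ge0 //.
suff -> : avg (fun w => H w t y y) = Complex (mean_sqr ^+ 2) 0 by [].
have [sep1 _] := sep.
have HE w : H w t y y = (lift w (y + t) * conjc (lift w (y + t))) *
       (lift w y * conjc (lift w y)).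
  by rewrite /H /prod_term !conjcM !conjcK; ring.
rewrite (eq_avg HE) -(avg_res M_gt0 (b (y + t))).
have -> : avg (res (b (y + t)) (fun w => (lift w (y + t) * conjc (lift w (y + t))) *
   (lift w y * conjc (lift w y)))) =
   avg (fun w : W => autocorr F 0 *
     (F (pi y + w (b y)) * conjc (F (pi y + w (b y))))).
  apply: eq_avg => w; rewrite res_mulr; last first.
    by move=> v a; rewrite !block_lift_upd_neq // eq_sym.
  congr (_ * _).
  rewrite /res; under eq_avg do rewrite !block_lift_upd_eq //.
  by rewrite autocorr_subE subrr.
rewrite avgZ (avg_site (b y) (fun a => F (pi y + a) * conjc (F (pi y + a)))).
rewrite autocorr_subE subrr autocorr0 [LHS]/(_ * _) /=.
by congr Complex; ring.
Qed.

End SecondMoment.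

(** * Variance of the energy on a set of far shifts *)

Section Variance.
Variables (R : realType) (Y M : finZmodType) (I : finType).
Variables (pi : Y -> M) (b : Y -> I) (F : M -> R[i]).
Local Notation W := {ffun I -> M}.
Local Notation lift := (block_lift pi b F).
Local Notation prod_term := (block_term pi b F).
Local Notation corr_sum := (block_sum pi b F).
Local Notation corr_ne := (offblock_sum pi b F).
Variables (C : R) (m n0 : nat) (T : pred Y) (E : R).
Hypothesis C_gt0 : 0 < C.
Hypothesis F_le : forall a, nc (F a) <= C.
Hypothesis fiber_le : forall i, (#|[pred y | b y == i]| <= m)%N.
Hypothesis T_far : forall t, T t -> forall y, b (y + t) != b y.
Hypothesis near_le : (#|[pred s : Y | [exists y : Y, b (y + s)%R == b y]]| <= n0)%N.
Hypothesis E_ge0 : 0 <= E.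

Let M_gt0 : (0 < #|{: M}|)%N.
Proof. by apply/card_gt0P; exists 0. Qed.

Let W_gt0 : (0 < #|{: W}|)%N := card_ffun_gt0 I M_gt0.

Let C_ge0 : 0 <= C := ltW C_gt0.

(* Efron-Stein is applied to [energy] with the comparison [energy0 i], where all
   terms involving the block i are deleted. *)
Definition energy (w : W) : R := \sum_(t | T t) nc (corr_sum w t) ^+ 2.

Let D (i : I) (w : W) t : R[i] :=
  \sum_(y | (b y == i) || (b (y + t) == i)) prod_term w t y.

Let R0 (i : I) (w : W) t : R[i] :=
  \sum_(y | ~~ ((b y == i) || (b (y + t) == i))) prod_term w t y.

Let energy0 (i : I) (w : W) : R := \sum_(t | T t) nc (R0 i w t) ^+ 2.

Lemma indep_energy0 i : indep i (energy0 i).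
Proof.
move=> w a; apply: eq_bigr => t _; congr (nc _ ^+ 2); apply: eq_bigr => y.
by rewrite negb_or => /andP[h1 h2]; rewrite /block_term !block_lift_upd_neq.
Qed.

Let cross (i : I) (w : W) : R[i] := \sum_(t | T t) conjc (corr_sum w t) * D i w t.

Lemma energyB i w : energy w - energy0 i w =
  2 * complex.Re (cross i w) - \sum_(t | T t) nc (D i w t) ^+ 2.
Proof.
rewrite /energy /energy0 /cross Re_sum mulr_sumr -!sumrB; apply: eq_bigr => t _.
have -> : corr_sum w t = D i w t + R0 i w t.
  by rewrite /block_sum (bigID (fun y => (b y == i) || (b (y + t) == i))).
rewrite !nc_sqr; case: (D i w t) (R0 i w t) => [a c] [a' c'] /=.
by ring.
Qed.

Lemma card_fiber_shift i t : (#|[pred y | b (y + t)%R == i]| <= m)%N.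
Proof.
rewrite -(fintype.card_image (addIr t)) (leq_trans _ (fiber_le i)) //.
by apply: subset_leq_card; apply/fintype.subsetP => _ /fintype.imageP[y yi ->].
Qed.

(** For a far shift y and y + t never lie in the same block, so the two conditions exclude each
    other. *)
Lemma D_split i w t : T t ->
  D i w t = \sum_(y | b y == i) prod_term w t y + \sum_(y | b (y + t) == i) prod_term w t y.
Proof.
move=> Tt; rewrite /D (bigID (fun y => b y == i)) /=; congr (_ + _); apply: eq_bigl => y.
  by rewrite orbC andbC; case: eqP => //= _; rewrite orbT.
case: (eqVneq (b y) i) => [<-|] /=; last by rewrite andbT.
by rewrite ?andbF; apply/esym/negbTE/T_far.
Qed.

Lemma D_le i w t : T t -> nc (D i w t) <= 2 * m%:R * C ^+ 2.
Proof.
move=> Tt; rewrite D_split // (le_trans (ncD _ _)) //.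
have half (P : pred Y) : (#|P| <= m)%N ->
    nc (\sum_(y | P y) prod_term w t y) <= m%:R * C ^+ 2.
  move=> Pm; apply: le_trans (nc_sum_le (c := C ^+ 2) _) _.
    by move=> y _; exact: block_term_le.
  by rewrite ler_wpM2r ?sqr_ge0 // ler_nat.
have h1 := half _ (fiber_le i); have h2 := half _ (card_fiber_shift i t).
by rewrite (le_trans (lerD h1 h2)) // -mulrA [leRHS]mulr_natl mulr2n.
Qed.

Lemma sum_fibers_sqr_le (u A : Y -> R[i]) : (forall y, nc (u y) <= C) ->
  \sum_i nc (\sum_(y | b y == i) u y * A y) ^+ 2 <=
  m%:R * C ^+ 2 * \sum_y nc (A y) ^+ 2.
Proof.
move=> uC; rewrite (partition_big b predT) //= mulr_sumr; apply: ler_sum => i _.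
apply: le_trans (nc_sum_sqr_le _ _) _; rewrite -mulrA.
apply: ler_pM => //.
- by apply: sumr_ge0 => y _; apply: sqr_ge0.
- by rewrite ler_nat; exact: fiber_le.
rewrite mulr_sumr; apply: ler_sum => y _; rewrite ncM exprMn.
by rewrite ler_wpM2r ?sqr_ge0 // ler_sqr ?nnegrE ?nc_ge0.
Qed.

(** Expanding the square produces the Gram matrix of the rows G _ t. For the translates used in
    [sum_cross_le] its entries are again correlation sums, at t - t', and this is where the estimate
    gains over a bound term by term. *)
Lemma sum_sqr_gram_le (v : Y -> R[i]) (G : Y -> Y -> R[i]) :
  \sum_y nc (\sum_(t | T t) v t * G y t) ^+ 2 <=
  \sum_(t | T t) \sum_(t' | T t') nc (v t) * nc (v t') *
     nc (\sum_y G y t * conjc (G y t')).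
Proof.
have -> : \sum_y nc (\sum_(t | T t) v t * G y t) ^+ 2 = complex.Re
  (\sum_(t | T t) \sum_(t' | T t') (v t * conjc (v t')) * \sum_y G y t * conjc (G y t')).
  rewrite (eq_bigr (fun y => complex.Re (\sum_(t | T t) \sum_(t' | T t')
     (v t * conjc (v t')) * (G y t * conjc (G y t'))))); last first.
    move=> y _; rewrite nc_sqrE conjc_sum mulr_suml; congr (complex.Re _).
    apply: eq_bigr => t _; rewrite mulr_sumr; apply: eq_bigr => t' _.
    by rewrite conjcM; ring.
  rewrite -Re_sum; congr (complex.Re _); rewrite exchange_big; apply: eq_bigr => t _.
  by rewrite exchange_big; apply: eq_bigr => t' _; rewrite mulr_sumr.
apply: le_trans (ler_norm _) _; apply: le_trans (Re_le_nc _) _.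
apply: le_trans (nc_sum _ _ _) _; apply: ler_sum => t _.
apply: le_trans (nc_sum _ _ _) _; apply: ler_sum => t' _.
by rewrite !ncM ncJ.
Qed.

Let S3 (w : W) : R := \sum_(t | T t) \sum_(t' | T t')
  nc (corr_sum w t) * nc (corr_sum w t') * nc (corr_sum w (t - t')).

Lemma cross_split i w : cross i w =
  \sum_(y | b y == i) conjc (lift w y) *
     (\sum_(t | T t) conjc (corr_sum w t) * lift w (y + t)) +
  \sum_(y | b y == i) lift w y *
     (\sum_(t | T t) conjc (corr_sum w t) * conjc (lift w (y - t))).
Proof.
rewrite /cross.
under eq_bigr => t Tt do rewrite (D_split _ _ Tt) mulrDr.
rewrite big_split /=; congr (_ + _).
- under [RHS]eq_bigr do rewrite mulr_sumr.
  rewrite [RHS]exchange_big; apply: eq_bigr => t _; rewrite mulr_sumr.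
  by apply: eq_bigr => y _; rewrite /block_term; ring.
- under [RHS]eq_bigr do rewrite mulr_sumr.
  rewrite [RHS]exchange_big; apply: eq_bigr => t _; rewrite mulr_sumr.
  rewrite [RHS](reindex_inj (addIr t)) /=; apply: eq_bigr => y _.
  by rewrite /block_term addrK; ring.
Qed.

(** The two halves of [cross_split] are treated alike: Cauchy-Schwarz inside each block, then the
    Gram bound for the translates of the lift, forward in one half and backward in the other. *)
Lemma sum_cross_le w : \sum_i nc (cross i w) ^+ 2 <= 4 * m%:R * C ^+ 2 * S3 w.
Proof.
pose P1 i := \sum_(y | b y == i) conjc (lift w y) *
     (\sum_(t | T t) conjc (corr_sum w t) * lift w (y + t)).
pose P2 i := \sum_(y | b y == i) lift w y *
     (\sum_(t | T t) conjc (corr_sum w t) * conjc (lift w (y - t))).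
have h1 : \sum_i nc (P1 i) ^+ 2 <= m%:R * C ^+ 2 * S3 w.
  apply: le_trans (sum_fibers_sqr_le _ _) _.
    by move=> y; rewrite ncJ; exact: block_lift_le.
  rewrite ler_wpM2l ?mulr_ge0 ?sqr_ge0 //.
  apply: le_trans (sum_sqr_gram_le _ _) _; rewrite le_eqVlt; apply/orP; left; apply/eqP.
  apply: eq_bigr => t _; apply: eq_bigr => t' _; rewrite !ncJ; congr (_ * nc _).
  rewrite /block_sum [RHS](reindex_inj (addIr t')) /=; apply: eq_bigr => y _.
  by rewrite /block_term -addrA [t' + _]addrC subrK.
have h2 : \sum_i nc (P2 i) ^+ 2 <= m%:R * C ^+ 2 * S3 w.
  apply: le_trans (sum_fibers_sqr_le _ _) _.
    by move=> y; exact: block_lift_le.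
  rewrite ler_wpM2l ?mulr_ge0 ?sqr_ge0 //.
  apply: le_trans (sum_sqr_gram_le _ _) _; rewrite le_eqVlt; apply/orP; left; apply/eqP.
  apply: eq_bigr => t _; apply: eq_bigr => t' _; rewrite !ncJ; congr (_ * nc _).
  rewrite /block_sum (reindex_inj (addIr t)) /=; apply: eq_bigr => y _.
  by rewrite /block_term addrK conjcK addrA mulrC.
apply: (@le_trans _ _ (\sum_i (2 * nc (P1 i) ^+ 2 + 2 * nc (P2 i) ^+ 2))).
  apply: ler_sum => i _; rewrite cross_split -/(P1 i) -/(P2 i).
  have := ncD (P1 i) (P2 i); have := nc_ge0 (P1 i + P2 i).
  move: (nc _) (nc (P1 i)) (nc (P2 i)) => x y z x0 xyz.
  apply: (@le_trans _ _ ((y + z) ^+ 2)); first by rewrite ler_sqr ?nnegrE // (le_trans x0).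
  by have := sqr_ge0 (y - z); nra.
by rewrite big_split /= -!mulr_sumr; nra.
Qed.

Let n : R := #|{: Y}|%:R.

Lemma block_sum_le w t : nc (corr_sum w t) <= n * C ^+ 2.
Proof. by apply: nc_sum_le => y _; apply: block_term_le. Qed.

Lemma block_sum_far w t : (forall y, b (y + t) != b y) -> corr_sum w t = corr_ne w t.
Proof.
move=> far; rewrite block_sumE /inblock_sum big_pred0 ?add0r // => y.
exact/negbTE/far.
Qed.

(** Off the exceptional event the correlations at t and t' are at most E, and so is the one at t -
    t', except for at most n0 near differences, where it is at most n C^2. On the event all three
    factors are bounded by n C^2. *)
Lemma S3_le w : S3 w <= (if deviates pi b F E w then n ^+ 5 * C ^+ 6
  else E ^+ 2 * n ^+ 2 * (n0%:R * C ^+ 2 + E)).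
Proof.
have n_ge0 : 0 <= n by rewrite ler0n.
have T_le : #|T|%:R <= n by rewrite ler_nat max_card.
have sumT_le (c : R) : 0 <= c -> \sum_(t | T t) c <= n * c.
  by move=> c0; rewrite sumr_const -[leLHS]mulr_natl ler_wpM2r.
case: ifPn => [_|/existsPn dev].
  have X0 : 0 <= n * C ^+ 2 by rewrite mulr_ge0 ?sqr_ge0.
  have -> : n ^+ 5 * C ^+ 6 = n * (n * ((n * C ^+ 2) * (n * C ^+ 2) * (n * C ^+ 2))) by ring.
  apply: le_trans (sumT_le _ _); last by rewrite ?mulr_ge0.
  apply: ler_sum => t _; apply: le_trans (sumT_le _ _); last by rewrite ?mulr_ge0.
  apply: ler_sum => t' _; do 2?[apply: ler_pM; rewrite ?nc_ge0 ?mulr_ge0 ?nc_ge0 //];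
  exact: block_sum_le.
have farE t : (forall y, b (y + t) != b y) -> nc (corr_sum w t) <= E.
  move=> far; rewrite block_sum_far //.
  by have := dev t; rewrite negb_or -!leNgt => /andP[].
have TE t : T t -> nc (corr_sum w t) <= E by move=> Tt; apply: farE; exact: T_far.
have total : \sum_s nc (corr_sum w s) <= n * (n0%:R * C ^+ 2 + E).
  rewrite (bigID (fun s => [exists y, b (y + s) == b y])) /= mulrDr lerD //.
    rewrite mulrCA; apply: le_trans (ler_sum _ (fun s _ => block_sum_le w s)) _.
    rewrite sumr_const -[leLHS]mulr_natl ler_wpM2r ?mulr_ge0 ?sqr_ge0 //.
    by rewrite ler_nat.
  apply: (@le_trans _ _ (\sum_(s | ~~ [exists y, b (y + s) == b y]) E)).
    by apply: ler_sum => s /existsPn h; exact: farE.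
  by rewrite sumr_const -[leLHS]mulr_natl ler_wpM2r // ler_nat max_card.
have row t : \sum_(t' | T t') nc (corr_sum w (t - t')) <= n * (n0%:R * C ^+ 2 + E).
  apply: le_trans total; rewrite [leRHS](reindex_inj (subrI t)) /=.
  rewrite [leRHS](bigID T) /= lerDl; apply: sumr_ge0 => s _; exact: nc_ge0.
have -> : E ^+ 2 * n ^+ 2 * (n0%:R * C ^+ 2 + E) =
  n * (E ^+ 2 * (n * (n0%:R * C ^+ 2 + E))) by ring.
have e0 : 0 <= n0%:R * C ^+ 2 + E by rewrite addr_ge0 ?mulr_ge0 ?sqr_ge0.
apply: le_trans (sumT_le _ _); last by rewrite ?mulr_ge0 ?sqr_ge0.
apply: ler_sum => t Tt.
apply: (@le_trans _ _ (E ^+ 2 * \sum_(t' | T t') nc (corr_sum w (t - t')))).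
  rewrite mulr_sumr; apply: ler_sum => t' Tt'.
  by rewrite ler_wpM2r ?nc_ge0 // expr2 ler_pM ?nc_ge0 ?TE.
by rewrite ler_wpM2l ?sqr_ge0.
Qed.

(** The first term comes from the part of the block change that is linear in D (8 times the 4 of
    [sum_cross_le]), the second from the quadratic part, for which the trivial bound [D_le] is
    enough. *)
Lemma energy_variance :
  avg (fun w => (energy w - avg energy) ^+ 2) <=
  32 * m%:R * C ^+ 2 * (E ^+ 2 * n ^+ 2 * (n0%:R * C ^+ 2 + E) +
     pr (deviates pi b F E) * (n ^+ 5 * C ^+ 6)) +
  32 * #|I|%:R * n ^+ 2 * m%:R ^+ 4 * C ^+ 8.
Proof.
apply: le_trans (efron_stein M_gt0 energy indep_energy0) _.
have n_ge0 : 0 <= n by rewrite ler0n.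
have step i w : (energy w - energy0 i w) ^+ 2 <=
    8 * nc (cross i w) ^+ 2 + 32 * n ^+ 2 * m%:R ^+ 4 * C ^+ 8.
  rewrite energyB.
  have h1 : complex.Re (cross i w) ^+ 2 <= nc (cross i w) ^+ 2.
    by rewrite nc_sqr lerDl sqr_ge0.
  set d := \sum_(t | T t) _.
  have d0 : 0 <= d by apply: sumr_ge0 => t _; apply: sqr_ge0.
  have dle : d <= n * (2 * m%:R * C ^+ 2) ^+ 2.
    apply: (@le_trans _ _ (\sum_(t | T t) (2 * m%:R * C ^+ 2) ^+ 2)).
      apply: ler_sum => t Tt; rewrite ler_sqr ?nnegrE ?nc_ge0 //; first exact: D_le.
      by rewrite ?mulr_ge0 ?sqr_ge0.
    by rewrite sumr_const -[leLHS]mulr_natl ler_wpM2r ?sqr_ge0 // ler_nat max_card.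
  have dsq : d ^+ 2 <= (n * (2 * m%:R * C ^+ 2) ^+ 2) ^+ 2.
    by rewrite ler_sqr ?nnegrE // (le_trans d0).
  have -> : 32 * n ^+ 2 * m%:R ^+ 4 * C ^+ 8 = 2 * (n * (2 * m%:R * C ^+ 2) ^+ 2) ^+ 2 by ring.
  have : (2 * complex.Re (cross i w) - d) ^+ 2 <=
      8 * complex.Re (cross i w) ^+ 2 + 2 * d ^+ 2.
    by have := sqr_ge0 (2 * complex.Re (cross i w) + d); nra.
  by move=> h; apply: le_trans h _; apply: lerD; rewrite ler_wpM2l.
rewrite -avg_sum.
apply: (@le_trans _ _ (avg (fun w => 8 * (4 * m%:R * C ^+ 2 *
    ((E ^+ 2 * n ^+ 2 * (n0%:R * C ^+ 2 + E)) + (deviates pi b F E w)%:R * (n ^+ 5 * C ^+ 6)))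
    + 32 * #|I|%:R * n ^+ 2 * m%:R ^+ 4 * C ^+ 8))); last first.
  rewrite avgD avgZ avgZ avgD !avg_cst //.
  rewrite (eq_avg (fun w => mulrC _ _)) avgZ -/(pr _) lerD2r.
  by rewrite le_eqVlt; apply/orP; left; apply/eqP; ring.
apply: ler_avg => w; apply: le_trans (ler_sum _ (fun i _ => step i w)) _.
rewrite big_split /= -mulr_sumr lerD //.
  rewrite ler_wpM2l //; apply: le_trans (sum_cross_le w) _.
  rewrite ler_wpM2l ?mulr_ge0 ?sqr_ge0 //; apply: le_trans (S3_le w) _.
  have e0 : 0 <= E ^+ 2 * n ^+ 2 * (n0%:R * C ^+ 2 + E).
    by rewrite ?mulr_ge0 ?sqr_ge0 ?addr_ge0 ?mulr_ge0 ?sqr_ge0.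
  by case: ifP => _; rewrite ?mul1r ?mul0r ?addr0 // lerDr.
rewrite sumr_const -[leLHS]mulr_natl le_eqVlt; apply/orP; left; apply/eqP.
by rewrite (_ : #|_|%:R = #|I|%:R) //; ring.
Qed.

End Variance.

(** * The tower of finite groups *)

Section Arithmetic.
Local Open Scope nat_scope.

Lemma divn_eq_close h y z : 0 < h -> y %/ h = z %/ h -> y < z + h.
Proof.
move=> h0 e; rewrite (divn_eq y h) (divn_eq z h) e.
have := ltn_pmod y h0; have := ltn_pmod z h0; lia.
Qed.

Lemma modn_add_cases H a c : a < H -> c < H ->
  (a + c) %% H = if a + c < H then a + c else a + c - H.
Proof.
move=> aH cH; case: (ltnP (a + c) H) => h; first by rewrite modn_small.
by rewrite -[in LHS](subnK h) modnDr modn_small //; lia.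
Qed.

Lemma block_near h H y t : 0 < h -> 2 * h <= H -> y < H -> t < H ->
  ((y + t) %% H) %/ h = y %/ h -> t < h \/ H < t + h.
Proof.
move=> h0 hH yH tH e; have c1 := divn_eq_close h0 e.
have c2 := divn_eq_close h0 (esym e).
move: c1 c2 {e}; rewrite modn_add_cases //; case: (ltnP (y + t) H) => l; lia.
Qed.

(** Adding the two coincidences shows that 2t is within less than 2h of a multiple of H, which the
    bounds on t exclude. *)
Lemma block_swap h H y z t : 0 < h -> y < H -> z < H ->
  h <= t -> 2 * t + 2 * h <= H ->
  ((z + t) %% H) %/ h = y %/ h -> z %/ h = ((y + t) %% H) %/ h -> False.
Proof.
move=> h0 yH zH ht tH e e'.
have c1 := divn_eq_close h0 e; have c2 := divn_eq_close h0 (esym e).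
have c3 := divn_eq_close h0 e'; have c4 := divn_eq_close h0 (esym e').
move: c1 c2 c3 c4 {e e'}; rewrite !modn_add_cases //; try lia.
case: (ltnP (z + t) H) => l1; case: (ltnP (y + t) H) => l2; lia.
Qed.

End Arithmetic.

Section Geometry.
Context {d : nat} {S : scales}.
Local Notation h := (h S).
Local Notation M := (M d S).
Local Notation Gq := (Gamma_quo d S).

Lemma hS n : h n.+1 = (q S n * h n)%N. Proof. by []. Qed.

Lemma h_dvdS n : (h n %| h n.+1)%N. Proof. by rewrite hS dvdn_mull. Qed.

Lemma h2_leS n : (2 * h n <= h n.+1)%N.
Proof. by rewrite hS leq_mul2r q_ge2 orbT. Qed.

Lemma coord_lt n (a : M n) i : (a 0%R i < h n)%N.
Proof.
have := ltn_ord (a 0%R i); move: (nat_of_ord (a 0%R i)) => k.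
by rewrite (prednK (h_gt0 S n)).
Qed.

Lemma coordD n (a c : M n) i : (a + c) 0%R i = ((a 0%R i + c 0%R i) %% h n)%N :> nat.
Proof.
rewrite mxE /=; move: (nat_of_ord _) (nat_of_ord _) => k l.
by rewrite (prednK (h_gt0 S n)).
Qed.

Lemma coord_projM n (t : 'rV[int]_d) i :
  ((projM n t : M n) 0%R i)%:Z = (t 0%R i %% (h n)%:Z)%Z.
Proof.
have h0 : (h n)%:Z != 0 by rewrite -lt0n h_gt0.
rewrite mxE /= (prednK (h_gt0 S n)) modn_small.
  by rewrite gez0_abs ?modz_ge0.
by rewrite -ltz_nat gez0_abs ?modz_ge0 // ltz_pmod // ltz_nat h_gt0.
Qed.

Lemma M_eqP n (a c : M n) : (forall i, a 0%R i = c 0%R i :> nat) -> a = c.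
Proof. by move=> e; apply/rowP => i; apply: val_inj; apply: e. Qed.

Lemma projMD n (s t : 'rV[int]_d) : projM n (s + t) = projM n s + projM n t :> M n.
Proof.
apply: M_eqP => i; apply/eqP; rewrite -eqz_nat coordD -modz_nat PoszD.
by rewrite !coord_projM modzDml modzDmr mxE.
Qed.

Definition piM n (y : M n.+1) : M n := projM n (upart y).

Lemma phiE (alpha : params d S) n (y : M n.+1) : phi alpha y = piM y + alpha n (gam y).
Proof. by []. Qed.

Lemma coord_piM n (y : M n.+1) i : piM y 0%R i = (y 0%R i %% h n)%N :> nat.
Proof.
apply/eqP; rewrite -eqz_nat coord_projM mxE modz_nat.
by rewrite modn_mod.
Qed.

Lemma piMD n : {morph (@piM n) : x y / x + y}.
Proof.
move=> x y; apply: M_eqP => i; rewrite coord_piM !coordD !coord_piM.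
by rewrite modn_dvdm ?h_dvdS // modnDm.
Qed.

Lemma piM_projM n t : piM (projM n.+1 t) = projM n t.
Proof.
apply: M_eqP => i; apply/eqP; rewrite -eqz_nat coord_piM -modz_nat.
rewrite !coord_projM.
apply/eqP; rewrite [in RHS](divz_eq (t 0%R i) (h n.+1)).
by rewrite [X in (_ * X + _)%R](_ : _ = (q S n)%:Z * (h n)%:Z) // mulrA modzMDl.
Qed.

Lemma gam_eqP n (y z : M n.+1) :
  reflect (forall i, y 0%R i %/ h n = z 0%R i %/ h n)%N (gam y == gam z).
Proof.
have gE (w : M n.+1) i : gpart w 0%R i = (h n * (w 0%R i %/ h n))%N :> nat.
  rewrite mxE /= -/(h n.+1); move: (nat_of_ord _) (coord_lt w i) => k ltk.
  rewrite (prednK (h_gt0 S n.+1)) modn_small // mulnC.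
  exact: leq_ltn_trans (leq_divM _ _) ltk.
apply: (iffP eqP) => [/(congr1 val) /= e i|e].
  have := congr1 (fun w : M n.+1 => nat_of_ord (w 0%R i)) e.
  by rewrite !gE => /eqP; rewrite eqn_pmul2l ?h_gt0 // => /eqP.
by apply: val_inj; apply: M_eqP => i; rewrite /= !gE e.
Qed.

Lemma card_ordh n : #|{: 'I_(h n).-1.+1}| = h n.
Proof. by rewrite card_ord (prednK (h_gt0 S n)). Qed.

Lemma card_M n : #|{: M n}| = (h n ^ d)%N.
Proof. by rewrite card_mx mul1n card_ordh. Qed.

Lemma gam_piM_inj n : injective (fun y : M n.+1 => (gam y, piM y)).
Proof.
move=> y z [/eqP/gam_eqP e1 e2]; apply: M_eqP => i.
rewrite (divn_eq (y 0%R i) (h n)) (divn_eq (z 0%R i) (h n)) e1.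
by rewrite -!coord_piM e2.
Qed.

Lemma fiber_le n (g : Gq n) : (#|[pred y : M n.+1 | gam y == g]| <= #|{: M n}|)%N.
Proof.
rewrite -(@fintype.card_in_image _ _ (@piM n)) ?max_card // => y z.
rewrite !inE => /eqP ey /eqP ez e; apply: gam_piM_inj.
by rewrite e ey ez.
Qed.

(** At most q^d because a class is determined by its quotients by h_n; at least q^d because (gam,
    piM) is injective on M_{n+1}. *)
Lemma card_Gq n : #|{: Gq n}| = (q S n ^ d)%N.
Proof.
apply/eqP; rewrite eqn_leq; apply/andP; split.
  have q0 : (0 < q S n)%N by rewrite (leq_trans _ (q_ge2 S n)).
  have lt (g : Gq n) i : ((val g) 0%R i %/ h n < q S n)%N.
    by rewrite ltn_divLR ?h_gt0 //; have := coord_lt (val g) i.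
  pose f (g : Gq n) : 'rV['I_(q S n)]_d := \row_i Ordinal (lt g i).
  rewrite -[X in (_ <= X ^ _)%N]card_ord -[X in (_ <= _ ^ X)%N]mul1n -card_mx.
  apply: (@leq_card _ _ f) => g g' e; apply: val_inj; apply: M_eqP => i.
  have /(congr1 val) /= := congr1 (fun r : 'rV['I_(q S n)]_d => r 0%R i) e.
  rewrite !mxE /= => e'.
  have /forallP/(_ i) dg := valP g; have /forallP/(_ i) dg' := valP g'.
  by rewrite -(divnK dg) -(divnK dg') e'.
have := leq_card _ (@gam_piM_inj n); rewrite card_prod !card_M.
move: (#|{: Gq n}|) => N; rewrite hS expnMn.
by rewrite leq_pmul2r // expn_gt0 h_gt0.
Qed.

Lemma card_M_S n : #|{: M n.+1}| = (#|{: Gq n}| * #|{: M n}|)%N.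
Proof. by rewrite card_Gq !card_M hS expnMn. Qed.

(** This is the invariance of the uniform measures: (gam, piM) is a bijection, and on each block
    phi_n is a translation of M_n. *)
Lemma avg_phi (K : numFieldType) (alpha : params d S) n (G : M n -> K) :
  avg (fun y : M n.+1 => G (phi alpha y)) = avg G.
Proof.
have M0 : (0 < #|{: M n}|)%N by rewrite card_M expn_gt0 h_gt0.
have G0 : (0 < #|{: Gq n}|)%N.
  by rewrite card_Gq expn_gt0 (leq_trans _ (q_ge2 S n)).
have bij : bijective (fun y : M n.+1 => (gam y, piM y)).
  by apply: (inj_card_bij (@gam_piM_inj n)); rewrite card_prod card_M_S.
rewrite /avg card_M_S natrM invfM mulrA; congr (_ / _).
transitivity ((\sum_(p : Gq n * M n) G (p.2 + alpha n p.1)) / #|{: Gq n}|%:R).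
  congr (_ / _); rewrite [RHS](reindex (fun y : M n.+1 => (gam y, piM y))) //.
  exact: onW_bij.
rewrite -(pair_big predT predT (fun (g : Gq n) (a : M n) => G (a + alpha n g))) /=.
rewrite (eq_bigr (fun _ => \sum_a G a)); last first.
  by move=> g _; rewrite [RHS](reindex_inj (addIr (alpha n g))).
by rewrite sumr_const -[_ *+ _]mulr_natr mulfK // card_gt0_neq0.
Qed.

(** If y + s and y share their block, s is the difference of their positions in it, so a pair of
    points of M_n determines s. *)
Lemma near_le n :
  (#|[pred s : M n.+1 | [exists y : M n.+1, gam (y + s)%R == gam y]]| <= #|{: M n}| ^ 2)%N.
Proof.
pose f (p : M n * M n) : M n.+1 :=
  projM n.+1 (\row_i (p.1 0%R i)%:Z) - projM n.+1 (\row_i (p.2 0%R i)%:Z).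
rewrite -mulnn -card_prod; apply: leq_trans (leq_image_card f predT).
apply: subset_leq_card; apply/fintype.subsetP => s; rewrite inE => /existsP[y /eqP e].
apply/fintype.imageP; exists (piM (y + s), piM y) => //.
have upE (z : M n.+1) : \row_i (piM z 0%R i)%:Z = upart z.
  by apply/rowP => i; rewrite mxE coord_piM mxE.
rewrite /f /= !upE; apply/esym/eqP; rewrite subr_eq eq_sym; apply/eqP.
apply: (@addrI _ (val (gam y))); rewrite addrCA -decompE -e -decompE.
exact: addrC.
Qed.

Section Residues.
Variables (n : nat) (i : 'I_d).

(** Translations along the i-th axis permute the residue classes of that coordinate mod h_n, so all
    classes have the same size. *)
Lemma card_residue (P : pred nat) :
  (#|[pred y : M n.+1 | P (y 0%R i %% h n)%N]| * h n =
   #|{: M n.+1}| * #|[pred r : 'I_(h n) | P r]|)%N.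
Proof.
pose cl (r : nat) := #|[pred y : M n.+1 | y 0%R i %% h n == r]%N|.
have h0 := h_gt0 S n.
have shift (r : 'I_(h n)) : cl r = cl 0%N.
  pose e : M n.+1 := projM n.+1 (\row_j (if j == i then (val r)%:Z else 0)).
  have eE : e 0 i = r :> nat.
    apply/eqP; rewrite -eqz_nat coord_projM mxE eqxx modz_nat modn_small //.
    by rewrite (leq_trans (ltn_ord r)) // dvdn_leq ?h_dvdS // h_gt0.
  rewrite /cl -sum1_card -[RHS]sum1_card (reindex_inj (addIr e)) /=.
  apply: eq_bigl => y; rewrite !inE. rewrite (@coordD n.+1 y e i) eE modn_dvdm ?h_dvdS //.
  by rewrite -{2}(modn_small (ltn_ord r)) -{2}[val r]add0n eqn_modDr mod0n.
pose f (y : M n.+1) : 'I_(h n) := Ordinal (ltn_pmod (y 0%R i) h0).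
have count (Q : pred nat) : #|[pred y : M n.+1 | Q (y 0%R i %% h n)%N]| =
    (#|[pred r : 'I_(h n) | Q r]| * cl 0%N)%N.
  rewrite -sum1_card (partition_big f (fun r : 'I_(h n) => Q r)) //=.
  rewrite -sum_nat_const; apply: eq_big => [r|r Qr]; first by rewrite inE.
  rewrite -(shift r) /cl -sum1_card; apply: eq_bigl => y; rewrite !inE.
  rewrite -val_eqE /=; apply: andb_idl => /eqP ->.
  by [].
have Yc : #|{: M n.+1}| = (h n * cl 0%N)%N by rewrite (count predT) card_ord.
by rewrite count Yc -mulnA mulnC (mulnC (cl 0%N)).
Qed.

End Residues.
End Geometry.

Section BlockArithmetic.
Local Open Scope nat_scope.

Lemma block_stay_pos h k H T : 0 < h -> h %| H -> k < H ->
  k %% h + T < h -> (k + T) %% H %/ h = k %/ h.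
Proof.
move=> h0 /dvdnP[q ->] kH lt.
have e := divn_eq k h.
have kq : k %/ h < q by rewrite ltn_divLR.
have le : (k %/ h).+1 * h <= q * h by rewrite leq_mul2r kq orbT.
rewrite mulSn in le.
rewrite modn_small; last by lia.
by rewrite {1}e -addnA divnMDl // (divn_small lt) addn0.
Qed.

Lemma block_stay_neg h k H T : 0 < h -> k < H -> T <= k %% h ->
  (k + (H - T)) %% H %/ h = k %/ h.
Proof.
move=> h0 kH le; have e := divn_eq k h.
have Tk : T <= k by rewrite (leq_trans le) // leq_mod.
have -> : k + (H - T) = (k - T) + H by lia.
rewrite modnDr modn_small; last by lia.
have -> : k - T = k %/ h * h + (k %% h - T) by lia.
rewrite divnMDl // [(_ - T) %/ h]divn_small ?addn0 //.
by rewrite (leq_ltn_trans (leq_subr _ _)) // ltn_pmod.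
Qed.

Lemma block_leave_pos h k H T : 0 < h -> h %| H -> 2 * h <= H -> k < H -> T < h ->
  (k + T) %% H %/ h = k %/ h -> k %% h + T < h.
Proof.
move=> h0 /dvdnP[q ->] hq kH Th; have e := divn_eq k h.
have c0 := ltn_pmod k h0.
have Tq : T < q * h by lia.
rewrite modn_add_cases //; case: (ltnP (k + T) (q * h)) => l eq2.
  by rewrite ltnNge; apply/negP => le; have := divn_eq_close h0 (esym eq2);
    have := divn_eq (k + T) h; have := ltn_pmod (k + T) h0; rewrite eq2; lia.
have := divn_eq_close h0 (esym eq2); lia.
Qed.

Lemma block_leave_neg h k H T : 0 < h -> h %| H -> 2 * h <= H -> k < H -> T < h -> 0 < T ->
  (k + (H - T)) %% H %/ h = k %/ h -> T <= k %% h.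
Proof.
move=> h0 /dvdnP[q ->] hq kH Th T0; have e := divn_eq k h.
have c0 := ltn_pmod k h0.
rewrite modn_add_cases //; last by lia.
case: (ltnP (k + (q * h - T)) (q * h)) => l eq2.
  have := divn_eq_close h0 eq2; lia.
rewrite leqNgt; apply/negP => le.
have := divn_eq (k + (q * h - T) - q * h) h; rewrite eq2.
have := ltn_pmod (k + (q * h - T) - q * h) h0; lia.
Qed.

Lemma card_ord_lt h T : #|[pred r : 'I_h | r < T]| <= T.
Proof.
rewrite -[leqRHS](size_iota 0) cardE -(size_map (@nat_of_ord h)).
apply: uniq_leq_size; first by rewrite map_inj_uniq ?enum_uniq //; apply: ord_inj.
by move=> _ /mapP[r + ->]; rewrite mem_enum inE mem_iota.
Qed.

Lemma card_ord_ge h T : #|[pred r : 'I_h | h <= r + T]| <= T.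
Proof.
rewrite -[leqRHS](size_iota (h - T)) cardE -(size_map (@nat_of_ord h)).
apply: uniq_leq_size; first by rewrite map_inj_uniq ?enum_uniq //; apply: ord_inj.
by move=> _ /mapP[r + ->]; rewrite mem_enum inE mem_iota; have := ltn_ord r; lia.
Qed.

End BlockArithmetic.

(** * Proportion of points that a translation keeps in their block *)

Section Translations.
Context {d : nat} {S : scales}.
Local Notation h := (h S).
Local Notation M := (M d S).
Implicit Types (t : 'rV[int]_d) (i : 'I_d).

Lemma coord_projM_small n t i : (`|t 0%R i| < h n)%N ->
  nat_of_ord ((projM n t : M n) 0%R i) = if (0 <= t 0%R i)%R then `|t 0%R i|%N else (h n - `|t 0%R i|)%N.
Proof.
move=> lt; apply/eqP; rewrite -eqz_nat coord_projM.
case: ifPn => [ge0|lt0].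
  by rewrite -[X in (X %% _)%Z](gez0_abs ge0) modz_nat modn_small.
have e : t 0%R i + (h n)%:Z = (h n - `|t 0%R i|)%N%:Z by move: lt lt0; lia.
have T0 : (0 < `|t 0%R i|)%N by move: lt0; lia.
rewrite -modzDr e modz_nat modn_small //.
by move: lt T0; lia.
Qed.

Definition stays n t (y : M n.+1) : bool := gam (y + projM n.+1 t) == gam y.
Arguments stays n t y : clear implicits.

Lemma staysP n t (y : M n.+1) : reflect
  (forall i, ((y 0%R i + (projM n.+1 t : M n.+1) 0%R i) %% h n.+1 %/ h n = y 0%R i %/ h n)%N)
  (stays n t y).
Proof.
apply: (iffP (gam_eqP _ _)) => e i; have := e i;
  by rewrite (@coordD _ _ n.+1 y (projM n.+1 t) i).
Qed.

(** In direction i a point leaves only if its residue is among the |t_i| ones next to the face it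
    moves towards. The directions are then summed. *)
Lemma leave_count n t :
  (#|[pred y : M n.+1 | ~~ stays n t y]| * h n <=
   #|{: M n.+1}| * \sum_i `|t 0%R i|%N)%N.
Proof.
pose L i := [pred y : M n.+1 |
  ((y 0%R i + (projM n.+1 t : M n.+1) 0%R i) %% h n.+1 %/ h n != y 0%R i %/ h n)%N].
have Lle i : (#|L i| * h n <= #|{: M n.+1}| * `|t 0%R i|%N)%N.
  case: (leqP (h n) (`|t 0%R i|%N)) => [le|lt].
    by rewrite leq_mul // max_card.
  have ltH : (`|t 0%R i| < h n.+1)%N.
    by rewrite (leq_trans lt) // dvdn_leq ?h_dvdS // h_gt0.
  pose P (r : nat) := if (0 <= t 0%R i)%R then (h n <= r + `|t 0%R i|)%N else (r < `|t 0%R i|)%N.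
  have sub : (#|L i| <= #|[pred y : M n.+1 | P (y 0%R i %% h n)%N]|)%N.
    apply: subset_leq_card; apply/fintype.subsetP => y; rewrite !inE /P.
    rewrite (coord_projM_small ltH); case: ifPn => s; apply: contraNT.
      rewrite -ltnNge => l; apply/eqP; apply: block_stay_pos => //.
      - exact: h_gt0.
      - exact: h_dvdS.
      - exact: (@coord_lt _ _ n.+1).
    rewrite -leqNgt => l; apply/eqP; apply: block_stay_neg => //.
    - exact: h_gt0.
    - exact: (@coord_lt _ _ n.+1).
  apply: (@leq_trans (#|[pred y : M n.+1 | P (y 0%R i %% h n)%N]| * h n)).
    by rewrite leq_mul2r sub orbT.
  rewrite card_residue leq_mul2l /P; apply/orP; right.
  by case: (0 <= t 0%R i); [exact: card_ord_ge|exact: card_ord_lt].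
apply: (@leq_trans ((\sum_i #|L i|) * h n)).
  rewrite leq_mul2r; apply/orP; right.
  apply: (@leq_trans #|[pred y : M n.+1 | [exists i, L i y]]|).
    apply: subset_leq_card; apply/fintype.subsetP => y; rewrite !inE => ny.
    apply: contraNT ny; rewrite negb_exists => /forallP nL; apply/staysP => i.
    by have := nL i; rewrite /= negbK => /eqP.
  rewrite -sum1_card (eq_bigr (fun i => \sum_(y in L i) 1)%N); last first.
    by move=> i _; rewrite sum1_card.
  rewrite (exchange_big_dep predT) //= [leqRHS](bigID (fun y => [exists i, L i y])) /=.
  apply: leq_trans (leq_addr _ _); apply: leq_sum => y /existsP[i Ly].
  by rewrite (bigD1 i) //.
by rewrite big_distrl big_distrr /=; apply: leq_sum => i _; apply: Lle.
Qed.

(** A shift by nearly the full side h_n leaves only c residues whose points stay. Used one level up,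
    with side h_{n+1} and c = h_n, this yields the factor 1/q_n at the points near the lattice. *)
Lemma stay_count n t i c : (`|t 0%R i| < h n)%N -> (h n <= `|t 0%R i| + c)%N ->
  (0 < `|t 0%R i|)%N ->
  (#|[pred y : M n.+1 | stays n t y]| * h n <= #|{: M n.+1}| * c)%N.
Proof.
move=> lt ge t0.
have ltH : (`|t 0%R i| < h n.+1)%N.
  by rewrite (leq_trans lt) // dvdn_leq ?h_dvdS // h_gt0.
pose P (r : nat) := if (0 <= t 0%R i)%R then (r < c)%N else (h n <= r + c)%N.
have sub : (#|[pred y : M n.+1 | stays n t y]| <= #|[pred y : M n.+1 | P (y 0%R i %% h n)%N]|)%N.
  apply: subset_leq_card; apply/fintype.subsetP => y; rewrite !inE /P.
  move/staysP/(_ i); rewrite (coord_projM_small ltH); case: ifPn => s e.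
    have := block_leave_pos (h_gt0 S n) (h_dvdS n) (h2_leS n) (@coord_lt _ _ n.+1 y i) lt e.
    by move: ge; lia.
  have := block_leave_neg (h_gt0 S n) (h_dvdS n) (h2_leS n) (@coord_lt _ _ n.+1 y i) lt t0 e.
  by move: ge; lia.
apply: (@leq_trans (#|[pred y : M n.+1 | P (y 0%R i %% h n)%N]| * h n)).
  by rewrite leq_mul2r sub orbT.
rewrite card_residue leq_mul2l /P; apply/orP; right.
by case: (0 <= t 0%R i); [exact: card_ord_lt|exact: card_ord_ge].
Qed.

Lemma stay_coord n t y i : stays n t y -> (`|t 0%R i| < h n.+1)%N ->
  (h n <= `|t 0%R i|)%N -> (h n.+1 < `|t 0%R i| + h n)%N.
Proof.
move=> /staysP/(_ i) e ltH ge.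
have := block_near (h_gt0 S n) (h2_leS n) (@coord_lt _ _ n.+1 y i)
  (@coord_lt _ _ n.+1 (projM n.+1 t) i) e.
have := h2_leS n; have := h_gt0 S n.
by rewrite (coord_projM_small ltH); case: ifP => _; lia.
Qed.

(** The corner at h_n puts each coordinate at least one block side away from 0; the upper end is
    limited in [test_box_separated], so that 2t stays away from h_{n+1} as well. *)
Definition test_box n (w : nat) : pred (M n.+1) :=
  fun s => [forall i, (h n <= s 0%R i < h n + w)%N].

Lemma test_box_separated n w s : (0 < d)%N -> (2 * (h n + w) + 2 * h n <= h n.+1)%N ->
  test_box w s -> separated (@gam d S n) s.
Proof.
move=> d0 le /forallP sT; pose i := Ordinal d0.
have /andP[s1 s2] := sT i.
have h0 := h_gt0 S n.
split=> [y|y z /eqP/gam_eqP/(_ i) e].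
  apply/gam_eqP => /(_ i); rewrite (@coordD _ _ n.+1 y s i) => e.
  have := block_near h0 (h2_leS n) (@coord_lt _ _ n.+1 y i) (@coord_lt _ _ n.+1 s i) e.
  by move: s1 s2 le; lia.
apply/gam_eqP => /(_ i) e'; move: e e'.
rewrite (@coordD _ _ n.+1 y s i) (@coordD _ _ n.+1 z s i) => e e'.
apply: (block_swap h0 (@coord_lt _ _ n.+1 y i) (@coord_lt _ _ n.+1 z i) s1 _ e e').
by move: s1 s2 le; lia.
Qed.

Lemma card_test_box n w : (h n + w <= h n.+1)%N -> (w ^ d <= #|@test_box n w|)%N.
Proof.
move=> le.
pose f (v : 'rV['I_w]_d) : M n.+1 := projM n.+1 (\row_i ((h n + v 0%R i)%N%:Z)).
have fE v i : f v 0%R i = (h n + v 0%R i)%N :> nat.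
  apply/eqP; rewrite -eqz_nat coord_projM mxE modz_nat modn_small //.
  by rewrite (leq_trans _ le) // ltn_add2l.
have finj : injective f.
  move=> v v' e; apply/rowP => i; apply: val_inj; apply: (@addnI (h n)).
  by rewrite -!fE e.
rewrite -[X in (X ^ _)%N]card_ord -[X in (_ ^ X)%N]mul1n -card_mx.
rewrite -(fintype.card_image finj); apply: subset_leq_card; apply/fintype.subsetP => s.
move=> /fintype.imageP[v _ ->]; apply/forallP => i.
by rewrite fE leq_addr ltn_add2l ltn_ord.
Qed.

End Translations.

(** * Good and bad levels *)

(* q_n = 4^l with l = 2^s: then #|Gamma_n / Gamma_{n+1}| has the square root
   2^(l d), and since s >= #|M_n| the number of maps M_n -> M_{n0} is at most 2^(s^2),
   negligible against the factor 2^-l in the probability of a bad level.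
   [log4q] is locked because its values must not be computed. *)
Definition size_exp (d : nat) (S : scales) (n : nat) : nat := (h S n ^ d + n + d + 40)%N.
HB.lock Definition log4q (d : nat) (S : scales) (n : nat) : nat := (2 ^ size_exp d S n)%N.

Lemma log4qE d S n : log4q d S n = (2 ^ size_exp d S n)%N. Proof. by rewrite unlock. Qed.

Definition fast (d : nat) (S : scales) : Prop := forall n, q S n = (4 ^ log4q d S n)%N.

Section ExpEstimates.
Variable R : realType.

Lemma expR_half_le2 : expR (2^-1 : R) <= 2.
Proof. by apply: le_trans (expR_le_quad (lexx _)) _; lra. Qed.

Lemma expRN_nat_le (k : nat) : expR (- k%:R : R) <= (2 ^+ k)^-1.
Proof.
rewrite expRN lef_pV2 ?posrE ?expR_gt0 ?exprn_gt0 // -[k%:R]mulr1 expRM_natl.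
rewrite lerXn2r ?nnegrE ?expR_ge0 //.
by have := expR_ge1Dx (1 : R); rewrite (_ : 1 + 1 = 2) //; ring.
Qed.

(** Applied with a = l and c = d, when X^4 L = 2^(4 l d + l) is compared with 2^(l^2). *)
Lemma sq_ge (a c : nat) : (8 * c + 8 <= a)%N -> (a * c * 4 + a <= a ^ 2)%N.
Proof.
move=> le; have : (a * (4 * c + 1) <= a * a)%N by rewrite leq_mul2l; apply/orP; right; lia.
by rewrite expnS expn1; lia.
Qed.

Lemma pow2_ge_quad (k : nat) : (40 <= k)%N -> (k * k + 9 * k <= 2 ^ k)%N.
Proof.
elim: k => // k IHk; rewrite leq_eqVlt => /predU1P[<-|lt].
  by rewrite -(leq_pmul2l (_ : 0 < 1)%N) // !mul1n; vm_compute.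
have := IHk lt; rewrite expnS; move: (2 ^ k)%N => p; nia.
Qed.

(** Here m = |M_n|, X^2 = q_n^d, L = 2^l, Yc = |M_{n+1}|, e is the relative deviation and u the tail
    probability. The worst power, l^8, arises from e^3 Yc, about l^6 m / X, times the outer m <= l.
    The coefficient 4368 is 256 + 4096 + 16, and 512 * 512 merely exceeds 32 * 4369. *)
Lemma variance_arith (l m X L u Yc : R) :
  1 <= l -> 0 < m -> m <= l -> 1 <= L -> L <= X -> 0 < u ->
  X ^+ 4 * u <= 2 / L -> Yc = m * X ^+ 2 ->
  let e := 16 * l ^+ 2 / X in
  Yc ^+ 2 * u <= 2 * l ^+ 8 / L /\
  32 * m * (e ^+ 2 * (m ^+ 2 + Yc * e) + 8 * (Yc ^+ 2 * u)) + 32 * m ^+ 2 / X ^+ 2 <=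
    512 * 512 * (l ^+ 8 / L).
Proof.
move=> l1 m0 ml L1 LX u0 X4u YE e.
have L0 : 0 < L by apply: lt_le_trans L1.
have X0 : 0 < X by apply: lt_le_trans LX.
have l0 : 0 < l by apply: lt_le_trans l1.
pose r := L^-1; pose x := X^-1.
have r0 : 0 < r by rewrite invr_gt0.
have x0 : 0 < x by rewrite invr_gt0.
have xr : x <= r by rewrite lef_pV2 ?posrE.
have r1 : r <= 1 by rewrite invf_le1.
have xx : x * x <= r by rewrite -[leRHS]mul1r ler_pM ?(ltW x0) // (le_trans xr).
have lpow (a c : nat) : (a <= c)%N -> l ^+ a <= l ^+ c.
  by move=> ac; apply: ler_weXn2l.
have lp (a : nat) : 0 <= l ^+ a by rewrite exprn_ge0 ?ltW.
have m2 : m ^+ 2 <= l ^+ 2 by apply: lerXn2r; rewrite ?nnegrE ?(ltW m0) ?(ltW l0).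
have Y0 : 0 < Yc by rewrite YE mulr_gt0 ?exprn_gt0.
have Yu : Yc ^+ 2 * u <= l ^+ 2 * (2 * r).
  have -> : Yc ^+ 2 * u = m ^+ 2 * (X ^+ 4 * u) by rewrite YE; ring.
  apply: ler_pM => //; first exact: sqr_ge0.
  by rewrite mulr_ge0 ?exprn_ge0 ?(ltW u0) ?(ltW X0).
have eE : e = 16 * l ^+ 2 * x by [].
have e0 : 0 <= e by rewrite eE !mulr_ge0 ?ltW // lp.
split.
  apply: le_trans Yu _; have -> : 2 * l ^+ 8 / L = l ^+ 8 * (2 * r) by rewrite /r; ring.
  by rewrite ler_wpM2r ?lpow // mulr_ge0 ?(ltW r0).
have h1 : e ^+ 2 * m ^+ 2 <= 256 * (l ^+ 7 * r).
  have -> : e ^+ 2 * m ^+ 2 = 256 * ((l ^+ 4 * m ^+ 2) * (x * x)) by rewrite eE; ring.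
  apply: ler_wpM2l; [exact: ler0n|apply: ler_pM].
  - by rewrite mulr_ge0 ?sqr_ge0 ?lp.
  - by rewrite mulr_ge0 ?(ltW x0).
  - apply: le_trans (lpow 6%N 7%N isT).
    by rewrite (exprD _ 4 2) ler_wpM2l.
  - exact: xx.
have h2 : e ^+ 2 * (Yc * e) <= 4096 * (l ^+ 7 * r).
  have -> : e ^+ 2 * (Yc * e) = 4096 * ((l ^+ 6 * m) * x).
    by rewrite eE YE /x; field; rewrite gt_eqF.
  apply: ler_wpM2l; [exact: ler0n|apply: ler_pM].
  - by rewrite mulr_ge0 ?(ltW m0) ?lp.
  - exact: ltW.
  - by rewrite (exprSr _ 6) ler_wpM2l.
  - exact: xr.
set T := e ^+ 2 * (m ^+ 2 + Yc * e) + 8 * (Yc ^+ 2 * u).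
have T0 : 0 <= T.
  apply: addr_ge0.
    by apply: mulr_ge0; [exact: sqr_ge0|apply: addr_ge0; [exact: sqr_ge0|
      apply: mulr_ge0; [exact: ltW|exact: e0]]].
  by apply: mulr_ge0; [exact: ler0n|apply: mulr_ge0; [exact: sqr_ge0|exact: ltW]].
have a1 : T <= 4368 * (l ^+ 7 * r).
  have l27 : l ^+ 2 * r <= l ^+ 7 * r by rewrite ler_wpM2r ?(ltW r0) // lpow.
  rewrite /T mulrDr; move: h1 h2 Yu l27; rewrite (mulrCA _ 2 r).
  move: (l ^+ 7 * r) (l ^+ 2 * r) (e ^+ 2 * m ^+ 2) (e ^+ 2 * _) (_ * u).
  by move=> p p' a b c; lra.
have a2 : m ^+ 2 / X ^+ 2 <= l ^+ 8 * r.
  rewrite -exprVn -/x expr2 [x ^+ 2]expr2; apply: ler_pM.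
  - by rewrite mulr_ge0 ?ltW.
  - by rewrite mulr_ge0 ?ltW.
  - by rewrite -expr2; apply: le_trans m2 (lpow 2%N 8%N isT).
  - exact: xx.
have a3 : m * T <= 4368 * (l ^+ 8 * r).
  have -> : 4368 * (l ^+ 8 * r) = l * (4368 * (l ^+ 7 * r)) by ring.
  by apply: ler_pM; [exact: ltW|exact: T0|exact: ml|exact: a1].
have p0 : 0 <= l ^+ 8 * r by rewrite mulr_ge0 ?lp ?(ltW r0).
have -> : 32 * m * T + 32 * m ^+ 2 / X ^+ 2 = 32 * (m * T) + 32 * (m ^+ 2 / X ^+ 2) by ring.
rewrite -/r; move: a2 a3 p0; move: (l ^+ 8 * r) (m * T) (m ^+ 2 / _) => p a b a2 a3 p0.
apply: (@le_trans _ _ (32 * (4368 * p) + 32 * p)); first by rewrite lerD // ler_wpM2l.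
rewrite mulrA -mulrDl; apply: ler_wpM2r => //.
by rewrite -!natrM -natrD ler_nat.
Qed.

End ExpEstimates.

Section LevelProbability.
Variables (R : realType) (d : nat) (S : scales).
Hypothesis d_gt0 : (0 < d)%N.
Hypothesis fastS : fast d S.
Variable n : nat.
Local Notation M := (M d S).
Local Notation Gq := (Gamma_quo d S).
Local Notation s := (size_exp d S n).
Local Notation l := (log4q d S n).
Local Notation W := {ffun Gq n -> M n}.
Let m := #|{: M n}|.
Let X : R := 2 ^+ (l * d).

Lemma s_ge40 : (40 <= s)%N. Proof. by rewrite /size_exp leq_addl. Qed.

Lemma m_le_l : (m <= l)%N.
Proof.
rewrite log4qE /m card_M (leq_trans _ (ltnW (ltn_expl _ _))) //.
by rewrite /size_exp -!addnA leq_addr.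
Qed.

Lemma m_gt0 : (0 < m)%N.
Proof. by rewrite /m card_M expn_gt0 h_gt0. Qed.

Lemma l_ge d' : (d' <= 8 * d)%N -> (d' + 8 <= l)%N.
Proof.
move=> le; have := pow2_ge_quad s_ge40; rewrite -log4qE; have := s_ge40.
have : (d <= s)%N by rewrite /size_exp; lia.
by move: le; move: l s => a c; nia.
Qed.

Lemma X_gt0 : 0 < X. Proof. by rewrite exprn_gt0. Qed.

Lemma card_GqX : #|{: Gq n}|%:R = X ^+ 2 :> R.
Proof.
rewrite card_Gq fastS /X !natrX (_ : 4%:R = 2 ^+ 2) -?exprM; last by ring.
by congr (_ ^+ _); lia.
Qed.

Lemma sqrt_card_Gq : Num.sqrt (#|{: Gq n}|%:R) = X.
Proof. by rewrite card_GqX sqrtr_sqr ger0_norm // ltW // X_gt0. Qed.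

Lemma card_YX : #|{: M n.+1}|%:R = m%:R * X ^+ 2 :> R.
Proof. by rewrite card_M_S natrM card_GqX mulrC. Qed.

(** The threshold of [pr_deviates] with K = l^2. *)
Definition dev_bound (C : R) : R :=
  16 * m%:R * C ^+ 2 * Num.sqrt (#|{: Gq n}|%:R) * l%:R ^+ 2.

Definition rel_err : R := 16 * l%:R ^+ 2 / 2 ^+ (l * d).

Lemma dev_boundE C : dev_bound C = #|{: M n.+1}|%:R * (C ^+ 2 * rel_err).
Proof.
rewrite /dev_bound sqrt_card_Gq card_YX /rel_err -/X.
by field; rewrite gt_eqF // X_gt0.
Qed.

(** The fraction 1/(8d) is small enough that the coordinates of a test shift add up to at most
    h_{n+1} / 4, as [r_close] requires, and large enough that the box keeps the proportion
    (16d)^(-d) of M_{n+1}. *)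
Definition width : nat := (h S n.+1 %/ (8 * d))%N.

Lemma q_ge_d : (16 * d <= q S n)%N.
Proof.
rewrite fastS; have := l_ge (leqnn (8 * d)).
have : (2 * l <= 4 ^ l)%N by elim: (l) => // k IHk; rewrite expnS; case: k IHk => // k; lia.
lia.
Qed.

Definition test_set : pred (M n.+1) := test_box width.

Lemma hS_ge : (16 * d * h S n <= h S n.+1)%N.
Proof. by rewrite hS leq_mul2r q_ge_d orbT. Qed.

Lemma width_ge : (h S n.+1 <= 16 * d * width)%N.
Proof.
have := divn_eq (h S n.+1) (8 * d); have := hS_ge; have := h_gt0 S n.
have : (h S n.+1 %% (8 * d) < 8 * d)%N by rewrite ltn_pmod // muln_gt0 d_gt0.
rewrite -/width; move: width (h S n.+1 %% (8 * d))%N (h S n) (h S n.+1) => w r a b.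
by nia.
Qed.

Lemma width_le : (8 * d * (h S n + width) <= 2 * h S n.+1)%N.
Proof.
have := leq_divM (h S n.+1) (8 * d); have := hS_ge.
rewrite -/width; move: width (h S n) (h S n.+1) => w a b.
by nia.
Qed.

Lemma test_set_separated t : test_set t -> separated (@gam d S n) t.
Proof.
apply: test_box_separated => //.
have := leq_divM (h S n.+1) (8 * d); have := hS_ge; have := d_gt0.
rewrite -/width; move: width (h S n) (h S n.+1) => w a b.
by nia.
Qed.

Let kappa : R := ((16 * d) ^ d)%N%:R^-1.

Lemma card_test_set : kappa * #|{: M n.+1}|%:R <= #|test_set|%:R.
Proof.
rewrite mulrC ler_pdivrMr ?ltr0n ?expn_gt0 ?muln_gt0 ?d_gt0 // -natrM ler_nat.
apply: (@leq_trans ((16 * d * width) ^ d)).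
  by rewrite card_M leq_exp2r // width_ge.
rewrite expnMn mulnC leq_mul2r; apply/orP; right.
apply: card_test_box; have := width_le; have := hS_ge; have := h_gt0 S n; have := d_gt0.
move: width (h S n) (h S n.+1) => w a b.
by nia.
Qed.

Definition bad_level (C : R) (F : M n -> R[i]) (w : W) : bool :=
  deviates (@piM d S n) (@gam d S n) F (dev_bound C) w ||
  (energy (@piM d S n) (@gam d S n) F test_set w <
     #|test_set|%:R * (#|{: M n.+1}|%:R * mean_sqr F ^+ 2) / 2).

Lemma pr_bad_level (C : R) (F : M n -> R[i]) : 0 < C -> (forall a, nc (F a) <= C) ->
  \sum_a F a = 0 -> 0 < mean_sqr F ->
  pr (bad_level C F) <=
    (16 + 4 * (512 * 512) * C ^+ 8 / (kappa ^+ 2 * mean_sqr F ^+ 4)) * (l%:R ^+ 8 / 2 ^+ l).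
Proof.
move=> C0 FC F0 ms0; pose L : R := 2 ^+ l.
have L0 : 0 < L by rewrite exprn_gt0.
have L1 : 1 <= L by rewrite exprn_ege1 // ler1n.
have X0 := X_gt0.
have XL : L <= X.
  by rewrite /L /X ler_eXn2l ?ltr1n // leq_pmulr.
have l1 : 1 <= l%:R :> R by rewrite ler1n (leq_trans _ m_le_l) // m_gt0.
have ml : m%:R <= l%:R :> R by rewrite ler_nat m_le_l.
have m0 : 0 < m%:R :> R by rewrite ltr0n m_gt0.
pose u := expR (2^-1 - l%:R ^+ 2 : R).
have u0 : 0 < u by apply: expR_gt0.
(* The choice K = l^2 pays off here: exp(-l^2) <= 2^(-l^2) absorbs X^4 and still leaves 1/L. *)
have X4u : X ^+ 4 * u <= 2 / L.
  rewrite /u expRD mulrCA; apply: ler_pM.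
  - exact: expR_ge0.
  - by rewrite mulr_ge0 ?exprn_ge0 ?expR_ge0 ?(ltW X0).
  - exact: expR_half_le2.
  rewrite -natrX; apply: (@le_trans _ _ (X ^+ 4 / 2 ^+ (l ^ 2))).
    by rewrite ler_wpM2l ?exprn_ge0 ?(ltW X0) // expRN_nat_le.
  rewrite ler_pdivrMr ?exprn_gt0 // mulrC -ler_pdivrMr ?invr_gt0 // invrK.
  rewrite /X /L -exprM -exprD ler_eXn2l ?ltr1n //.
  exact: sq_ge (l_ge (leqnn (8 * d))).
pose Yc : R := #|{: M n.+1}|%:R.
have YE : Yc = m%:R * X ^+ 2 := card_YX.
have Y0 : 0 < Yc by rewrite YE mulr_gt0 ?exprn_gt0.
pose e := rel_err.
have [Yu Ble] := variance_arith l1 m0 ml L1 XL u0 X4u YE.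
rewrite -/e in Ble; set B := (X in X <= _) in Ble.
pose prd : R := pr (deviates (@piM d S n) (@gam d S n) F (dev_bound C)).
have G0 : (0 < #|{: Gq n}|)%N by rewrite card_Gq expn_gt0 (leq_trans _ (q_ge2 S n)).
have prd_le : prd <= Yc * (8 * u).
  exact: (pr_deviates (@piMD d S n) C0 FC F0 (@fiber_le d S n) m_gt0 _ G0).
have dev_ge0 : 0 <= dev_bound C by rewrite !mulr_ge0 ?sqr_ge0 ?sqrtr_ge0 ?(ltW C0).
pose V := avg (fun w => (energy (@piM d S n) (@gam d S n) F test_set w -
   avg (energy (@piM d S n) (@gam d S n) F test_set)) ^+ 2).
have Vle : V <= Yc ^+ 4 * C ^+ 8 * B.
  have far t : test_set t -> forall y, gam (y + t) != gam y.
    by move=> /test_set_separated[].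
  apply: le_trans (energy_variance (@piM d S n) C0 FC (@fiber_le d S n) far (@near_le d S n) dev_ge0) _.
  rewrite -/m -/Yc -/prd dev_boundE -/Yc -/e card_GqX natrX.
  have -> : Yc ^+ 4 * C ^+ 8 * B = 32 * m%:R * C ^+ 2 *
     ((Yc * (C ^+ 2 * e)) ^+ 2 * Yc ^+ 2 * (m%:R ^+ 2 * C ^+ 2 + Yc * (C ^+ 2 * e)) +
      (Yc * (8 * u)) * (Yc ^+ 5 * C ^+ 6)) + 32 * X ^+ 2 * Yc ^+ 2 * m%:R ^+ 4 * C ^+ 8.
    by rewrite /B (_ : e = 16 * l%:R ^+ 2 / X) // YE; field; rewrite gt_eqF.
  rewrite lerD2r; apply: ler_wpM2l; first by rewrite !mulr_ge0 ?(ltW m0) ?(ltW C0).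
  rewrite lerD2l; apply: ler_wpM2r prd_le.
  by rewrite mulr_ge0 // exprn_ge0 ?(ltW Y0) ?(ltW C0).
pose mu0 : R := #|test_set|%:R * (Yc * mean_sqr F ^+ 2).
have kap0 : 0 < kappa by rewrite invr_gt0 ltr0n expn_gt0 muln_gt0 d_gt0.
have kT : kappa * Yc <= #|test_set|%:R := card_test_set.
have T0 : 0 < #|test_set|%:R :> R by apply: lt_le_trans kT; rewrite mulr_gt0.
have mu0_gt0 : 0 < mu0.
  by apply: mulr_gt0 => //; apply: mulr_gt0 => //; exact: exprn_gt0.
have mu0_le : mu0 <= avg (energy (@piM d S n) (@gam d S n) F test_set).
  rewrite /energy avg_sum /mu0 mulr_natl -sumr_const /=; apply: ler_sum => t Tt.
  exact: (second_moment_ge (@piMD d S n) F0 (test_set_separated Tt)).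
have M0 : (0 < #|{: M n}|)%N := m_gt0.
have cheb := chebyshev_lower mu0_gt0 mu0_le Vle.
apply: le_trans (prU _ _) _; rewrite mulrDl lerD //.
  apply: le_trans prd_le _; rewrite mulrCA [leRHS](_ : _ = 8 * (2 * l%:R ^+ 8 / L)); last first.
    by rewrite /L; ring.
  rewrite ler_wpM2l // (le_trans _ Yu) //.
  rewrite ler_wpM2r ?(ltW u0) // expr2 -[leLHS]mul1r ler_wpM2r ?(ltW Y0) //.
  by rewrite ler1n card_M expn_gt0 h_gt0.
apply: le_trans cheb _.
apply: (@le_trans _ _ (4 * (Yc ^+ 4 * C ^+ 8 * (512 * 512 * (l%:R ^+ 8 / L))) /
     (kappa * Yc * (Yc * mean_sqr F ^+ 2)) ^+ 2)).
  apply: ler_pM.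
  - apply: mulr_ge0 => //; apply: le_trans Vle.
    by apply: avg_ge0 => w; exact: sqr_ge0.
  - by rewrite invr_ge0 sqr_ge0.
  - by rewrite ler_wpM2l // ler_wpM2l // mulr_ge0 ?exprn_ge0 ?(ltW Y0) ?(ltW C0).
  have yms0 : 0 < Yc * mean_sqr F ^+ 2 by apply: mulr_gt0 => //; exact: exprn_gt0.
  set nu := kappa * Yc * _.
  have nu0 : 0 < nu by apply: mulr_gt0 => //; exact: mulr_gt0.
  have numu : nu <= mu0 by apply: ler_wpM2r => //; exact: ltW.
  rewrite lef_pV2 ?posrE; [|exact: exprn_gt0|exact: exprn_gt0].
  by apply: lerXn2r; rewrite ?nnegrE // ltW.
rewrite le_eqVlt; apply/orP; left; apply/eqP.
by rewrite -/L; field; rewrite !gt_eqF.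
Qed.

End LevelProbability.

(** Used for the halving of the errors, with j the increase of [log4q] from one level to the next;
    [l_mono] guarantees j >= 8. *)
Lemma double_sq_le (j : nat) : (8 <= j)%N -> (2 * (1 + j) ^ 2 <= 2 ^ j)%N.
Proof.
elim: j => // j IHj; rewrite leq_eqVlt => /predU1P[<-//|lt].
have := IHj lt; rewrite [(2 ^ j.+1)%N]expnS; move: (2 ^ j)%N => p.
by move: lt; rewrite !expnS !expn0; nia.
Qed.

(** * Correlations along the tower *)

Section Descent.
Variables (R : realType) (d : nat) (S : scales) (alpha : params d S) (n0 : nat).
Local Notation M := (M d S).

(** Levels are written k + n0 so that the successor step holds by conversion and no cast between the
    types M n appears. *)
Fixpoint descend (k : nat) : M (k + n0) -> M n0 :=
  match k return M (k + n0) -> M n0 with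
  | 0 => fun a => a
  | k'.+1 => fun a => @descend k' (phi alpha a)
  end.

Variable f : M n0 -> R[i].

Definition lifted (k : nat) (a : M (k + n0)) : R[i] := f (descend a).

Definition corr (k : nat) (t : 'rV[int]_d) : R[i] :=
  autocorr (@lifted k) (projM (k + n0) t).

Definition level_params (n : nat) : {ffun Gamma_quo d S n -> M n} :=
  [ffun g => alpha g].

Lemma avg_descend (K : numFieldType) k (G : M n0 -> K) :
  avg (fun a : M (k + n0) => G (descend a)) = avg G.
Proof.
elim: k => [//|k IHk] /=; rewrite -IHk.
exact: (avg_phi alpha (fun a : M (k + n0) => G (descend a))).
Qed.

Lemma M_card_gt0 n : (0 < #|{: M n}|)%N.
Proof. by rewrite card_M expn_gt0 h_gt0. Qed.

Lemma M_cardR_gt0 n : 0 < #|{: M n}|%:R :> R.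
Proof. by rewrite ltr0n M_card_gt0. Qed.

Lemma mean_sqr_lifted k : mean_sqr (@lifted k) = mean_sqr f.
Proof. exact: (avg_descend k (fun a => nc (f a) ^+ 2)). Qed.

Lemma sum_lifted k : \sum_a f a = 0 -> \sum_a @lifted k a = 0.
Proof.
move=> f0; rewrite sum_avg ?M_card_gt0 // (avg_descend k f) /avg f0 mul0r mulr0.
by [].
Qed.

Lemma block_lift_lifted k (y : M (k + n0).+1) :
  block_lift (@piM d S (k + n0)) (@gam d S (k + n0)) (@lifted k) (level_params (k + n0)) y =
  @lifted k.+1 y.
Proof. by rewrite /block_lift ffunE /lifted /= phiE. Qed.

Lemma corrS k t : corr k.+1 t =
  block_sum (@piM d S (k + n0)) (@gam d S (k + n0)) (@lifted k) (level_params (k + n0))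
    (projM (k + n0).+1 t) / #|{: M (k + n0).+1}|%:R.
Proof.
rewrite /corr /autocorr /avg; congr (_ / _); apply: eq_bigr => y _.
by rewrite /block_term !block_lift_lifted.
Qed.

Definition stay_frac (n : nat) (t : 'rV[int]_d) : R :=
  #|[pred y : M n.+1 | @stays d S n t y]|%:R / #|{: M n.+1}|%:R.

Lemma stay_frac_ge0 n t : 0 <= stay_frac n t.
Proof. by rewrite divr_ge0 ?ler0n. Qed.

Lemma stay_frac_le1 n t : stay_frac n t <= 1.
Proof. by rewrite ler_pdivrMr ?M_cardR_gt0 // mul1r ler_nat max_card. Qed.

Lemma stay_frac_ge n t : 1 - stay_frac n t <= (\sum_i `|t 0%R i|%N)%N%:R / (h S n)%:R.
Proof.
have h0 : 0 < (h S n)%:R :> R by rewrite ltr0n h_gt0.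
have := @leave_count d S n t; rewrite -(ler_nat R) !natrM /stay_frac.
have -> : #|[pred y : M n.+1 | ~~ @stays d S n t y]|%:R =
   #|{: M n.+1}|%:R - #|[pred y : M n.+1 | @stays d S n t y]|%:R :> R.
  apply/eqP; rewrite eq_sym subr_eq -natrD eqr_nat.
  by rewrite -(cardC [pred y : M n.+1 | @stays d S n t y]) addnC.
have := M_cardR_gt0 n.+1; set Y := #|{: M n.+1}|%:R.
set s := #|[pred y : M n.+1 | @stays d S n t y]|%:R => Y0 le.
have -> : 1 - s / Y = (Y - s) / Y by field; rewrite gt_eqF.
by rewrite ler_pdivrMr // mulrAC ler_pdivlMr // [leRHS]mulrC.
Qed.

Lemma stay_frac_le n (t : 'rV[int]_d) i c : (`|t 0%R i| < h S n)%N -> (h S n <= `|t 0%R i| + c)%N ->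
  (0 < `|t 0%R i|)%N -> stay_frac n t <= c%:R / (h S n)%:R.
Proof.
move=> h1 h2 h3; have h0 : 0 < (h S n)%:R :> R by rewrite ltr0n h_gt0.
rewrite ler_pdivlMr // /stay_frac mulrAC ler_pdivrMr ?M_cardR_gt0 //.
by rewrite -!natrM ler_nat [leqRHS]mulnC (stay_count h1 h2 h3).
Qed.

Section Bounds.
Variable C : R.
Hypothesis C_gt0 : 0 < C.
Hypothesis f_le : forall a, nc (f a) <= C.
Hypothesis d_gt0 : (0 < d)%N.
Hypothesis fastS : fast d S.

Lemma corr_le k t : nc (corr k t) <= C ^+ 2.
Proof. by apply: autocorr_le => // a; exact: f_le. Qed.

Definition good (k : nat) : bool :=
  ~~ bad_level C (@lifted k) (level_params (k + n0)).

Definition err (k : nat) : R := 2 * C ^+ 2 * rel_err R d S (k + n0).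

Lemma err_ge0 k : 0 <= err k.
Proof.
by rewrite /err /rel_err; apply: mulr_ge0; [|apply: divr_ge0];
  rewrite ?exprn_ge0 ?mulr_ge0 ?sqr_ge0 ?(ltW C_gt0).
Qed.

(** The in-block part is [stay_frac] times the previous correlation, up to one [dev_bound]; the
    off-block part costs another. Together, divided by |M_{n+1}|, they make up [err]. *)
Lemma good_step k t : good k ->
  nc (corr k.+1 t - Complex (stay_frac (k + n0) t) 0 * corr k t) <= err k.
Proof.
rewrite /good negb_or => /andP[/existsPn/(_ (projM (k + n0).+1 t)) + _].
rewrite negb_or -!leNgt => /andP[ne eq].
rewrite corrS block_sumE.
set Y := #|{: M (k + n0).+1}|%:R : R.
have Y0 : 0 < Y := M_cardR_gt0 _.
have YC : #|{: M (k + n0).+1}|%:R = Complex Y 0 :> R[i] by rewrite natCE.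
have Yn0 : #|{: M (k + n0).+1}|%:R != 0 :> R[i] by rewrite pnatr_eq0 -lt0n M_card_gt0.
have -> : Complex (stay_frac (k + n0) t) 0 =
   (near_count (@gam d S (k + n0)) (projM (k + n0).+1 t))%:R / #|{: M (k + n0).+1}|%:R :> R[i].
  by rewrite divnCE natCE /= mul0r.
move: ne eq; rewrite piM_projM -/(corr k t).
move: (offblock_sum _ _ _ _ _) (inblock_sum _ _ _ _ _) (near_count _ _) => A B c ne eq.
have -> : (B + A) / #|{: M (k + n0).+1}|%:R - c%:R / #|{: M (k + n0).+1}|%:R * corr k t =
  (A + (B - c%:R * corr k t)) / #|{: M (k + n0).+1}|%:R by field.
rewrite ncM Normc.normcV nc_nat -/Y ler_pdivrMr //.
rewrite (le_trans (ncD _ _)) //.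
have -> : err k * Y = dev_bound d S (k + n0) C + dev_bound d S (k + n0) C.
  by rewrite dev_boundE // /err -/Y; ring.
exact: lerD.
Qed.

Lemma good_stepD k t : good k ->
  nc (corr k.+1 t - corr k t) <= (1 - stay_frac (k + n0) t) * nc (corr k t) + err k.
Proof.
move=> /(good_step t) st.
have -> : corr k.+1 t - corr k t =
  (corr k.+1 t - Complex (stay_frac (k + n0) t) 0 * corr k t) +
  - (Complex (1 - stay_frac (k + n0) t) 0 * corr k t).
  have -> : Complex (1 - stay_frac (k + n0) t) 0 = 1 - Complex (stay_frac (k + n0) t) 0.
    by rewrite [RHS]/(_ + _) /= oppr0 addr0.
  by ring.
rewrite (le_trans (ncD _ _)) // addrC lerD // ncN ncM ler_wpM2r ?nc_ge0 //=.
by rewrite expr0n addr0 sqrtr_sqr ger0_norm // subr_ge0 stay_frac_le1.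
Qed.

Lemma good_step_le k t : good k ->
  nc (corr k.+1 t) <= stay_frac (k + n0) t * nc (corr k t) + err k.
Proof.
move=> /(good_step t) st.
rewrite -[corr k.+1 t](subrK (Complex (stay_frac (k + n0) t) 0 * corr k t)) addrC.
rewrite (le_trans (ncD _ _)) // lerD // ncM ler_wpM2r ?nc_ge0 //=.
by rewrite expr0n addr0 sqrtr_sqr ger0_norm // stay_frac_ge0.
Qed.

Lemma l_mono n : (log4q d S n + 8 <= log4q d S n.+1)%N.
Proof.
rewrite !log4qE.
have le : (size_exp d S n < size_exp d S n.+1)%N.
  have : (h S n ^ d <= h S n.+1 ^ d)%N.
    by rewrite leq_exp2r // hS leq_pmull // (leq_trans _ (q_ge2 S n)).
  by rewrite /size_exp; move: (_ ^ d)%N (_ ^ d)%N => a b; lia.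
apply: (@leq_trans (2 ^ (size_exp d S n).+1)); last by rewrite leq_exp2l.
rewrite expnS mul2n -addnn leq_add2l (@leq_trans (2 ^ 3)) // leq_exp2l //.
by rewrite (leq_trans _ (s_ge40 d S n)).
Qed.

Lemma size_exp_le_log4q n : (size_exp d S n <= log4q d S n)%N.
Proof. by rewrite log4qE ltnW // ltn_expl. Qed.

(** When l grows from a to a + j, the numerator grows by at most (1 + j)^2 and the denominator by
    2^(j d). Halving makes all later errors together comparable to the first. *)
Lemma err_half k : err k.+1 <= err k / 2.
Proof.
rewrite /err -[leRHS]mulrA; apply: ler_wpM2l; first by rewrite mulr_ge0 ?sqr_ge0.
rewrite /rel_err addSn.
set n := (k + n0)%N; set a := log4q d S n; set c := log4q d S n.+1.
have ac : (a + 8 <= c)%N by exact: l_mono.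
have a40 : (40 <= a)%N by rewrite (leq_trans _ (size_exp_le_log4q n)) ?s_ge40.
have key : (c ^ 2 * 2 * 2 ^ (a * d) <= a ^ 2 * 2 ^ (c * d))%N.
  have /subnKC <- : (a <= c)%N := leq_trans (leq_addr 8 a) ac.
  have := d_gt0; have j8' : (8 <= c - a)%N by rewrite leq_subRL // (leq_trans (leq_addr 8 a)).
  move: j8' a40.
  move: (c - a)%N => j j8 a40 d0.
  have a1 : (0 < a)%N by apply: leq_trans a40.
  have h1 : ((a + j) ^ 2 <= a ^ 2 * (1 + j) ^ 2)%N.
    by rewrite -expnMn leq_exp2r // mulnDr muln1 leq_add2l leq_pmull.
  have h2 : (2 * (1 + j) ^ 2 <= 2 ^ (j * d))%N.
    by rewrite (leq_trans (double_sq_le j8)) // leq_exp2l // leq_pmulr.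
  rewrite mulnDl expnD mulnCA [leqLHS]mulnC leq_mul2l; apply/orP; right.
  apply: (@leq_trans (a ^ 2 * (2 * (1 + j) ^ 2))); last by rewrite leq_mul2l h2 orbT.
  by rewrite mulnCA mulnC leq_mul2l h1 orbT.
have P0 : 0 < 2 ^+ (a * d) :> R by rewrite exprn_gt0.
have Q0 : 0 < 2 ^+ (c * d) :> R by rewrite exprn_gt0.
move: key; rewrite -(ler_nat R) !natrM !natrX; move: P0 Q0.
move: (2 ^+ (a * d)) (2 ^+ (c * d)) => P Q P0 Q0 key.
rewrite ler_pdivrMr //.
have -> : 16 * a%:R ^+ 2 / P / 2 * Q = 16 * (a%:R ^+ 2 * Q) / (P * 2).
  by field; rewrite gt_eqF.
rewrite ler_pdivlMr ?mulr_gt0 // (_ : 16 * c%:R ^+ 2 * (P * 2) = 16 * (c%:R ^+ 2 * 2 * P)); last by ring.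
by apply: ler_wpM2l => //; exact: ler0n.
Qed.

End Bounds.
End Descent.

Definition sup_le (d : nat) (t : 'rV[int]_d) (H : nat) : bool := [forall i, (`|t 0%R i| < H)%N].

Section Zones.
Variables (d : nat) (S : scales).
Local Notation M := (M d S).
Local Notation h := (h S).

(* For t below h_{n+1} this forces each t_i to be within h_n of 0 or +-h_{n+1}. *)
Definition near (n : nat) (t : 'rV[int]_d) : bool := [exists y : M n.+1, @stays d S n t y].

Section Counting.
Variable n : nat.

(** A coordinate below h_{n+1} in absolute value is recovered from its class and its sign; the signs
    are the source of the factor 2^d. *)
Let enc (t : 'rV[int]_d) : {ffun 'I_d -> bool} * M n.+1 :=
  ([ffun i => 0 <= t 0%R i], projM n.+1 t).

Lemma enc_inj (s : seq 'rV[int]_d) : all (fun t => sup_le t (h n.+1)) s -> {in s &, injective enc}.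
Proof.
move=> /allP sH t t' ts t's [e1 e2]; apply/rowP => i.
have /forallP/(_ i) b := sH _ ts; have /forallP/(_ i) b' := sH _ t's.
have := congr1 (fun g : {ffun 'I_d -> bool} => g i) e1; rewrite !ffunE => e3.
have := congr1 (fun a : M n.+1 => nat_of_ord (a 0%R i)) e2.
rewrite !coord_projM_small // -e3; case: ifP e3 => [a /esym c|/negbT a /esym/negbT c] e.
  by rewrite -(gez0_abs a) -(gez0_abs c) e.
by move: a c e b b'; lia.
Qed.

Lemma size_zone_le (s : seq 'rV[int]_d) : uniq s -> all (fun t => sup_le t (h n.+1)) s ->
  (size s <= 2 ^ d * #|{: M n.+1}|)%N.
Proof.
move=> us sH; rewrite -(size_map enc).
have /card_uniqP <- : uniq (map enc s) by rewrite map_inj_in_uniq //; exact: enc_inj.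
rewrite (leq_trans (max_card _)) // card_prod card_ffun card_bool card_ord.
by [].
Qed.

Lemma size_near_le (s : seq 'rV[int]_d) : uniq s -> all (fun t => sup_le t (h n.+1)) s -> all (near n) s ->
  (size s <= 2 ^ d * #|{: M n}| ^ 2)%N.
Proof.
move=> us sH /allP sn; rewrite -(size_map enc).
have /card_uniqP <- : uniq (map enc s) by rewrite map_inj_in_uniq //; exact: enc_inj.
pose P := [pred s : M n.+1 | [exists y : M n.+1, gam (y + s)%R == gam y]].
apply: (@leq_trans (#|[pred p : {ffun 'I_d -> bool} * M n.+1 | p.2 \in P]|)).
  apply: subset_leq_card; apply/fintype.subsetP => _ /mapP[t ts ->].
  by rewrite !inE; exact: (sn _ ts).
rewrite (_ : #|_| = #|{: {ffun 'I_d -> bool}}| * #|P|)%N.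
  by rewrite card_ffun card_bool card_ord leq_mul2l near_le orbT.
rewrite -cardX; apply: eq_card => p; rewrite !inE.
by [].
Qed.

End Counting.

Definition zvec n (s : M n.+1) : 'rV[int]_d := \row_i (s 0%R i)%:Z.

Lemma projM_zvec n (s : M n.+1) : projM n.+1 (zvec s) = s.
Proof.
apply: M_eqP => i; apply/eqP; rewrite -eqz_nat coord_projM mxE modz_nat modn_small //.
exact: (@coord_lt _ _ n.+1).
Qed.

Lemma h_iter n j : (2 ^ j * h n <= h (j + n))%N.
Proof.
elim: j => [|j IHj]; first by rewrite mul1n.
rewrite expnS -mulnA addSn (leq_trans _ (h2_leS _)) //.
by rewrite leq_mul2l IHj.
Qed.

End Zones.

(** * From good levels to the limit correlations *)

Section LimitBounds.
Variables (R : realType) (d : nat) (S : scales) (alpha : params d S) (n0 : nat).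
Local Notation M := (M d S).
Variable f : M n0 -> R[i].
Variable C : R.
Hypothesis C_gt0 : 0 < C.
Hypothesis f_le : forall a, nc (f a) <= C.
Hypothesis d_gt0 : (0 < d)%N.
Hypothesis fastS : fast d S.
Local Notation corr := (corr alpha f).
Local Notation err := (err d S n0 C).
Local Notation h := (h S).
Variables (r : 'rV[int]_d -> R[i]) (k1 : nat).
Hypothesis goodk : forall k, (k1 <= k)%N -> good alpha f C k.
Hypothesis corr_lim : forall t (e : R), 0 < e -> exists k2, forall k, (k2 <= k)%N ->
  nc (corr k t - r t) <= e.

Lemma lim_le t (k : nat) (x : R) (c : R[i]) :
  (forall j, (k <= j)%N -> nc (corr j t - c) <= x) -> nc (r t - c) <= x.
Proof.
move=> le; apply/ler_addgt0Pr => e e0; have [k2 lim] := corr_lim t e0.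
have j1 := le _ (leq_maxl k k2); have j2 := lim _ (leq_maxr k k2).
have -> : r t - c = (corr (maxn k k2) t - c) + - (corr (maxn k k2) t - r t) by ring.
by rewrite (le_trans (ncD _ _)) // lerD // ncN.
Qed.

Lemma lim_le0 t (k : nat) (x : R) :
  (forall j, (k <= j)%N -> nc (corr j t) <= x) -> nc (r t) <= x.
Proof.
move=> le; rewrite -[r t]subr0; apply: (@lim_le _ k) => j kj.
by rewrite subr0 le.
Qed.

Lemma r_le t : nc (r t) <= C ^+ 2.
Proof. by apply: (@lim_le0 _ 0) => j _; apply: corr_le. Qed.

Lemma err_half' k : err k.+1 <= err k / 2.
Proof. exact: err_half. Qed.

Lemma err_pos k : 0 <= err k.
Proof. exact: err_ge0. Qed.

(** By halving, one step error err is at most 2 (err - next err), so the right-hand side telescopes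
    and no geometric sum is needed. *)
Lemma corr_decay k j t : (k1 <= k)%N ->
  nc (corr (k + j) t) <= nc (corr k t) + 2 * (err k - err (k + j)).
Proof.
move=> kk; elim: j => [|j IHj]; first by rewrite addn0 subrr mulr0 addr0.
rewrite addnS.
have st := good_step_le d_gt0 fastS t (goodk (leq_trans kk (leq_addr j k))).
have := err_half' (k + j).
have : stay_frac R S (k + j + n0) t * nc (corr (k + j) t) <= nc (corr (k + j) t).
  by rewrite -[leRHS]mul1r ler_wpM2r ?nc_ge0 ?stay_frac_le1.
by move: st IHj; lra.
Qed.

Lemma r_tail k t : (k1 <= k)%N -> nc (r t) <= nc (corr k t) + 2 * err k.
Proof.
move=> kk; apply: (@lim_le0 _ k) => j kj; rewrite -(subnKC kj).
have := corr_decay (j - k) t kk; have := err_pos (k + (j - k)); lra.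
Qed.

Lemma zone_far k t : (k1 <= k)%N -> ~~ near S (k + n0) t -> nc (r t) <= 2 * err k.
Proof.
move=> kk /existsPn far.
have := r_tail t (leqW kk); have := err_half' k.
have := good_step_le d_gt0 fastS t (goodk kk).
have -> : stay_frac R S (k + n0) t = 0.
  rewrite /stay_frac eq_card0 ?mul0r // => y.
  by apply/negbTE; exact: far.
by rewrite mul0r add0r; lra.
Qed.

(** Level n gives nothing for such t. But some |t_j| exceeds h_{n+1} - h_n, so at level n + 1 only
    the proportion h_n / h_{n+1} of the points stays in its block. *)
Lemma zone_near k t : (k1 <= k)%N -> sup_le t (h (k + n0).+1) -> ~~ sup_le t (h (k + n0)) ->
  near S (k + n0) t -> nc (r t) <= C ^+ 2 / (q S (k + n0))%:R + 2 * err k.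
Proof.
move=> kk /forallP tH; rewrite {1}/sup_le negb_forall => /existsP[j].
rewrite -leqNgt => ti /existsP[y ys].
have h0 := h_gt0 S (k + n0).
have ge := stay_coord ys (tH j) ti.
have fr : stay_frac R S (k.+1 + n0) t <= (q S (k + n0))%:R^-1.
  apply: le_trans (stay_frac_le R (tH j) (ltnW ge) (leq_trans h0 ti)) _.
  rewrite hS natrM invfM mulrCA divff ?mulr1 // pnatr_eq0 -lt0n //.
have := r_tail t (leqW (leqW kk)); have := err_half' k; have := err_half' k.+1.
have := good_step_le d_gt0 fastS t (goodk (leqW kk)).
have : stay_frac R S (k.+1 + n0) t * nc (corr k.+1 t) <= C ^+ 2 / (q S (k + n0))%:R.
  rewrite mulrC; apply: ler_pM; rewrite ?nc_ge0 ?stay_frac_ge0 //.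
  exact: corr_le.
by have := err_pos k; lra.
Qed.

(** At j levels further on the proportion of points leaving their block is at most 2^(-j) / 4, so
    over all later levels the correlation loses at most half of its size, up to errors. *)
Lemma r_close k (t : 'rV[int]_d) : (k1 <= k.+1)%N -> (4 * \sum_i `|t 0%R i| <= h (k.+1 + n0))%N ->
  nc (r t - corr k.+1 t) <= nc (corr k.+1 t) / 2 + 3 * err k.+1.
Proof.
move=> kk tle; set a := nc (corr k.+1 t); set e := err k.+1.
have a0 : 0 <= a := nc_ge0 _.
have e0 : 0 <= e := err_pos _.
(* The first term sums the losses 2^(-j) / 4 of at most a + 2e, the second telescopes the errors. *)
suff H j : nc (corr (k.+1 + j) t - corr k.+1 t) <=
    (a + 2 * e) / 2 * (1 - 2^-1 ^+ j) + 2 * (e - err (k.+1 + j)).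
  apply: (@lim_le _ k.+1) => j kj; rewrite -(subnKC kj).
  apply: le_trans (H _) _; have := err_pos (k.+1 + (j - k.+1)).
  have : 0 <= 2^-1 ^+ (j - k.+1) :> R by rewrite exprn_ge0.
  move: (2^-1 ^+ _) (err _) => x y x0 y0.
  have : 0 <= (a + 2 * e) * x by rewrite mulr_ge0 // addr_ge0 // mulr_ge0.
  by move=> h; lra.
elim: j => [|j IHj]; first by rewrite addn0 expr0 !subrr nc0 !mulr0 addr0.
rewrite addnS.
have kj : (k1 <= k.+1 + j)%N by rewrite (leq_trans kk) // leq_addr.
have st := good_stepD d_gt0 fastS t (goodk kj).
have dec := corr_decay j t kk; rewrite -/a -/e in dec.
have eh := err_half' (k.+1 + j).
have fr : 1 - stay_frac R S (k.+1 + j + n0) t <= 4^-1 * 2^-1 ^+ j.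
  apply: le_trans (stay_frac_ge R S (k.+1 + j + n0) t) _.
  have hj : (2 ^ j * h (k.+1 + n0) <= h (k.+1 + j + n0))%N.
    by rewrite [(k.+1 + j)%N]addnC -addnA h_iter.
  have h0 := h_gt0 S (k.+1 + n0).
  rewrite ler_pdivrMr ?ltr0n ?h_gt0 // exprVn -invfM mulrC ler_pdivlMr; last first.
    by rewrite mulr_gt0 ?exprn_gt0.
  rewrite -natrX -!natrM ler_nat mulnA (leq_trans _ hj) // mulnC leq_mul2l mulnC tle.
  by rewrite orbT.
have fr0 : 0 <= 1 - stay_frac R S (k.+1 + j + n0) t by rewrite subr_ge0 stay_frac_le1.
have ae : nc (corr (k.+1 + j) t) <= a + 2 * e by have := err_pos (k.+1 + j); lra.
have pr : (1 - stay_frac R S (k.+1 + j + n0) t) * nc (corr (k.+1 + j) t) <=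
    (4^-1 * 2^-1 ^+ j) * (a + 2 * e).
  by apply: ler_pM; rewrite ?nc_ge0.
have -> : corr (k.+1 + j).+1 t - corr k.+1 t =
  (corr (k.+1 + j).+1 t - corr (k.+1 + j) t) + (corr (k.+1 + j) t - corr k.+1 t) by ring.
apply: le_trans (ncD _ _) _; apply: le_trans (lerD st IHj) _.
rewrite exprSr; move: pr eh; move: (2^-1 ^+ j) (_ * nc _) (err (k.+1 + j)) (err _) => x p y z.
by move=> pr eh; nra.
Qed.

(** Since |r| >= |corr| / 2 - 3 err by [r_close], |r|^2 is at least |corr|^2 / 8 - 9 err^2 on the
    test set; the remaining factor 1/2 in 1/16 is the one from [bad_level]. *)
Lemma test_energy_ge k : (k1 <= k)%N ->
  ((16 * d) ^ d)%N%:R^-1 * mean_sqr f ^+ 2 / 16 - 9 * #|{: M (k + n0).+1}|%:R * err k.+1 ^+ 2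
  <= \sum_(s | test_set s) nc (r (@zvec d S (k + n0) s)) ^+ 2.
Proof.
move=> kk; set n := (k + n0)%N; set Y := #|{: M n.+1}|%:R : R; set e := err k.+1.
have Y0 : 0 < Y := M_cardR_gt0 _ _ _ _.
have := goodk kk; rewrite /good negb_or -leNgt => /andP[_]; rewrite -/n -/Y.
rewrite /energy.
have cE s : block_sum (@piM d S n) (@gam d S n) (@lifted R d S alpha n0 f k) (level_params alpha n) s =
   corr k.+1 (zvec s) * #|{: M n.+1}|%:R.
  rewrite corrS -/n projM_zvec divfK // pnatr_eq0 -lt0n; exact: M_card_gt0.
under eq_bigr => s _ do rewrite cE ncM nc_nat exprMn.
rewrite -mulr_suml -/Y mean_sqr_lifted => en.
set Q := \sum_(s | test_set s) nc (corr k.+1 (zvec s)) ^+ 2 in en.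
have kap := card_test_set R d_gt0 fastS n; rewrite -/Y in kap.
set kappa := (_%:R^-1) in kap *.
have Qge : kappa * mean_sqr f ^+ 2 / 2 <= Q.
  rewrite -(ler_pM2r (exprn_gt0 2 Y0)); apply: le_trans en.
  have -> : kappa * mean_sqr f ^+ 2 / 2 * Y ^+ 2 =
    kappa * Y * (Y * mean_sqr f ^+ 2) / 2 by ring.
  by rewrite ler_wpM2r // ler_wpM2r // mulr_ge0 ?sqr_ge0 // ltW.
have pt (s : M n.+1) : test_set s -> nc (corr k.+1 (zvec s)) ^+ 2 / 8 - 9 * e ^+ 2 <=
    nc (r (zvec s)) ^+ 2.
  move=> /forallP ts.
  have tle : (4 * \sum_i `|zvec s 0%R i| <= h (k.+1 + n0))%N.
    have sum_le : (\sum_i `|zvec s 0%R i| <= d * (h n + width d S n))%N.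
      move: (width d S n) ts => w ts.
      rewrite -[X in (_ <= X * _)%N](card_ord d) -sum_nat_const; apply: leq_sum => i _.
      by rewrite mxE absz_nat; have /andP[_ /ltnW] := ts i.
    have := width_le d_gt0 fastS n; rewrite addSn -/n; move: sum_le.
    by move: (\sum_i _)%N (h n + width d S n)%N (h n.+1) => x y z; lia.
  have := r_close (leqW kk) tle; rewrite -/e.
  have : nc (corr k.+1 (zvec s)) <= nc (r (zvec s) - corr k.+1 (zvec s)) + nc (r (zvec s)).
    have := ncD (- (r (zvec s) - corr k.+1 (zvec s))) (r (zvec s)).
    by rewrite ncN opprB subrK.
  have := nc_ge0 (r (zvec s)); have := nc_ge0 (corr k.+1 (zvec s)); have := err_pos k.+1.
  rewrite -/e; move: (nc (corr _ _)) (nc (r _)) (nc (_ - _)) => a x z e0 a0 x0 h1 h2.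
  have : (a / 2) ^+ 2 <= (x + 3 * e) ^+ 2.
    by apply: lerXn2r; rewrite ?nnegrE; lra.
  have -> : (a / 2) ^+ 2 = a ^+ 2 / 4 by field.
  have := sqr_ge0 (x - 3 * e).
  have -> : (x - 3 * e) ^+ 2 = x ^+ 2 + 9 * e ^+ 2 - 6 * (x * e) by ring.
  have -> : (x + 3 * e) ^+ 2 = x ^+ 2 + 9 * e ^+ 2 + 6 * (x * e) by ring.
  by move: (x ^+ 2) (a ^+ 2) (e ^+ 2) (x * e) => p1 p2 p3 p4; lra.
apply: le_trans (ler_sum _ pt); rewrite sumrB -mulr_suml -/Q; apply: lerD.
  by move: Qge; set p := kappa * _; lra.
rewrite lerN2 sumr_const -[leLHS]mulr_natl mulrCA -mulrA.
by rewrite ler_wpM2l // ler_wpM2r ?sqr_ge0 // ler_nat max_card.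
Qed.

End LimitBounds.

(** * Decay and summability *)

Section Growth.
Variable R : realType.

Lemma pow_le_expR (a : nat) (c : R) : 0 < c ->
  exists2 K : R, 0 < K & forall l : nat, (0 < l)%N -> l%:R ^+ a <= K * expR (c * l%:R).
Proof.
move=> c0; have a0 : 0 < a.+1%:R :> R by rewrite ltr0n.
exists ((a.+1%:R / c) ^+ a.+1) => [|l l0]; first by rewrite exprn_gt0 // divr_gt0.
have lR : 1 <= l%:R :> R by rewrite ler1n.
apply: le_trans (ler_weXn2l lR (leqnSn a)) _.
have -> : c * l%:R = a.+1%:R * (c / a.+1%:R * l%:R) by field; rewrite gt_eqF.
rewrite expRM_natl -exprMn; apply: lerXn2r; rewrite ?nnegrE ?ler0n //.
  by rewrite mulr_ge0 ?expR_ge0 // divr_ge0 // ltW.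
rewrite -ler_pdivrMl ?divr_gt0 // invf_div.
by apply: le_trans (expR_ge1Dx _); rewrite lerDr.
Qed.

Lemma powR_pow2 (k : nat) (p : R) : (2 ^+ k) `^ p = expR (p * ln 2 * k%:R).
Proof.
by rewrite /powR gt_eqF ?exprn_gt0 // lnXn // -(mulr_natr (ln 2)) mulrA.
Qed.

Lemma powR_nat_le (l a : nat) (p : R) : (0 < l)%N -> p <= a%:R -> l%:R `^ p <= l%:R ^+ a.
Proof. by move=> l0 pa; rewrite -powR_mulrn ?ler0n // ler_powR // ler1n. Qed.

Lemma powR_ratio_le (c X p : R) (l a : nat) : 0 <= c -> 0 < X -> (0 < l)%N -> 2 * p <= a%:R ->
  (c * (l%:R ^+ 2 / X)) `^ p <= c `^ p * (l%:R ^+ a * X `^ (- p)).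
Proof.
move=> c0 X0 l0 pa; have Xi0 : 0 <= X^-1 by rewrite invr_ge0 ltW.
rewrite powRM // ?mulr_ge0 ?sqr_ge0 //; apply: ler_wpM2l; first exact: powR_ge0.
rewrite powRM ?sqr_ge0 // -[X^-1](powR_inv1 (ltW X0)) -powRrM mulN1r.
apply: ler_wpM2r; first exact: powR_ge0.
rewrite (_ : l%:R ^+ 2 = l%:R `^ 2); last by rewrite -powR_mulrn.
by rewrite -powRrM; exact: powR_nat_le.
Qed.

End Growth.

Lemma all_filterW (T : Type) (a b : pred T) (s : seq T) : all a s -> all a [seq x <- s | b x].
Proof. by elim: s => //= x s IHs /andP[ax /IHs]; case: (b x) => //=; rewrite ax. Qed.

Section Asymptotics.
Variables (R : realType) (d : nat) (S : scales) (n0 : nat) (C ms : R).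
Local Notation M := (M d S).
Local Notation h := (h S).
Local Notation err := (err d S n0 C).
Hypothesis C_gt0 : 0 < C.
Hypothesis ms_gt0 : 0 < ms.
Hypothesis d_gt0 : (0 < d)%N.
Hypothesis fastS : fast d S.
Variables (r : 'rV[int]_d -> R[i]) (k1 : nat).
Hypothesis r_le : forall t, nc (r t) <= C ^+ 2.
Hypothesis zone_far : forall k t, (k1 <= k)%N -> ~~ near S (k + n0) t -> nc (r t) <= 2 * err k.
Hypothesis zone_near : forall k t, (k1 <= k)%N -> sup_le t (h (k + n0).+1) ->
  ~~ sup_le t (h (k + n0)) -> near S (k + n0) t ->
  nc (r t) <= C ^+ 2 / (q S (k + n0))%:R + 2 * err k.
Hypothesis test_ge : forall k, (k1 <= k)%N ->
  ((16 * d) ^ d)%N%:R^-1 * ms ^+ 2 / 16 - 9 * #|{: M (k + n0).+1}|%:R * err k.+1 ^+ 2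
  <= \sum_(s | test_set s) nc (r (@zvec d S (k + n0) s)) ^+ 2.

Local Notation lg n := (log4q d S n).

Lemma lg_gt0 n : (0 < lg n)%N.
Proof. by rewrite log4qE expn_gt0. Qed.

Lemma lgR_ge1 n : 1 <= (lg n)%:R :> R.
Proof. by rewrite ler1n lg_gt0. Qed.

Lemma lg_ge_pow2 k : (2 ^ k <= lg (k + n0))%N.
Proof. by rewrite log4qE leq_exp2l // /size_exp; lia. Qed.

Lemma lg_gt k : (k < lg (k + n0))%N.
Proof. exact: leq_trans (ltn_expl _ _) (lg_ge_pow2 k). Qed.

(** Twice [err] accounts for 64 C^2, the term C^2 / q_n for one more. *)
Let A := 65 * C ^+ 2.

(** Since q_n = 4^l, both 1/q_n and 2^(-l d) are at most 2^(-l) = q_n^(-1/2); this common bound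
    gives the exponent 1/2 in every dimension. *)
Lemma zone_le k t : (k1 <= k)%N -> sup_le t (h (k + n0).+1) -> ~~ sup_le t (h (k + n0)) ->
  nc (r t) <= A * ((lg (k + n0))%:R ^+ 2 / 2 ^+ lg (k + n0)).
Proof.
move=> kk t1 t2; set l := lg _; set u := _ / _.
have l1 : 1 <= l%:R :> R by exact: lgR_ge1.
have p0 : 0 < 2 ^+ l :> R by rewrite exprn_gt0.
have C0 : 0 <= C ^+ 2 by exact: sqr_ge0.
have u0 : 0 <= u by rewrite divr_ge0 ?sqr_ge0 // ltW.
have e2 : 2 * err k <= 64 * C ^+ 2 * u.
  rewrite /err /rel_err -/l.
  have -> : 2 * (2 * C ^+ 2 * (16 * l%:R ^+ 2 / 2 ^+ (l * d))) =
     64 * C ^+ 2 * (l%:R ^+ 2 / 2 ^+ (l * d)) by ring.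
  apply: ler_wpM2l; first by rewrite mulr_ge0.
  apply: ler_wpM2l; first exact: sqr_ge0.
  by rewrite lef_pV2 ?posrE ?exprn_gt0 // ler_eXn2l ?ltr1n // leq_pmulr.
have q2 : C ^+ 2 / (q S (k + n0))%:R <= C ^+ 2 * u.
  apply: ler_wpM2l => //; rewrite /u fastS natrX -/l.
  apply: (@le_trans _ _ (2 ^+ l)^-1).
    rewrite lef_pV2 ?posrE ?exprn_gt0 //; apply: lerXn2r; rewrite ?nnegrE ?ler0n //.
    by rewrite ler_nat.
  by rewrite -[leLHS]mul1r ler_wpM2r ?invr_ge0 ?(ltW p0) // exprn_ege1.
have -> : A * u = C ^+ 2 * u + 64 * C ^+ 2 * u by rewrite /A; ring.
case: (boolP (near S (k + n0) t)) => nt.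
  exact: le_trans (zone_near kk t1 t2 nt) (lerD q2 e2).
apply: le_trans (zone_far kk nt) (le_trans e2 _).
by rewrite lerDr mulr_ge0.
Qed.

Lemma h_ge_pow2 n : (2 ^ n <= h n)%N.
Proof.
elim: n => [|n IHn]; first by rewrite h_gt0.
by rewrite expnS (leq_trans _ (h2_leS n)) // leq_mul2l IHn.
Qed.

Lemma sup_le_exists (t : 'rV[int]_d) : exists k, sup_le t (h (k + n0)).
Proof.
exists (\max_i `|t 0%R i|)%N; apply/forallP => i.
apply: leq_trans (h_ge_pow2 _); apply: (leq_ltn_trans _ (ltn_expl _ (isT : 1 < 2)%N)).
by rewrite (leq_trans _ (leq_addr _ _)) // leq_bigmax.
Qed.

Lemma sup_le_mono (t : 'rV[int]_d) H H' : (H <= H')%N -> sup_le t H -> sup_le t H'.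
Proof. by move=> le /forallP tH; apply/forallP => i; apply: leq_trans (tH i) le. Qed.

Lemma h_mono k k' : (k <= k')%N -> (h k <= h k')%N.
Proof.
move=> /subnK <-; apply: leq_trans (h_iter _ _ _).
by rewrite leq_pmull // expn_gt0.
Qed.

Lemma zone_exists (t : 'rV[int]_d) k : ~~ sup_le t (h (k + n0)) ->
  exists2 k', (k <= k')%N & sup_le t (h (k' + n0).+1) && ~~ sup_le t (h (k' + n0)).
Proof.
move=> nt; have ex : exists j, sup_le t (h (j + n0)) := sup_le_exists t.
case: (ex_minnP ex) => [[|k'] tk' mn].
  by case/negP: nt; apply: sup_le_mono tk'; apply: h_mono; rewrite leq_add2r.
exists k'; last first.
  by rewrite tk'; apply/negP => /mn; rewrite ltnn.
rewrite leqNgt; apply: contra nt => lt; apply: sup_le_mono tk'; apply: h_mono.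
by rewrite leq_add2r.
Qed.

Lemma enorm_le (t : 'rV[int]_d) H : sup_le t H -> enorm R t <= d%:R * H%:R.
Proof.
move=> /forallP tH; rewrite /enorm -[leRHS]ger0_norm ?mulr_ge0 // -sqrtr_sqr.
rewrite ler_sqrt ?sqr_ge0 //.
apply: (@le_trans _ _ (\sum_(i < d) (H%:R : R) ^+ 2)).
  apply: ler_sum => i _; rewrite -[leLHS]real_normK ?num_real //.
  apply: lerXn2r; rewrite ?nnegrE ?ler0n //.
  by rewrite -intr_norm -natr_absz ler_nat ltnW.
rewrite sumr_const card_ord -[leLHS]mulr_natl exprMn ler_wpM2r ?sqr_ge0 //.
by rewrite expr2 -natrM ler_nat leq_pmulr.
Qed.

Lemma h_le_lg n : (h n <= lg n)%N.
Proof.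
apply: leq_trans (m_le_l d S n); rewrite card_M.
by rewrite -[leqLHS]expn1 leq_pexp2l ?h_gt0.
Qed.

(** Below h_{n+1} = 4^l h_n, with h_n <= l, one has |t| <= d l 4^l. So 2^(-l) is |t|^(-1/2) up to
    powers of l, and these are absorbed by the exponential gain from a > 0. For a >= 1/2 boundedness
    suffices. *)
Lemma r_bigO (a : R) : 0 < a -> bigO_power r (- 2^-1 + a).
Proof.
move=> a0; case: (lerP 2^-1 a) => ha.
  exists (C ^+ 2), 1 => t t1; apply: le_trans (r_le t) _.
  rewrite -[leLHS]mulr1 ler_wpM2l ?sqr_ge0 //.
  by rewrite -[leLHS](powRr0 (enorm R t)) ler_powR ?(ltW t1) //; lra.
have c0 : 0 < 2 * a * ln 2 :> R by rewrite !mulr_gt0 // ln_gt0 // ltr1n.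
have [K K0 HK] := pow_le_expR 3 c0.
exists (A * d%:R * K), (d%:R * (h (k1 + n0))%:R) => t tlt.
have nt : ~~ sup_le t (h (k1 + n0)).
  by apply/negP => /enorm_le; apply/negP; rewrite -ltNge.
have [k kk /andP[t1 t2]] := zone_exists nt.
have A0 : 0 <= A by rewrite /A mulr_ge0 ?sqr_ge0.
have := zone_le kk t1 t2; set l := lg (k + n0) => le.
have e0 : 0 < enorm R t by apply: le_lt_trans tlt; rewrite mulr_ge0.
rewrite (_ : - 2^-1 + a = - (2^-1 - a)); last by ring.
rewrite powRN ler_pdivlMr ?powR_gt0 //.
have b0 : 0 <= 2^-1 - a by lra.
have l0 : (0 < l)%N := lg_gt0 _.
have dl : 1 <= (d * l)%N%:R :> R by rewrite ler1n muln_gt0 d_gt0.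
have en : enorm R t `^ (2^-1 - a) <=
   (d * l)%N%:R * (2 ^+ l * expR (- (2 * a * ln 2 * l%:R))).
  apply: (@le_trans _ _ (((d * l)%N%:R * 2 ^+ (2 * l)) `^ (2^-1 - a))).
    apply: ge0_ler_powR => //; rewrite ?nnegrE ?(ltW e0) ?mulr_ge0 ?exprn_ge0 //.
    apply: le_trans (enorm_le t1) _.
    rewrite hS fastS -/l natrM natrX (_ : 4 = 2 ^+ 2 :> R); last by ring.
    rewrite -exprM natrM -mulrA [_ * (h _)%:R]mulrC ler_wpM2l // ler_wpM2r ?exprn_ge0 //.
    by rewrite ler_nat h_le_lg.
  rewrite powRM ?exprn_ge0 //; apply: ler_pM; rewrite ?powR_ge0 //.
    by rewrite -[leRHS](powRr1 (ler0n _ _)) ler_powR //; lra.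
  have -> : 2 ^+ l = (2 ^+ l) `^ 1 :> R by rewrite powRr1 // exprn_ge0.
  rewrite !powR_pow2 -expRD ler_expR natrM.
  by rewrite le_eqVlt; apply/orP; left; apply/eqP; field.
apply: le_trans (ler_pM (nc_ge0 _) (powR_ge0 _ _) le en) _.
have p0 : 0 < 2 ^+ l :> R by rewrite exprn_gt0.
have -> : A * (l%:R ^+ 2 / 2 ^+ l) * ((d * l)%:R * (2 ^+ l * expR (- (2 * a * ln 2 * l%:R)))) =
   A * d%:R * (l%:R ^+ 3 * expR (- (2 * a * ln 2 * l%:R))).
  by rewrite natrM; field; rewrite gt_eqF.
apply: ler_wpM2l; first by apply: mulr_ge0.
rewrite expRN ler_pdivrMr ?expR_gt0 //.
exact: HK.
Qed.

(** With X = 2^(l d), a zone has at most 2^d |M_n| X^2 far points of size 1/X and at most 2^d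
    |M_n|^2 near points of size 2^(-l), up to powers of l. For p > 2 both sums decay exponentially
    in l, hence geometrically in k. *)
Lemma r_in_Lp (p : R) : 2 < p -> exists B : R, forall s : seq 'rV[int]_d, uniq s ->
  \sum_(t <- s) nc (r t) `^ p <= B.
Proof.
move=> p2; have p0 : 0 < p by lra.
pose a := (Num.truncn (2 * p)).+1.
have pa : 2 * p <= a%:R by rewrite ltW // truncnS_gt.
have ln2 : 0 < ln 2 :> R by rewrite ln_gt0 // ltr1n.
have c0 : 0 < (p - 2) * ln 2 by rewrite mulr_gt0 // subr_gt0.
have [K K0 HK] := pow_le_expR (a + 3) c0.
have A0 : 0 <= A by rewrite /A mulr_ge0 ?sqr_ge0.
pose D := (2 ^ d)%N%:R * A `^ p * K.
have D0 : 0 <= D by rewrite /D !mulr_ge0 ?powR_ge0 // ltW.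
have zone k (s : seq 'rV[int]_d) : (k1 <= k)%N -> uniq s ->
    all (fun t => sup_le t (h (k + n0).+1)) s -> all (fun t => ~~ sup_le t (h (k + n0))) s ->
    \sum_(t <- s) nc (r t) `^ p <= 2 * D / 2 ^+ k.
  move=> kk us s1 s2; set n := (k + n0)%N in s1 s2; pose l := lg n.
  have l0 : (0 < l)%N := lg_gt0 _.
  have l1 : 1 <= l%:R :> R := lgR_ge1 _.
  have X0 : 0 < 2 ^+ (l * d) :> R by rewrite exprn_gt0.
  have Xl0 : 0 < 2 ^+ l :> R by rewrite exprn_gt0.
  (* Common end of both cases: j powers of l come from the number of points, a from the p-th power,
     and one more is spent to produce 2^(-k). *)
  have tail (j : nat) (x : R) : (j <= 2)%N -> 0 <= x -> x <= expR (- ((p - 2) * ln 2 * l%:R)) ->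
      (2 ^ d)%N%:R * (l%:R ^+ j) * (A `^ p * (l%:R ^+ a * x)) <= D / 2 ^+ k.
    move=> j2 x0 xle.
    have -> : (2 ^ d)%N%:R * (l%:R ^+ j) * (A `^ p * (l%:R ^+ a * x)) =
      ((2 ^ d)%N%:R * A `^ p) * (l%:R ^+ (j + a) * x) by rewrite exprD; ring.
    have -> : D / 2 ^+ k = ((2 ^ d)%N%:R * A `^ p) * (K / 2 ^+ k) by rewrite /D; ring.
    apply: ler_wpM2l.
      by rewrite mulr_ge0 ?powR_ge0.
    have kl : 2 ^+ k <= l%:R :> R by rewrite -natrX ler_nat lg_ge_pow2.
    have le1 : l%:R ^+ (j + a) * x <= K / l%:R.
      rewrite ler_pdivlMr ?ltr0n //.
      apply: (@le_trans _ _ (l%:R ^+ (a + 3) * expR (- ((p - 2) * ln 2 * l%:R)))).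
        rewrite mulrAC -exprSr; apply: ler_pM => //.
        by apply: ler_weXn2l => //; rewrite addnC -addnS leq_add2l.
      by rewrite expRN ler_pdivrMr ?expR_gt0 // HK.
    apply: le_trans le1 _; apply: ler_wpM2l; first exact: ltW.
    by rewrite lef_pV2 ?posrE ?exprn_gt0 ?ltr0n.
  have near_part (s' : seq 'rV[int]_d) : uniq s' -> all (fun t => sup_le t (h n.+1)) s' ->
      all (fun t => ~~ sup_le t (h n)) s' -> all (near S n) s' ->
      \sum_(t <- s') nc (r t) `^ p <= D / 2 ^+ k.
    move=> us' s1' s2' s3'.
    have ptw t : t \in s' -> nc (r t) `^ p <= A `^ p * (l%:R ^+ a * (2 ^+ l) `^ (- p)).
      move=> ts; have tz := zone_le kk (allP s1' _ ts) (allP s2' _ ts).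
      apply: le_trans (ge0_ler_powR (ltW p0) _ _ tz) _; rewrite ?nnegrE ?nc_ge0 //.
        by rewrite mulr_ge0 ?divr_ge0 ?exprn_ge0.
      exact: powR_ratio_le.
    apply: (@le_trans _ _ (\sum_(t <- s') A `^ p * (l%:R ^+ a * (2 ^+ l) `^ (- p)))).
      by rewrite !big_seq; apply: ler_sum.
    rewrite big_const_seq count_predT iter_addr_0 -[leLHS]mulr_natl.
    apply: (le_trans _ (tail 2%N ((2 ^+ l) `^ (- p)) _ _ _)) => //.
    - apply: ler_wpM2r; first by rewrite !mulr_ge0 ?powR_ge0 ?exprn_ge0.
      apply: (@le_trans _ _ ((2 ^ d * #|{: M n}| ^ 2)%N%:R)).
        by rewrite ler_nat; exact: size_near_le.
      rewrite natrM [X in _ * X <= _]natrX; apply: ler_wpM2l => //.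
      by apply: lerXn2r; rewrite ?nnegrE // ler_nat m_le_l.
    - rewrite powR_pow2 ler_expR -subr_ge0.
      have -> : - ((p - 2) * ln 2 * l%:R) - - p * ln 2 * l%:R = 2 * (ln 2 * l%:R) by ring.
      by apply: mulr_ge0 => //; apply: mulr_ge0 => //; exact: ltW.
  have far_part (s' : seq 'rV[int]_d) : uniq s' -> all (fun t => sup_le t (h n.+1)) s' ->
      all (fun t => ~~ near S n t) s' ->
      \sum_(t <- s') nc (r t) `^ p <= D / 2 ^+ k.
    move=> us' s1' s3'.
    have ptw t : t \in s' -> nc (r t) `^ p <= A `^ p * (l%:R ^+ a * (2 ^+ (l * d)) `^ (- p)).
      move=> ts; have tz := zone_far kk (allP s3' _ ts).
      have {}tz : nc (r t) <= A * (l%:R ^+ 2 / 2 ^+ (l * d)).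
        apply: le_trans tz _; rewrite /err /rel_err -/l.
        have -> : 2 * (2 * C ^+ 2 * (16 * l%:R ^+ 2 / 2 ^+ (l * d))) =
          64 * C ^+ 2 * (l%:R ^+ 2 / 2 ^+ (l * d)) by ring.
        apply: ler_wpM2r; first by rewrite divr_ge0 ?exprn_ge0.
        by rewrite /A ler_wpM2r ?sqr_ge0 // ler_nat.
      apply: le_trans (ge0_ler_powR (ltW p0) _ _ tz) _; rewrite ?nnegrE ?nc_ge0 //.
        by rewrite mulr_ge0 ?divr_ge0 ?exprn_ge0.
      exact: powR_ratio_le.
    apply: (@le_trans _ _ (\sum_(t <- s') A `^ p * (l%:R ^+ a * (2 ^+ (l * d)) `^ (- p)))).
      by rewrite !big_seq; apply: ler_sum.
    rewrite big_const_seq count_predT iter_addr_0 -[leLHS]mulr_natl.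
    apply: (@le_trans _ _ ((2 ^ d * #|{: M n.+1}|)%N%:R *
        (A `^ p * (l%:R ^+ a * (2 ^+ (l * d)) `^ (- p))))).
      apply: ler_wpM2r; first by rewrite !mulr_ge0 ?powR_ge0 ?exprn_ge0.
      by rewrite ler_nat; exact: size_zone_le.
    rewrite natrM (card_YX R d_gt0 fastS) -/l.
    apply: (le_trans _ (tail 1%N ((2 ^+ (l * d)) `^ (2 - p)) _ _ _)) => //.
    - have -> : (2 ^+ (l * d)) `^ (2 - p) = (2 ^+ (l * d)) ^+ 2 * (2 ^+ (l * d)) `^ (- p) :> R.
        rewrite powRD; last by rewrite (gt_eqF X0) implybT.
        by rewrite powR_mulrn // ltW.
      have ml : #|{: M n}|%:R <= l%:R :> R by rewrite ler_nat m_le_l.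
      set P := (2 ^+ (l * d)) `^ (- p); pose Z := (2 ^+ (l * d)) ^+ 2 * (A `^ p * (l%:R ^+ a * P)).
      have Z0 : 0 <= Z by rewrite /Z /P !mulr_ge0 ?powR_ge0 ?exprn_ge0.
      rewrite [leLHS](_ : _ = (2 ^ d)%N%:R * (#|{: M n}|%:R * Z)); last by rewrite /Z; ring.
      rewrite [leRHS](_ : _ = (2 ^ d)%N%:R * (l%:R * Z)); last by rewrite /Z; ring.
      by apply: ler_wpM2l => //; exact: ler_wpM2r.
    - rewrite powR_pow2 ler_expR natrM -subr_ge0.
      have -> : - ((p - 2) * ln 2 * l%:R) - (2 - p) * ln 2 * (l%:R * d%:R) =
        (p - 2) * ln 2 * (l%:R * (d%:R - 1)) by ring.
      by rewrite !mulr_ge0 ?(ltW ln2) ?subr_ge0 ?ler1n // ltW.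
  rewrite (bigID (near S n)) /= -big_filter -[X in _ + X]big_filter.
  rewrite -mulrA mulr_natl mulr2n; apply: lerD.
    apply: near_part; rewrite ?filter_uniq ?filter_all //.
      by apply: all_filterW s1.
    by apply: all_filterW s2.
  apply: far_part; rewrite ?filter_uniq ?filter_all //.
  by apply: all_filterW s1.
pose B0 := (2 ^ d * #|{: M (k1 + n0).+1}|)%N%:R * (C ^+ 2) `^ p.
have B00 : 0 <= B0 by rewrite /B0 mulr_ge0 ?powR_ge0.
have box j (s : seq 'rV[int]_d) : uniq s -> all (fun t => sup_le t (h (k1 + j + n0))) s ->
    \sum_(t <- s) nc (r t) `^ p <= B0 + 4 * D * (1 - 2^-1 ^+ j).
  elim: j s => [|j IHj] s us sj.
    rewrite expr0 subrr mulr0 addr0.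
    apply: (@le_trans _ _ (\sum_(t <- s) (C ^+ 2) `^ p)).
      by apply: ler_sum => t _; apply: ge0_ler_powR; rewrite ?nnegrE ?nc_ge0 ?sqr_ge0 // ltW.
    rewrite big_const_seq count_predT iter_addr_0 -[leLHS]mulr_natl ler_wpM2r ?powR_ge0 //.
    rewrite ler_nat; apply: size_zone_le => //.
    apply: sub_all sj => t; apply: sup_le_mono; rewrite addn0.
    exact: h_mono (leqnSn _).
  rewrite (bigID (fun t => sup_le t (h (k1 + j + n0)))) /= -big_filter -[X in _ + X]big_filter.
  have h1 := IHj _ (filter_uniq (fun t => sup_le t (h (k1 + j + n0))) us) (filter_all _ _).
  have h2 : \sum_(t <- [seq t <- s | ~~ sup_le t (h (k1 + j + n0))]) nc (r t) `^ p <=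
      2 * D / 2 ^+ (k1 + j).
    apply: zone; rewrite ?filter_uniq ?leq_addr //; last exact: filter_all.
    by apply: all_filterW; move: sj; rewrite addnS addSn.
  apply: le_trans (lerD h1 h2) _; rewrite exprSr.
  have : 2 * D / 2 ^+ (k1 + j) <= 2 * D * 2^-1 ^+ j.
    rewrite exprVn; apply: ler_wpM2l; first by rewrite mulr_ge0.
    by rewrite lef_pV2 ?posrE ?exprn_gt0 // ler_weXn2l ?ler1n // leq_addl.
  by move: (2 * D / _) (2^-1 ^+ j) => u v; nra.
exists (B0 + 4 * D) => s us.
have [j sj] : exists j, all (fun t => sup_le t (h (j + n0))) s.
  elim: s {us} => [|t s [j IHs]]; first by exists 0%N.
  have [k tk] := sup_le_exists t; exists (k + j)%N => /=; apply/andP; split.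
    by apply: sup_le_mono tk; apply: h_mono; rewrite leq_add2r leq_addr.
  apply: sub_all IHs => t'; apply: sup_le_mono; apply: h_mono.
  by rewrite leq_add2r leq_addl.
apply: (@le_trans _ _ (B0 + 4 * D * (1 - 2^-1 ^+ j))).
  apply: box => //; apply: sub_all sj => t'; apply: sup_le_mono; apply: h_mono.
  by rewrite -addnA leq_addl.
have : 0 <= 2^-1 ^+ j :> R by rewrite exprn_ge0.
by move: (2^-1 ^+ j) => u u0; nra.
Qed.

(** With l = [log4q] at the next level, |M_{n+1}| <= l while err^2 is at most a constant times l^4 /
    2^l, so the product tends to 0. *)
Lemma err_negligible : exists2 k2, (k1 <= k2)%N & forall k, (k2 <= k)%N ->
  9 * #|{: M (k + n0).+1}|%:R * err k.+1 ^+ 2 <= ((16 * d) ^ d)%N%:R^-1 * ms ^+ 2 / 32.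
Proof.
have c0 : 0 < ln 2 :> R by rewrite ln_gt0 // ltr1n.
have [K K0 HK] := pow_le_expR 6 c0.
set c := _ / 32; have cc : 0 < c.
  by rewrite /c !mulr_gt0 ?invr_gt0 ?exprn_gt0 // ltr0n expn_gt0 muln_gt0 d_gt0.
pose Q := 9 * (32 * C ^+ 2) ^+ 2 * K.
have Q0 : 0 <= Q by rewrite /Q !mulr_ge0 ?sqr_ge0 // ltW.
pose k3 := (Num.truncn (Q / c)).+1.
exists (maxn k1 k3) => [|k]; first exact: leq_maxl.
rewrite geq_max => /andP[_ k3k].
set l := lg (k.+1 + n0); have l0 : (0 < l)%N := lg_gt0 _.
have l1 : 1 <= l%:R :> R := lgR_ge1 _.
have p0 : 0 < 2 ^+ l :> R by rewrite exprn_gt0.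
have m_le : #|{: M (k + n0).+1}|%:R <= l%:R :> R by rewrite ler_nat m_le_l.
have e_le : err k.+1 <= 32 * C ^+ 2 * (l%:R ^+ 2 / 2 ^+ l).
  rewrite /err /rel_err -/l.
  have -> : 2 * C ^+ 2 * (16 * l%:R ^+ 2 / 2 ^+ (l * d)) =
     32 * C ^+ 2 * (l%:R ^+ 2 / 2 ^+ (l * d)) by ring.
  apply: ler_wpM2l; first by rewrite mulr_ge0 ?sqr_ge0.
  apply: ler_wpM2l; first exact: sqr_ge0.
  by rewrite lef_pV2 ?posrE ?exprn_gt0 // ler_eXn2l ?ltr1n // leq_pmulr.
have e2_le : err k.+1 ^+ 2 <= (32 * C ^+ 2) ^+ 2 * (l%:R ^+ 4 / 2 ^+ l).
  apply: le_trans (lerXn2r 2 _ _ e_le) _; rewrite ?nnegrE ?err_ge0 //.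
    by apply: (le_trans _ e_le); exact: err_ge0.
  rewrite exprMn; apply: ler_wpM2l; first exact: sqr_ge0.
  rewrite expr_div_n -[(l%:R ^+ 2) ^+ 2]exprM; apply: ler_wpM2l; first exact: exprn_ge0.
  rewrite lef_pV2 ?posrE ?exprn_gt0 //.
  by rewrite -exprM ler_weXn2l ?ler1n // leq_pmulr.
have hk := HK l l0.
apply: (@le_trans _ _ (Q / l%:R)).
  apply: (@le_trans _ _ (9 * l%:R * ((32 * C ^+ 2) ^+ 2 * (l%:R ^+ 4 / 2 ^+ l)))).
    by apply: ler_pM; rewrite ?sqr_ge0 ?mulr_ge0 // ler_wpM2l.
  rewrite /Q ler_pdivlMr ?ltr0n //.
  have -> : 9 * l%:R * ((32 * C ^+ 2) ^+ 2 * (l%:R ^+ 4 / 2 ^+ l)) * l%:R =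
    9 * (32 * C ^+ 2) ^+ 2 * (l%:R ^+ 6 / 2 ^+ l) by field; rewrite gt_eqF.
  apply: ler_wpM2l; first by rewrite mulr_ge0 ?sqr_ge0.
  rewrite ler_pdivrMr //; apply: le_trans hk _; apply: ler_wpM2l; first exact: ltW.
  have := powR_pow2 l (1 : R); rewrite powRr1 ?(ltW p0) // mul1r => ->.
  by [].
rewrite ler_pdivrMr ?ltr0n // mulrC -ler_pdivrMr //.
apply: le_trans (ltW (truncnS_gt _)) _; rewrite ler_nat.
by rewrite (leq_trans k3k) // ltnW // (leq_trans _ (lg_gt k.+1)).
Qed.

(** The test shifts of different levels lie in disjoint zones, so each level adds the same positive
    amount to a duplicate-free list. *)
Lemma r_not_L2 (B : R) : exists2 s : seq 'rV[int]_d, uniq s &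
  B <= \sum_(t <- s) nc (r t) ^+ 2.
Proof.
have [k2 k12 neg] := err_negligible.
set c := _ / 32 in neg; have cc : 0 < c.
  by rewrite /c !mulr_gt0 ?invr_gt0 ?exprn_gt0 // ltr0n expn_gt0 muln_gt0 d_gt0.
have c2 : ((16 * d) ^ d)%N%:R^-1 * ms ^+ 2 / 16 = 2 * c by rewrite /c; field; rewrite pnatr_eq0 -lt0n expn_gt0 muln_gt0 d_gt0.
suff build j : exists2 s : seq 'rV[int]_d, uniq s &
    all (fun t => sup_le t (h (k2 + j + n0))) s && (j%:R * c <= \sum_(t <- s) nc (r t) ^+ 2).
  have [s us /andP[_ le]] := build (Num.truncn (B / c)).+1.
  exists s => //; apply: le_trans le; rewrite -ler_pdivrMr //.
  exact: ltW (truncnS_gt _).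
elim: j => [|j [s us /andP[sj le]]]; first by exists [::] => //=; rewrite big_nil mul0r.
set n := (k2 + j + n0)%N in sj.
pose u := [seq @zvec d S n x | x <- enum (@test_set d S n)].
have zin x : test_set x -> sup_le (@zvec d S n x) (h n.+1).
  move=> _; apply/forallP => i; rewrite mxE absz_nat.
  exact: (@coord_lt _ _ n.+1).
have zout x : test_set x -> ~~ sup_le (@zvec d S n x) (h n).
  move=> /forallP/(_ (Ordinal d_gt0)) /andP[le1 _]; apply/negP => /forallP/(_ (Ordinal d_gt0)).
  by rewrite mxE absz_nat ltnNge le1.
have uu : uniq u.
  rewrite map_inj_uniq ?enum_uniq // => x y e.
  by rewrite -(projM_zvec x) e projM_zvec.
exists (s ++ u).
  rewrite cat_uniq us uu andbT; apply/hasPn => _ /mapP[x + ->].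
  rewrite mem_enum => tx; apply/negP => /(allP sj); apply/negP; exact: zout.
rewrite all_cat big_cat /=; apply/andP; split; [apply/andP; split|].
- by apply: sub_all sj => t; apply: sup_le_mono; apply: h_mono; rewrite addnS.
- apply/allP => _ /mapP[x + ->]; rewrite mem_enum addnS addSn => tx; exact: zin.
rewrite -natr1 mulrDl mul1r lerD // big_map big_enum /=.
have k2j : (k1 <= k2 + j)%N by rewrite (leq_trans k12) // leq_addr.
have := test_ge k2j; have := neg _ (leq_addr j k2); rewrite c2 => n1 n2.
by apply: le_trans n2; lra.
Qed.

End Asymptotics.

(** * The shift on the inverse limit *)

Import numFieldNormedType.Exports.
Local Open Scope classical_set_scope.
Local Open Scope ring_scope.

Section Shifts.
Variables (d : nat) (S : scales) (alpha : params d S).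
Local Notation M := (M d S).
Local Notation X := (X alpha).
Implicit Types (x y : X) (t : 'rV[int]_d).

Lemma coord_step x n : phi alpha (coord x n.+1) = coord x n.
Proof. exact: (proj2_sig x). Qed.

Lemma descend_coord n0 k x : descend alpha (n0 := n0) (coord x (k + n0)) = coord x n0.
Proof.
elim: k => [//|k IHk] /=; rewrite -[RHS]IHk.
by congr descend; exact: (coord_step x (k + n0)).
Qed.

Definition agree t x n : Prop :=
  gam (coord x n.+1) = gam (projM n.+1 t + coord x n.+1).

Lemma phi_shift t x n : agree t x n ->
  phi alpha (projM n.+1 t + coord x n.+1) = projM n t + coord x n.
Proof.
by move=> e; rewrite phiE -e piMD piM_projM -addrA -phiE coord_step.
Qed.

(** The translated coordinates are coherent from K on; the lower ones are recomputed from above by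
    phi. *)
Lemma shift_exists t x K : (forall n, (K <= n)%N -> agree t x n) ->
  exists y, is_shift t x y.
Proof.
move=> ag; pose z n : M n := projM n t + coord x n.
have [y yz yphi] : exists2 y : forall n, M n, (forall n, (K <= n)%N -> y n = z n) &
    forall n, phi alpha (y n.+1) = y n.
  (* Here j counts the levels below K that are already coherent. *)
  suff H j : exists2 y : forall n, M n, (forall n, (K <= n)%N -> y n = z n) &
      forall n, (K <= n + j)%N -> phi alpha (y n.+1) = y n.
    by have [y yz yphi] := H K; exists y => // n; apply: yphi; rewrite leq_addl.
  elim: j => [|j [y yz yphi]].
    by exists z => // n; rewrite addn0 => Kn; exact: phi_shift (ag _ Kn).
  exists (fun n => if (n + j.+1 == K)%N then phi alpha (y n.+1) else y n) => n Kn.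
    by rewrite ifN ?yz // neq_ltn (leq_ltn_trans Kn) ?orbT // -addSnnS leq_addr.
  have -> : (n.+1 + j.+1 == K)%N = false.
    by apply/negbTE; rewrite neq_ltn addSn ltnS Kn orbT.
  case: eqP => // nK; apply: yphi.
  by move: Kn nK; rewrite addnS leq_eqVlt => /predU1P[<-//|]; rewrite ltnS.
exists (exist _ y yphi); exists K; split=> n Kn; [exact: ag|exact: yz].
Qed.

(** As long as the blocks agree, descending commutes with translating, so the starting level does
    not matter. It can be raised to n1, beyond which y is the translate of x. *)
Lemma shift_coord t x y n0 k : is_shift t x y ->
  (forall n, (k + n0 <= n)%N -> agree t x n) ->
  coord y n0 = descend alpha (n0 := n0) (projM (k + n0) t + coord x (k + n0)).
Proof.
move=> [n1 [_ yx]] ag.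
have stable j : descend alpha (n0 := n0) (projM (k + n0) t + coord x (k + n0)) =
    descend alpha (n0 := n0) (projM (j + k + n0) t + coord x (j + k + n0)).
  elim: j => [//|j ->] /=; congr descend; apply/esym; apply: phi_shift.
  by apply: ag; rewrite leq_add2r leq_addl.
rewrite (stable n1) -yx ?descend_coord //.
by rewrite -addnA leq_addr.
Qed.

Lemma Tpow_shift t x K : (forall n, (K <= n)%N -> agree t x n) ->
  is_shift t x (Tpow t x).
Proof.
move=> /shift_exists[y xy]; rewrite /Tpow.
exact: (@xgetPex _ x [set y | is_shift t x y] (ex_intro _ y xy)).
Qed.

Lemma Tpow_undefined t x : ~ (exists K, forall n, (K <= n)%N -> agree t x n) ->
  Tpow t x = x.
Proof.
move=> nex; rewrite /Tpow; case: xgetP => // y _ [K [ag _]].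
by exfalso; apply: nex; exists K.
Qed.

End Shifts.

Lemma geometric_lim_sup (R : realType) (disp : measure_display) (T : measurableType disp)
    (mu : {measure set T -> \bar R}) (F : (set T)^nat) (c : R) :
  0 <= c -> (forall n, measurable (F n)) -> (forall n, (mu (F n) <= (c / 2 ^+ n)%:E)%E) ->
  mu (lim_sup_set F) = 0%E.
Proof.
move=> c0 mF Fc; apply: lim_sup_set_cvg0 => //.
(* The series is put in the form eps / 2^(i+1) expected by [epsilon_trick0]. *)
apply: (@le_lt_trans _ _ (\sum_(i <oo) ((2 * c) / (2 ^ i.+1)%:R)%:E)%E).
  apply: lee_nneseries => // n _; rewrite (_ : 2 * c / _ = c / 2 ^+ n) //.
  by rewrite natrX exprS; field; rewrite expf_neq0.
apply: le_lt_trans (epsilon_trick0 xpredT _) (ltry _).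
by rewrite mulr_ge0.
Qed.

(** * Integrals of cylindric functions and convergence of the correlations *)

Section CylinderMeasure.
Variables (R : realType) (d : nat) (S : scales) (alpha : params d S).
Local Notation M := (M d S).
Local Notation X := (X alpha).
Variable mu : probability X R.
Hypothesis mu_ice : is_iceberg_measure mu.

Lemma measurable_cylinder n (A : {set M n}) :
  measurable ([set x | coord x n \in A] : set X).
Proof. by apply: sub_sigma_algebra; exists n, A. Qed.

Lemma measurable_coord n (P : pred (M n)) : measurable ([set x | P (coord x n)] : set X).
Proof.
rewrite (_ : [set x | _] = [set x : X | coord x n \in [set a | P a]%SET]).
  exact: measurable_cylinder.
by apply/seteqP; split=> x /=; rewrite inE.
Qed.

Lemma mu_coord n (P : pred (M n)) :
  mu [set x | P (coord x n)] = (#|P|%:R / #|{: M n}|%:R)%:E.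
Proof.
rewrite (_ : [set x | _] = [set x : X | coord x n \in [set a | P a]%SET]).
  by rewrite mu_ice cardsE.
by apply/seteqP; split=> x /=; rewrite inE.
Qed.

Lemma measurable_fun_coord (d' : measure_display) (T : measurableType d') n (g : M n -> T) :
  measurable_fun setT (fun x : X => g (coord x n)).
Proof.
move=> _ B mB; rewrite setTI.
rewrite (_ : _ @^-1` _ = [set x : X | (fun a => `[< B (g a) >]) (coord x n)]).
  exact: (@measurable_coord n (fun a => `[< B (g a) >])).
by apply/seteqP; split=> x /= /asboolP.
Qed.

Lemma integrable_coord n (g : M n -> R) :
  mu.-integrable setT (fun x : X => (g (coord x n))%:E).
Proof.
have [C gC] : exists C : R, forall a, `|g a| <= C.
  exists (\sum_a `|g a|) => a; rewrite (bigD1 a) //= lerDl sumr_ge0 //.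
apply: (@le_integrable _ _ _ _ _ _ _ (fun=> C%:E)) => //.
- by apply/measurable_EFinP; exact: measurable_fun_coord.
- by move=> x _ /=; rewrite lee_fin (le_trans (gC _)) // ler_norm.
- exact: (finite_measure_integrable_cst mu C measurableT).
Qed.

Lemma integral_coord n (g : M n -> R) :
  (\int[mu]_x (g (coord x n))%:E = (avg g)%:E)%E.
Proof.
have gE (x : X) : (g (coord x n))%:E = (\sum_a (g a * (coord x n == a)%:R)%:E)%E.
  rewrite sumEFin (bigD1 (coord x n)) //= eqxx mulr1 big1 ?addr0 // => a ne.
  by rewrite eq_sym (negPf ne) mulr0.
under eq_integral do rewrite gE.
rewrite integral_sum //; last first.
  by move=> a; apply: (integrable_coord (fun c => g a * (c == a)%:R)).
rewrite /avg mulr_suml -sumEFin; apply: eq_bigr => a _.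
under eq_integral do rewrite EFinM.
rewrite integralZl //; last exact: (integrable_coord (fun c => (c == a)%:R)).
rewrite EFinM; congr (_ * _)%E.
rewrite (_ : (fun x : X => _) = (fun x : X => (\1_[set x : X | coord x n == a] x)%:E)).
  rewrite integral_indic ?setIT //; last exact: (measurable_coord (fun c => c == a)).
  by apply: etrans (mu_coord (pred1 a)) _; rewrite card1 mul1r.
by apply/funext => x; rewrite indicE mem_setE.
Qed.


Section ShiftDefect.
Variable t : 'rV[int]_d.

Definition defect n : set X := [set x | gam (projM n.+1 t + coord x n.+1) != gam (coord x n.+1)].

Lemma agreeP x n : agree t x n <-> ~ defect n x.
Proof.
rewrite /agree /defect /=; split => [->|/negP]; first by rewrite eqxx.
by rewrite negbK => /eqP ->.
Qed.

Lemma measurable_defect n : measurable (defect n).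
Proof.
exact: (@measurable_coord n.+1 (fun a => gam (projM n.+1 t + a) != gam a)).
Qed.

Lemma mu_defect n : (mu (defect n) <= ((\sum_i `|t 0%R i|%N)%N%:R / 2 ^+ n)%:E)%E.
Proof.
rewrite (@mu_coord n.+1 (fun a => gam (projM n.+1 t + a) != gam a)) lee_fin.
have h0 : 0 < (h S n)%:R :> R by rewrite ltr0n h_gt0.
apply: (@le_trans _ _ ((\sum_i `|t 0%R i|%N)%N%:R / (h S n)%:R)); last first.
  apply: ler_wpM2l => //; rewrite lef_pV2 ?posrE ?exprn_gt0 // -natrX ler_nat.
  exact: h_ge_pow2.
rewrite ler_pdivlMr // mulrAC ler_pdivrMr ?M_cardR_gt0 // -!natrM ler_nat.
rewrite [leqRHS]mulnC; apply: leq_trans (@leave_count d S n t).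
rewrite leq_mul2r; apply/orP; right; apply: subset_leq_card; apply/fintype.subsetP => y.
by rewrite !inE /stays addrC.
Qed.

Lemma defect_lim_sup : mu (lim_sup_set defect) = 0%E.
Proof.
exact: (geometric_lim_sup (ler0n R _) measurable_defect mu_defect).
Qed.


Let defined : set X := ~` lim_sup_set defect.

Let definedP x : defined x <-> exists K, forall n, (K <= n)%N -> agree t x n.
Proof.
split=> [nL|[K ag] /(_ K I)[n /= Kn]]; last exact/agreeP/ag.
apply: contrapT => nex; apply: nL => K _; apply: contrapT => nK; apply: nex; exists K => n Kn.
by apply/agreeP => dn; apply: nK; exists n.
Qed.

Let measurable_defined : measurable defined.
Proof.
apply: measurableC; apply: bigcap_measurable => // k _.
by apply: bigcup_measurable => j _; exact: measurable_defect.
Qed.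

Section JointLimit.
Variables (n0 : nat) (G : M n0 -> M n0 -> R).

Let level k (a : M (k + n0)) : R :=
  G (descend alpha (n0 := n0) (projM (k + n0) t + a)) (descend alpha (n0 := n0) a).

Let limit (x : X) : R := G (coord (Tpow t x) n0) (coord x n0).

Let level_cvg x : defined x -> level (coord x (k + n0)) @[k --> \oo] --> limit x.
Proof.
move=> /definedP[K ag]; apply: cvg_near_cst; exists K => // k /= Kk.
rewrite /level descend_coord /limit (@shift_coord _ _ _ t x (Tpow t x) n0 k) //.
  exact: Tpow_shift ag.
by move=> n kn; apply: ag; apply: leq_trans Kk (leq_trans (leq_addr _ _) kn).
Qed.

(** A pointwise limit of functions of single coordinates. Off [defined] the shift is the identity by
    convention, which dictates the value G a a there. *)
Lemma measurable_shift_coord : measurable_fun setT limit.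
Proof.
pose F k (x : X) : R :=
  if x \in defined then level (coord x (k + n0)) else G (coord x n0) (coord x n0).
apply: (@measurable_fun_cvg _ _ _ setT F) => [k|x _].
  apply: measurable_fun_ifT; [|exact: measurable_fun_coord|].
    apply: (measurable_fun_bool true); rewrite setTI.
    rewrite (_ : _ @^-1` _ = defined) //.
    by apply/seteqP; split=> x /=; [move/set_mem|exact: mem_set].
  exact: (@measurable_fun_coord _ _ n0 (fun a => G a a)).
rewrite /F; have [dx|ndx] := boolP (x \in defined).
  by apply: level_cvg; rewrite inE in dx.
rewrite notin_setE in ndx.
rewrite /limit Tpow_undefined; first exact: cvg_cst.
by move=> /definedP.
Qed.

Lemma joint_shift_cvg :
  avg (@level k) @[k --> \oo] --> \int[mu]_x limit x.
Proof.
pose C := \sum_a \sum_b `|G a b|.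
have GC a b : `|G a b| <= C.
  apply: (@le_trans _ _ (\sum_b `|G a b|)).
    by rewrite [leRHS](bigD1 b) //= lerDl sumr_ge0.
  by rewrite /C [leRHS](bigD1 a) //= lerDl sumr_ge0 // => i _; rewrite sumr_ge0.
have [|||||iF _ cF] := @dominated_convergence _ _ _ mu setT measurableT
   (fun k x => (level (coord x (k + n0)))%:E) (fun x => (limit x)%:E) (fun=> C%:E).
- by move=> k; apply/measurable_EFinP; exact: measurable_fun_coord.
- by apply/measurable_EFinP; exact: measurable_shift_coord.
- exists (~` defined); split; first exact: measurableC.
    by apply: etrans defect_lim_sup; rewrite /defined setCK.
  move=> x /= ncv dx; apply: ncv => _; apply: cvg_EFin; first exact: nearW.
  exact: level_cvg.
- exact: (finite_measure_integrable_cst mu C measurableT).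
- by apply: aeW => x k _; rewrite lee_fin GC.
have e : (fun k => (\int[mu]_x (level (coord x (k + n0)))%:E)%E) = (fun k => (avg (@level k))%:E).
  by apply/funext => k; rewrite integral_coord.
move: cF; rewrite e => cF; apply: (fine_cvg (f := fun k => (avg (@level k))%:E)).
by rewrite fineK //; exact: (integrable_fin_num measurableT iF).
Qed.

End JointLimit.

Lemma corr_cvg n0 (f : M n0 -> R[i]) (e : R) : 0 < e ->
  exists k2, forall k, (k2 <= k)%N ->
    nc (corr alpha f k t -
      inner mu (fun x => f (coord (Tpow t x) n0)) (fun x => f (coord x n0))) <= e.
Proof.
move=> e0; have e2 : 0 < e / 2 by rewrite divr_gt0.
pose GR (a b : M n0) := complex.Re (f a * conjc (f b)).
pose GI (a b : M n0) := complex.Im (f a * conjc (f b)).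
have /cvgrPdist_le/(_ _ e2)[k1 _ H1] := @joint_shift_cvg n0 GR.
have /cvgrPdist_le/(_ _ e2)[k2 _ H2] := @joint_shift_cvg n0 GI.
exists (maxn k1 k2) => k; rewrite geq_max => /andP[/H1 + /H2].
rewrite /= => {}H1 {}H2.
apply: le_trans (nc_le_ReIm _) _; rewrite [e in _ <= e]splitr.
rewrite !ReD !ImD !ReN !ImN.
have cE a : descend alpha (n0 := n0) (projM (k + n0) t + a) =
    descend alpha (n0 := n0) (a + projM (k + n0) t) by rewrite addrC.
apply: lerD; rewrite distrC.
  move: H1; rewrite (eq_avg (fun a => congr1 (fun b => GR b (descend alpha (n0 := n0) a)) (cE a))).
  by rewrite -Re_avg.
move: H2; rewrite (eq_avg (fun a => congr1 (fun b => GI b (descend alpha (n0 := n0) a)) (cE a))).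
by rewrite -Im_avg.
Qed.

End ShiftDefect.

End CylinderMeasure.

(** * Passing from t to -t, the Fourier transform being the correlation at -t *)

Section Reflection.
Variables (R : realType) (d : nat).
Implicit Types (a b : 'rV[int]_d -> R[i]) (t : 'rV[int]_d).

Lemma enormN t : enorm R (- t) = enorm R t.
Proof. by congr Num.sqrt; apply: eq_bigr => i _; rewrite mxE rmorphN sqrrN. Qed.

Lemma bigO_power_refl a b s : (forall t, b t = a (- t)) -> bigO_power a s -> bigO_power b s.
Proof.
move=> ba [C [r aO]]; exists C, r => t rt; rewrite ba -enormN.
by apply: aO; rewrite enormN.
Qed.

Lemma in_Lp_bounded a b p B : (forall t, b t = a (- t)) ->
  (forall s, uniq s -> \sum_(t <- s) nc (a t) `^ p <= B) -> in_Lp p b.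
Proof.
move=> ba aB; rewrite /in_Lp /esum.
apply: le_lt_trans (ltry B); apply: ge_ereal_sup => _ [A [fA _] <-].
rewrite fsbig_finite //= sumEFin lee_fin.
under eq_bigr do rewrite ba.
rewrite -(big_map -%R xpredT (fun t => nc (a t) `^ p)); apply: aB.
by rewrite map_inj_uniq ?finmap.fset_uniq //; exact: oppr_inj.
Qed.

Lemma not_in_L2 a b : (forall t, b t = a (- t)) ->
  (forall B, exists2 s, uniq s & B <= \sum_(t <- s) nc (a t) ^+ 2) -> ~ in_Lp 2 b.
Proof.
move=> ba aB; rewrite /in_Lp; set E := (X in (X < _)%E) => Efin.
have E0 : (0 <= E)%E by apply: esum_ge0 => t _; rewrite lee_fin powR_ge0.
have [s us] := aB (fine E + 1).
apply/negP; rewrite -ltNge; apply: (@le_lt_trans _ _ (fine E)); last by rewrite ltrDl.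
rewrite -lee_fin fineK; last by rewrite ge0_fin_numE.
apply: esum_ge; exists [set` [seq - t | t <- s]]; first by split => //; exact: finite_seq.
rewrite -fsbig_seq; last by rewrite map_inj_uniq //; exact: oppr_inj.
rewrite sumEFin lee_fin big_map; rewrite (eq_bigr (fun t => nc (b (- t)) `^ 2)) // => t _.
by rewrite ba opprK -powR_mulrn ?nc_ge0.
Qed.

End Reflection.

Lemma spectral_asymptotics (R : realType) (d : nat) (S : scales) (alpha : params d S)
    (mu : probability (X alpha) R) (n0 : nat) (f : M d S n0 -> R[i]) (C : R) (k1 : nat)
    (sigma : {finite_measure set (torus R d) -> \bar R}) :
  (0 < d)%N -> fast d S -> is_iceberg_measure mu ->
  0 < C -> (forall a, nc (f a) <= C) -> 0 < mean_sqr f ->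
  (forall k, (k1 <= k)%N -> good alpha f C k) ->
  is_spectral_measure mu (fun x => f (coord x n0)) sigma ->
  [/\ forall eps : R, 0 < eps -> bigO_power (fourier sigma) (- 2^-1 + eps),
      ~ in_Lp 2 (fourier sigma) &
      forall p : R, 2 < p -> in_Lp p (fourier sigma)].
Proof.
move=> d0 fastS ice C0 fC ms0 gd spec.
pose r (t : 'rV[int]_d) := inner mu (fun x : X alpha => f (coord (Tpow t x) n0)) (fun x => f (coord x n0)).
have rE t : fourier sigma t = r (- t) by rewrite spec.
have lim := fun t e => @corr_cvg _ _ _ _ _ ice t n0 f e.
have rle := r_le fC lim.
have far := fun k t => @zone_far _ _ _ _ _ _ _ C0 d0 fastS r k1 gd lim k t.
have nr := fun k t => @zone_near _ _ _ _ _ _ _ C0 fC d0 fastS r k1 gd lim k t.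
have tst := fun k => @test_energy_ge _ _ _ _ _ _ _ C0 d0 fastS r k1 gd lim k.
split=> [e e0||p p2].
- exact: (bigO_power_refl rE (r_bigO d0 fastS rle far nr e0)).
- exact: (not_in_L2 rE (r_not_L2 C0 ms0 d0 tst)).
have [B rB] := r_in_Lp C0 ms0 d0 fastS rle far nr p2.
exact: in_Lp_bounded rE rB.
Qed.

(** * Almost sure behaviour of the parameters *)

Section RandomParams.
Variables (R : realType) (d : nat) (S : scales).
Local Notation M := (M d S).
Local Notation Gq := (Gamma_quo d S).
Variables (disp : measure_display) (Omega : measurableType disp) (P : probability Omega R).
Variable alpha : forall n : nat, Gq n -> Omega -> M n.
Hypothesis alpha_meas : measurable_params alpha.
Hypothesis alpha_indep : independent_params P alpha.
Hypothesis alpha_unif : uniform_params P alpha.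

Let params_at w : params d S := fun n g => alpha g w.

Lemma measurable_level n (E : pred {ffun Gq n -> M n}) :
  measurable [set w | E (level_params (params_at w) n)].
Proof.
rewrite (_ : [set w | _] = \bigcup_(v in [set v | E v])
    \bigcap_(g in [set: Gq n]) [set w | alpha g w = v g]).
  apply: fin_bigcup_measurable => [|v _]; first exact: finite_finset.
  apply: fin_bigcap_measurable => [|g _]; first exact: finite_finset.
  exact: alpha_meas.
apply/seteqP; split=> w /=.
  by move=> Ew; exists (level_params (params_at w) n) => // g _; rewrite /= ffunE.
move=> [v Ev vw]; rewrite (_ : level_params _ _ = v) //.
by apply/ffunP => g; rewrite ffunE; exact: vw.
Qed.

Lemma prob_level_point n (v : {ffun Gq n -> M n}) :
  P [set w | level_params (params_at w) n = v] = (#|{: {ffun Gq n -> M n}}|%:R^-1)%:E.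
Proof.
pose J := [seq existT (fun n => Gq n) n g | g <- enum {: Gq n}].
(* A dependent family equal to {v g} at (n, g); at indices of other levels the condition is vacuous
   and the set is everything. *)
pose A (j : {n : nat & Gq n}) : {set M (tag j)} :=
  [set a | `[< forall g, j = existT _ n g -> existT (fun n => M n) (tag j) a = existT _ n (v g) >]]%SET.
have AE g a : (a \in A (existT _ n g)) = (a == v g).
  rewrite inE; apply/asboolP/eqP => [/(_ g erefl)/eqP|-> g' /eqP].
    by rewrite (@eq_Tagged _ (fun n => M n : eqType)) /= => /eqP.
  by rewrite (@eq_Tagged _ (fun n => Gq n : eqType)) /= => /eqP <-.
have uJ : uniq J.
  rewrite map_inj_uniq ?enum_uniq // => g g' /eqP.
  by rewrite (@eq_Tagged _ (fun n => Gq n : eqType)) /= => /eqP.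
have := alpha_indep A uJ.
rewrite (_ : \bigcap_(j in _) _ = [set w | level_params (params_at w) n = v]); last first.
  apply/seteqP; split=> w /=.
    move=> H; apply/ffunP => g; rewrite ffunE.
    have /H /= : [set` J] (existT _ n g) by apply: map_f; rewrite mem_enum.
    by rewrite AE => /eqP.
  move=> e j /mapP[g _ ->] /=; rewrite AE -e ffunE; exact/eqP.
move=> ->; rewrite big_map.
under eq_bigr => g _.
  rewrite (_ : [set w | _] = [set w | alpha g w = v g]); last first.
    by apply/seteqP; split=> w /=; rewrite AE => /eqP.
  rewrite alpha_unif; over.
rewrite prodEFin big_enum /= prodr_const exprVn card_ffun natrX.
by congr (_ ^- _)%:E; rewrite cardT.
Qed.

Lemma prob_level n (E : pred {ffun Gq n -> M n}) :
  P [set w | E (level_params (params_at w) n)] = (pr E)%:E.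
Proof.
rewrite (_ : [set w | _] = \bigcup_(v in [set v | E v])
    [set w | level_params (params_at w) n = v]); last first.
  apply/seteqP; split=> w /=; first by move=> Ew; exists (level_params (params_at w) n).
  by move=> [v Ev ->].
rewrite measure_fin_bigcup; first last.
- move=> v _; rewrite (_ : [set w | _] = [set w | pred1 v (level_params (params_at w) n)]).
    exact: measurable_level.
  by apply/seteqP; split=> w /=; [move=> ->; exact: eqxx|move/eqP].
- by move=> v v' _ _ [w [/= -> ->]].
- exact: finite_finset.
rewrite (fsbigE [seq v <- enum {: {ffun Gq n -> M n}} | E v]
  _ (filter_uniq E (enum_uniq _))); first last.
- by move=> v Ev; rewrite mem_filter Ev mem_enum.
- by move=> v; rewrite /= mem_filter => /andP[].
rewrite (eq_bigr (fun=> (#|{: {ffun Gq n -> M n}}|%:R^-1)%:E)); last first.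
  by move=> v _; exact: prob_level_point.
rewrite sumEFin /pr /avg mulr_suml big_filter_cond big_enum_cond /= big_mkcond /=; congr (_%:E).
apply: eq_bigr => v _; rewrite mem_setE andbb.
by case: (E v); rewrite ?mul1r ?mul0r.
Qed.

End RandomParams.

Lemma leq_expnW m n e : (m <= n)%N -> (m ^ e <= n ^ e)%N.
Proof. by case: e => // e; rewrite leq_exp2r. Qed.

Lemma h_le_addl (S : scales) n0 k : (h S n0 <= h S (k + n0))%N.
Proof.
by elim: k => // k IHk; have := @h2_leS S (k + n0); rewrite -addSn; lia.
Qed.

(** With s = [size_exp] the three factors are at most 2^(s^2), 2^(8 s) and 2^s, and s^2 + 9 s <=
    2^s. *)
Lemma descents_count d (S : scales) n0 k :
  (#|{: M d S n0}| ^ #|{: M d S (k + n0)}| * log4q d S (k + n0) ^ 8 * 2 ^ k <=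
   2 ^ log4q d S (k + n0))%N.
Proof.
set s := size_exp d S (k + n0).
have ms : (#|{: M d S (k + n0)}| <= s)%N by rewrite card_M /s /size_exp -!addnA leq_addr.
have m0s : (#|{: M d S n0}| <= 2 ^ s)%N.
  apply: leq_trans (ltnW (ltn_expl s (leqnn 2))); apply: leq_trans ms.
  by rewrite !card_M leq_expnW // h_le_addl.
have ks : (k <= s)%N by rewrite /s /size_exp; lia.
apply: (@leq_trans (2 ^ (s * s) * 2 ^ (s * 8) * 2 ^ s)).
  rewrite log4qE -/s -expnM leq_mul ?leq_pexp2l // leq_mul2r; apply/orP; right.
  apply: (@leq_trans ((2 ^ s) ^ #|{: M d S (k + n0)}|)); first exact: leq_expnW.
  by rewrite expnM leq_pexp2l // expn_gt0.
rewrite -!expnD leq_pexp2l // log4qE -/s.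
by apply: leq_trans (pow2_ge_quad (s_ge40 d S (k + n0))); rewrite -/s; lia.
Qed.

Section BadEvents.
Variables (R : realType) (d : nat) (S : scales).
Local Notation M := (M d S).
Hypotheses (d_gt0 : (0 < d)%N) (fastS : fast d S).
Variables (n0 : nat) (f : M n0 -> R[i]) (C : R).
Hypotheses (C_gt0 : 0 < C) (f_le : forall a, nc (f a) <= C) (f_ms : 0 < mean_sqr f).

(* The bad event is taken over all maps M_{k+n0} -> M_n0 instead of the random
   composition of the phi_n: it then depends only on the parameters of one level. *)
Definition bad_descent k (Phi : {ffun M (k + n0) -> M n0})
    (w : {ffun Gamma_quo d S (k + n0) -> M (k + n0)}) : bool :=
  [&& \sum_a f (Phi a) == 0, mean_sqr (fun a => f (Phi a)) == mean_sqr f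
    & bad_level C (fun a => f (Phi a)) w].

Definition bad_some_descent k (w : {ffun Gamma_quo d S (k + n0) -> M (k + n0)}) : bool :=
  [exists Phi, bad_descent Phi w].

Let A : R := 16 + 4 * (512 * 512) * C ^+ 8 / (((16 * d) ^ d)%:R^-1 ^+ 2 * mean_sqr f ^+ 4).

Let A_ge0 : 0 <= A.
Proof.
apply: addr_ge0; first exact: ler0n.
apply: divr_ge0; last by apply: mulr_ge0; apply: exprn_ge0; rewrite ?invr_ge0 ?ler0n ?ltW.
apply: mulr_ge0; last by rewrite exprn_ge0 // ltW.
by apply: mulr_ge0; [|apply: mulr_ge0]; exact: ler0n.
Qed.

Lemma pr_bad_descent k (Phi : {ffun M (k + n0) -> M n0}) :
  pr (bad_descent Phi) <= A * ((log4q d S (k + n0))%:R ^+ 8 / 2 ^+ log4q d S (k + n0)).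
Proof.
have [/andP[/eqP f0 /eqP fm]|bad] :=
  boolP ((\sum_a f (Phi a) == 0) && (mean_sqr (fun a => f (Phi a)) == mean_sqr f)).
  have ms0 : 0 < mean_sqr (fun a => f (Phi a)) by rewrite fm.
  have := pr_bad_level d_gt0 fastS C_gt0 (fun a => f_le (Phi a)) f0 ms0.
  rewrite fm -/A; apply: le_trans; apply: prS => w.
  by move=> /and3P[].
have -> : pr (bad_descent Phi) = 0 :> R.
  rewrite /pr /avg big1 ?mul0r // => w _.
  by rewrite /bad_descent andbA (negPf bad).
by rewrite mulr_ge0 ?A_ge0 // divr_ge0 // exprn_ge0 ?ler0n.
Qed.

Lemma pr_bad_some_descent k : pr (@bad_some_descent k) <= A / 2 ^+ k.
Proof.
apply: le_trans (pr_exists _) _.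
apply: (@le_trans _ _ (\sum_(Phi : {ffun M (k + n0) -> M n0})
   A * ((log4q d S (k + n0))%:R ^+ 8 / 2 ^+ log4q d S (k + n0)))).
  by apply: ler_sum => Phi _; exact: pr_bad_descent.
rewrite sumr_const card_ffun -[leLHS]mulr_natr -!mulrA; apply: ler_wpM2l; first exact: A_ge0.
have := descents_count d S n0 k; move: (log4q _ _ _) (_ ^ #|_|)%N => l c.
rewrite -(ler_nat R) !natrM !natrX => le.
rewrite -[leRHS]div1r ler_pdivlMr ?exprn_gt0 //.
rewrite (_ : _ * _ = c%:R * l%:R ^+ 8 * 2 ^+ k / 2 ^+ l); last by ring.
by rewrite ler_pdivrMr ?exprn_gt0 // mul1r.
Qed.

Variables (disp : measure_display) (Omega : measurableType disp) (P : probability Omega R).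
Variable alpha : forall n : nat, Gamma_quo d S n -> Omega -> M n.
Hypothesis alpha_meas : measurable_params alpha.
Hypothesis alpha_indep : independent_params P alpha.
Hypothesis alpha_unif : uniform_params P alpha.
Hypothesis f_mean0 : \sum_a f a = 0.

Lemma ae_good : {ae P, forall w,
  exists k1, forall k, (k1 <= k)%N -> good (fun n g => @alpha n g w) f C k}.
Proof.
pose F k := [set w | @bad_some_descent k (level_params (fun n g => @alpha n g w) (k + n0))].
have mF k : measurable (F k) by exact: measurable_level.
exists (lim_sup_set F); split.
- by apply: bigcap_measurable => // k _; apply: bigcup_measurable => j _; exact: mF.
- apply: (geometric_lim_sup A_ge0 mF) => k.
  apply: (@le_trans _ _ (pr (@bad_some_descent k))%:E); last first.
    by rewrite lee_fin; exact: pr_bad_some_descent.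
  rewrite le_eqVlt; apply/orP; left; apply/eqP; exact: (prob_level alpha_meas alpha_indep alpha_unif (@bad_some_descent k)).
move=> w /= nex K _; apply: contrapT => nK; apply: nex; exists K => k Kk.
apply/negP => bad; apply: nK; exists k => //; apply/existsP.
(* The actual composition of the phi is one of the maps in the union, and it has the two properties
   required in [bad_descent]. *)
exists [ffun a => descend (fun n g => @alpha n g w) (n0 := n0) a].
have e : (fun a => f ([ffun a => descend (fun n g => @alpha n g w) (n0 := n0) a] a)) =
  lifted (fun n g => @alpha n g w) f (k := k).
  by apply/funext => a; rewrite ffunE.
apply/and3P; rewrite e; split=> //.
  by apply/eqP; have := sum_lifted (fun n g => @alpha n g w) k f_mean0; rewrite -e.
by apply/eqP; exact: mean_sqr_lifted.
Qed.

End BadEvents.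

(** * Density of rational cylindric functions *)

Import HBNNSimple.

(** * Mean-square density of a space containing the indicators of a pi-system *)

Section MeanSquare.
Variables (R : realType) (disp : measure_display) (E : measurableType disp).
Variable mu : probability E R.
Implicit Types (u v w : E -> R) (a b c e : R).

Definition msq u : \bar R := (\int[mu]_x ((u x) ^+ 2)%:E)%E.

Lemma measurable_sqr u : measurable_fun setT u -> measurable_fun setT (fun x => ((u x) ^+ 2)%:E).
Proof. by move=> mu_; apply/measurable_EFinP; exact: measurable_funX. Qed.

Lemma msq_ge0 u : (0 <= msq u)%E.
Proof. by apply: integral_ge0 => x _; rewrite lee_fin sqr_ge0. Qed.

Lemma msq_le u v : measurable_fun setT u -> measurable_fun setT v ->
  (forall x, `|u x| <= `|v x|) -> (msq u <= msq v)%E.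
Proof.
move=> mu_ mv uv; apply: ge0_le_integral => //.
- by move=> x _; rewrite lee_fin sqr_ge0.
- exact: (measurable_sqr mu_).
- exact: (measurable_sqr mv).
by move=> x _; rewrite lee_fin -[leLHS]real_normK ?num_real // -[leRHS]real_normK ?num_real //
  lerXn2r ?nnegrE.
Qed.

Lemma msqZ c u : measurable_fun setT u -> msq (fun x => c * u x) = ((c ^+ 2)%:E * msq u)%E.
Proof.
move=> mu_; rewrite /msq -ge0_integralZl_EFin ?sqr_ge0 //.
- by apply: eq_integral => x _; rewrite -EFinM exprMn.
- by move=> x _; rewrite lee_fin sqr_ge0.
exact: (measurable_sqr mu_).
Qed.

Lemma msqD_le u v a b : measurable_fun setT u -> measurable_fun setT v ->
  (msq u <= a%:E)%E -> (msq v <= b%:E)%E -> (msq (fun x => (u x + v x)%R) <= (2 * (a + b))%R%:E)%E.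
Proof.
move=> mu_ mv ua vb; pose s2 w x : R := 2 * w x ^+ 2.
have ge2 w : forall x : E, setT x -> (0 <= (s2 w x)%:E)%E.
  by move=> x _; rewrite lee_fin mulr_ge0 ?sqr_ge0.
have m2 w : measurable_fun setT w -> measurable_fun setT (fun x => (s2 w x)%:E).
  by move=> mw; apply/measurable_EFinP; apply: measurable_funM => //; exact: measurable_funX.
have i2 w : measurable_fun setT w -> (\int[mu]_x (s2 w x)%:E = 2%:E * msq w)%E.
  move=> mw; rewrite /msq -ge0_integralZl_EFin //; first by move=> x _; rewrite lee_fin sqr_ge0.
  exact: measurable_sqr.
apply: (@le_trans _ _ (\int[mu]_x ((s2 u x)%:E + (s2 v x)%:E))%E).
  apply: ge0_le_integral => //.
  - by move=> x _; rewrite lee_fin sqr_ge0.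
  - by apply: measurable_sqr; exact: measurable_funD.
  - by apply: emeasurable_funD; exact: m2.
  - move=> x _; rewrite -EFinD lee_fin -subr_ge0 /s2.
    rewrite (_ : _ - _ = (u x - v x) ^+ 2) ?sqr_ge0 //; ring.
rewrite (ge0_integralD mu measurableT (ge2 u) (m2 _ mu_) (ge2 v) (m2 _ mv)).
rewrite !i2 // (_ : (2 * (a + b))%:E = 2%:E * a%:E + 2%:E * b%:E)%E.
  by apply: leeD; apply: lee_wpmul2l.
by rewrite -!EFinM -EFinD mulrDr.
Qed.

Lemma msq_bounded u c : measurable_fun setT u -> (forall x, `|u x| <= c) -> (msq u <= (c ^+ 2)%R%:E)%E.
Proof.
move=> mu_ uc; have c0 : 0 <= c by apply: le_trans (uc point); exact: normr_ge0.
apply: le_trans (msq_le mu_ (measurable_cst c) _) _.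
  by move=> x; rewrite (ger0_norm c0).
have -> : msq (fun=> c) = (\int[mu]_x cst (c ^+ 2)%:E x)%E by [].
rewrite integral_cst // -[leRHS]mule1; apply: lee_wpmul2l.
  by rewrite lee_fin sqr_ge0.
exact: (@probability_le1 _ _ _ mu).
Qed.

Lemma msq_cvg0 (u_ : nat -> E -> R) (g : E -> R) e :
  (forall n, measurable_fun setT (u_ n)) -> measurable_fun setT g -> (msq g < +oo)%E ->
  (forall n x, `|u_ n x| <= `|g x|) -> (forall x, u_ n x @[n --> \oo] --> 0) ->
  0 < e -> exists n, (msq (u_ n) <= e%:E)%E.
Proof.
move=> mu_ mg gfin ug u0 e0.
have [|||||_ _ cv] := @dominated_convergence _ _ _ mu setT measurableT
    (fun n x => (u_ n x ^+ 2)%:E) (cst 0%E) (fun x => (g x ^+ 2)%:E).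
- by move=> n; exact: measurable_sqr.
- exact: measurable_cst.
- apply: aeW => x _ /=; apply: cvg_EFin; first exact: nearW.
  rewrite (_ : 0 = 0 ^+ 2); last by rewrite expr0n.
  by rewrite /= ; under eq_fun do rewrite /= expr2; rewrite expr2; apply: cvgM; exact: u0.
- apply/integrableP; split; first exact: measurable_sqr.
  by under eq_integral do rewrite gee0_abs ?lee_fin ?sqr_ge0 //.
- apply: aeW => x n _; rewrite gee0_abs ?lee_fin ?sqr_ge0 //.
  by rewrite -[leLHS]real_normK ?num_real // -[leRHS]real_normK ?num_real // lerXn2r ?nnegrE.
move: cv; rewrite integral0 => cv.
move/fine_cvgP : cv => [fin /cvgrPdist_le /(_ e e0) close].
have [n _ H] := filterI fin close; exists n; have [fn] := H n (leqnn n).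
rewrite /= sub0r normrN => le; have -> : msq (u_ n) = (fine (msq (u_ n)))%:E.
  by rewrite fineK.
by rewrite lee_fin (le_trans (ler_norm _)).
Qed.


Section GeneratingClass.
Variables (G : set (set E)) (V : set (E -> R)).
Hypothesis genE : @measurable _ E = <<s G >>.
Hypothesis G_setI : setI_closed G.
Hypothesis V_meas : forall v, V v -> measurable_fun setT v.
Hypothesis V_cst1 : V (cst 1).
Hypothesis V_indic : forall A, G A -> V \1_A.
Hypothesis V_add : forall u v, V u -> V v -> V (fun x => u x + v x).
Hypothesis V_scale : forall c v, V v -> V (fun x => c * v x).

Definition ms_limit u := forall e, 0 < e ->
  exists2 v, V v & (msq (fun x => (u x - v x)%R) <= e%:E)%E.

Lemma ms_limit_closed u : measurable_fun setT u ->
  (forall e, 0 < e -> exists w, [/\ measurable_fun setT w, ms_limit w &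
     (msq (fun x => (u x - w x)%R) <= e%:E)%E]) -> ms_limit u.
Proof.
move=> mu_ lim e e0; have e4 : 0 < e / 4 by rewrite divr_gt0.
have [w [mw /(_ _ e4)[v Vv wv] uw]] := lim _ e4; exists v => //.
have mv := V_meas Vv.
rewrite (_ : (fun x => _) = (fun x => (u x - w x) + (w x - v x))); last first.
  by apply/funext => x; rewrite addrA subrK.
rewrite (_ : e = 2 * (e / 4 + e / 4)); last by field.
by apply: msqD_le => //; exact: measurable_funB.
Qed.

Lemma ms_limitV v : V v -> ms_limit v.
Proof.
move=> Vv e e0; exists v => //; apply: le_trans (msq_bounded (c := 0) _ _) _.
- by apply: measurable_funB; exact: V_meas.
- by move=> x; rewrite subrr normr0.
by rewrite expr0n /= lee_fin ltW.
Qed.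

Lemma ms_limitD u v : measurable_fun setT u -> measurable_fun setT v ->
  ms_limit u -> ms_limit v -> ms_limit (fun x => u x + v x).
Proof.
move=> mu_ mv lu lv e e0; have e4 : 0 < e / 4 by rewrite divr_gt0.
have [u' Vu uu'] := lu _ e4; have [v' Vv vv'] := lv _ e4.
exists (fun x => u' x + v' x); first exact: V_add.
rewrite (_ : (fun x => _) = (fun x => (u x - u' x) + (v x - v' x))); last first.
  by apply/funext => x; rewrite opprD addrACA.
rewrite (_ : e = 2 * (e / 4 + e / 4)); last by field.
by apply: msqD_le => //; apply: measurable_funB => //; exact: V_meas.
Qed.

Lemma ms_limitZ c u : measurable_fun setT u -> ms_limit u -> ms_limit (fun x => c * u x).
Proof.
move=> mu_ lu e e0; have e1 : 0 < e / (c ^+ 2 + 1) by rewrite divr_gt0 // ltr_wpDl ?sqr_ge0.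
have [v Vv uv] := lu _ e1; exists (fun x => c * v x); first exact: V_scale.
rewrite (_ : (fun x => _) = (fun x => c * (u x - v x))); last first.
  by apply/funext => x; rewrite mulrBr.
rewrite msqZ; last by apply: measurable_funB => //; exact: V_meas.
apply: (@le_trans _ _ ((c ^+ 2)%:E * (e / (c ^+ 2 + 1))%:E)%E).
  by apply: lee_wpmul2l => //; rewrite lee_fin sqr_ge0.
rewrite -EFinM lee_fin mulrCA ler_piMr ?(ltW e0) //.
by rewrite ler_pdivrMr ?mul1r ?lerDl // ltr_wpDl ?sqr_ge0.
Qed.

Lemma ms_limitB u v : measurable_fun setT u -> measurable_fun setT v ->
  ms_limit u -> ms_limit v -> ms_limit (fun x => u x - v x).
Proof.
move=> mu_ mv lu lv.
rewrite (_ : (fun x => _) = (fun x => u x + -1 * v x)); last first.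
  by apply/funext => x; rewrite mulN1r.
by apply: ms_limitD => //; [apply: measurable_funM|apply: ms_limitZ].
Qed.

(** Dynkin's argument: the sets whose indicator is a mean-square limit form a lambda-system
    containing the pi-system G. Increasing unions are handled by dominated convergence. *)
Lemma ms_limit_indic A : measurable A -> ms_limit \1_A.
Proof.
pose H := [set A : set E | measurable A /\ ms_limit \1_A].
suff HG : <<s G >> `<=` H by rewrite genE => /HG[].
clear A.
apply: lambda_system_subset => //.
- split=> //.
  + by split => //; rewrite indicT; exact: ms_limitV.
  + move=> A B BA [mA lA] [mB lB]; split; first exact: measurableD.
    rewrite (_ : \1__ = (fun x => \1_A x - \1_B x) :> (E -> R)); last first.
      apply/funext => x; rewrite !indicE in_setD.
      have [xB|] := boolP (x \in B); last by rewrite subr0 andbT.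
      by rewrite (mem_set (BA _ (set_mem xB))) subrr.
    by apply: ms_limitB => //; exact: measurable_indic.
  + move=> F ndF HF; have mF n : measurable (F n) by have [] := HF n.
    have mU : measurable (\bigcup_n F n) by exact: bigcup_measurable.
    split => //; apply: ms_limit_closed; first exact: measurable_indic.
    move=> e e0.
    have [|||||n Hn] := @msq_cvg0 (fun n x => \1_(\bigcup_n F n) x - \1_(F n) x) (cst 1) e _ _ _ _ _ e0.
    * by move=> n; apply: measurable_funB; exact: measurable_indic.
    * exact: measurable_cst.
    * apply: le_lt_trans (msq_bounded (c := 1) _ _) (ltry _); first exact: measurable_cst.
      by move=> x; rewrite normr1.
    * move=> n x; rewrite normr1 !indicE.
      by case: (_ \in _); case: (_ \in _); rewrite ?subrr ?subr0 ?sub0r ?normrN ?normr1 ?normr0.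
    * move=> x; apply: cvg_near_cst.
      have [xU|xU] := boolP (x \in \bigcup_n F n).
        have /set_mem[m _ Fmx] := xU; exists m => // n /= mn.
        rewrite !indicE xU mem_set ?subrr //.
        by have := ndF _ _ mn; rewrite subsetEset; apply.
      apply: nearW => n; rewrite !indicE (negPf xU).
      rewrite (_ : (x \in F n) = false) ?subrr //.
      apply/negbTE; apply: contra xU => /set_mem Fx; apply/mem_set.
      by exists n.
    by exists \1_(F n); split => //; have [] := HF n.
- move=> A GA; split; last exact/ms_limitV/V_indic.
  by rewrite genE; exact: sub_sigma_algebra.
Qed.

Lemma ms_limit_nnsfun (f : {nnsfun E >-> R}) : ms_limit f.
Proof.
pose u : E -> R := f.
have [s sE] : exists s : seq R, forall x, u x = \sum_(y <- s) y * \1_(u @^-1` [set y]) x.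
  exists (finmap.enum_fset (fset_set (range u))) => x.
  by rewrite /u fimfunE fsbig_finite.
suff H : measurable_fun setT (fun x => \sum_(y <- s) y * \1_(u @^-1` [set y]) x) /\
    ms_limit (fun x => \sum_(y <- s) y * \1_(u @^-1` [set y]) x).
  by rewrite -/u (_ : u = (fun x => \sum_(y <- s) y * \1_(u @^-1` [set y]) x)); [case: H|exact/funext].
elim: s {sE} => [|y s [ms ls]].
  rewrite (_ : (fun x => _) = (fun x => 0 * cst 1 x)); last first.
    by apply/funext => x; rewrite big_nil mul0r.
  split; first exact: measurable_funM.
  exact/ms_limitV/V_scale.
rewrite (_ : (fun x => _) = (fun x => y * \1_(u @^-1` [set y]) x +
   \sum_(y <- s) y * \1_(u @^-1` [set y]) x)); last first.
  by apply/funext => x; rewrite big_cons.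
have mA : measurable (u @^-1` [set y]) by exact: measurable_sfunP.
have mi : measurable_fun setT (\1_(u @^-1` [set y]) : E -> R) by exact: measurable_indic.
split; first by apply: measurable_funD => //; exact: measurable_funM.
apply: ms_limitD => //; first exact: measurable_funM.
by apply: ms_limitZ => //; exact: ms_limit_indic.
Qed.

Lemma ms_limit_ge0 u : measurable_fun setT u -> (forall x, 0 <= u x) -> (msq u < +oo)%E -> ms_limit u.
Proof.
move=> mu_ u0 fin; apply: ms_limit_closed => // e e0.
have mE : measurable_fun setT (EFin \o u) by exact/measurable_EFinP.
have uE x : setT x -> (0 <= (EFin \o u) x)%E by rewrite lee_fin.
pose a n := nnsfun_approx measurableT mE n.
have a_le n x : a n x <= u x.
  have := @le_approx _ _ _ setT (EFin \o u) n x uE I.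
  by rewrite /a nnsfun_approxE lee_fin.
have [|||||n Hn] := @msq_cvg0 (fun n x => u x - a n x) u e _ _ _ _ _ e0 => //.
- by move=> n; apply: measurable_funB => //; exact: measurable_funPT.
- move=> n x; rewrite !ger0_norm ?subr_ge0 ?a_le ?u0 //.
  by rewrite lerBlDr lerDl; exact: fun_ge0.
- move=> x; rewrite -(subrr (u x)); apply: cvgB; first exact: cvg_cst.
  have := @cvg_nnsfun_approx _ _ _ setT measurableT _ mE uE x I.
  by move=> /fine_cvgP[_].
exists (a n); split => //; exact: ms_limit_nnsfun.
Qed.

Theorem ms_dense u : measurable_fun setT u -> (msq u < +oo)%E -> ms_limit u.
Proof.
move=> mu_ fin.
have pn x : u x = u^\+ x - u^\- x by rewrite -[in LHS](funrposBneg u).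
have mp : measurable_fun setT u^\+ by exact: measurable_funrpos.
have mn : measurable_fun setT u^\- by exact: measurable_funrneg.
rewrite (_ : u = (fun x => u^\+ x - u^\- x)); last exact/funext.
apply: ms_limitB => //; apply: ms_limit_ge0 => //.
- apply: le_lt_trans (msq_le mp mu_ _) fin => x.
  by rewrite /funrpos; have [] := leP (u x) 0; rewrite ?normr0 ?normr_ge0.
apply: le_lt_trans (msq_le mn mu_ _) fin => x.
by rewrite /funrneg; have [] := leP (- u x) 0; rewrite ?normr0 ?normrN ?normr_ge0.
Qed.

End GeneratingClass.

End MeanSquare.

Section Centering.
Variables (R : realType) (disp : measure_display) (E : measurableType disp).
Variable mu : probability E R.
Implicit Types (u : E -> R) (F : E -> R[i]).

Lemma integrable_sqr u : measurable_fun setT u -> (msq mu u < +oo)%E ->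
  mu.-integrable setT (EFin \o (fun x => u x ^+ 2)).
Proof.
move=> mu_ fin; apply/integrableP; split; first exact: measurable_sqr.
by under eq_integral do rewrite /= ger0_norm ?sqr_ge0 //.
Qed.

Lemma integrable_msq u : measurable_fun setT u -> (msq mu u < +oo)%E ->
  mu.-integrable setT (EFin \o u).
Proof.
move=> mu_ fin.
apply: (@le_integrable _ _ _ _ _ _ _ (EFin \o (fun x => 1 + u x ^+ 2))) => //.
- exact/measurable_EFinP.
- move=> x _ /=; rewrite lee_fin [leRHS]ger0_norm ?addr_ge0 ?sqr_ge0 //.
  rewrite -[X in _ <= _ + X]real_normK ?num_real //.
  by move: (normr_ge0 (u x)); set y := `|u x| => y0; nra.
apply: (@integrableD _ _ _ mu setT measurableT (cst 1%E) (EFin \o (fun x => u x ^+ 2))).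
  exact: (finite_measure_integrable_cst mu 1 measurableT).
exact: integrable_sqr.
Qed.

(** The variance is at most the second moment. Applied to the difference of a centred g and an
    approximant, it makes centring the approximant free of cost. *)
Lemma msq_center u e : measurable_fun setT u -> (msq mu u <= e%:E)%E ->
  (msq mu (fun x => (u x - \int[mu]_y u y)%R) <= e%:E)%E.
Proof.
move=> mu_ ue; have fin : (msq mu u < +oo)%E := le_lt_trans ue (ltry e).
set m := \int[mu]_y u y.
have i1 := integrable_msq mu_ fin; have i2 := integrable_sqr mu_ fin.
have ic c : mu.-integrable setT (EFin \o (fun _ : E => c)).
  exact: (finite_measure_integrable_cst mu c measurableT).
have msqE v : measurable_fun setT v -> (msq mu v < +oo)%E ->
    msq mu v = (\int[mu]_x (v x ^+ 2))%:E.
  move=> mv fv; rewrite /Rintegral fineK //.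
  by rewrite -[(_ < _)%E]ge0_fin_numE // in fv; exact: msq_ge0.
have mum : measurable_fun setT (fun x => u x - m) by exact: measurable_funB.
rewrite msqE //; last first.
  have mc : (msq mu (fun=> (- m)%R) <= (`|(- m)%R| ^+ 2)%R%:E)%E.
    by apply: msq_bounded => [|x]; [exact: measurable_cst|].
  exact: le_lt_trans (msqD_le mu_ (measurable_cst _) ue mc) (ltry _).
under eq_Rintegral => x _.
  rewrite (_ : _ ^+ 2 = (u x ^+ 2 + (- (2 * m)) * u x) + m ^+ 2); last by ring.
  over.
rewrite RintegralD //; last first.
  apply: (@integrableD _ _ _ mu setT measurableT (EFin \o (fun x => u x ^+ 2)) (EFin \o (fun x => - (2 * m) * u x))) => //.
  exact: (integrableZl measurableT _ i1).
rewrite RintegralD //; last exact: (integrableZl measurableT _ i1).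
rewrite RintegralZl // -/m Rintegral_cst //.
have -> : fine (mu setT) = 1 by rewrite probability_setT.
apply: le_trans ue; rewrite (msqE u) // lee_fin mulr1.
by have := sqr_ge0 m; lra.
Qed.

Lemma msq_complex F : ((\int[mu]_x `| (nc (F x))%:E | `^ 2)%E =
  \int[mu]_x ((complex.Re (F x)) ^+ 2 + (complex.Im (F x)) ^+ 2)%R%:E)%E.
Proof.
apply: eq_integral => x _; rewrite gee0_abs ?lee_fin ?nc_ge0 // poweR_EFin.
by rewrite -nc_sqr -powR_mulrn ?nc_ge0.
Qed.

Lemma L2norm_msq F : Cmeasurable F ->
  (L2norm mu F `^ 2 = msq mu (fun x => complex.Re (F x)) + msq mu (fun x => complex.Im (F x)))%E.
Proof.
move=> [mRe mIm]; rewrite /L2norm powR_Lnorm // msq_complex.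
rewrite /msq -ge0_integralD //.
- by move=> x _; rewrite lee_fin sqr_ge0.
- exact: measurable_sqr.
- by move=> x _; rewrite lee_fin sqr_ge0.
- exact: measurable_sqr.
Qed.

Lemma L2norm_lt F (a b eps : R) : Cmeasurable F -> 0 < eps ->
  (msq mu (fun x => complex.Re (F x)) <= a%:E)%E ->
  (msq mu (fun x => complex.Im (F x)) <= b%:E)%E ->
  a + b < eps ^+ 2 -> (L2norm mu F < eps%:E)%E.
Proof.
move=> mF eps0 ReF ImF ab; rewrite ltNge; apply/negP => le.
have : (eps%:E `^ 2 <= L2norm mu F `^ 2)%E.
  have N0 : (0 <= L2norm mu F)%E by exact: Lnorm_ge0.
  by apply: gt0_ler_poweR; rewrite ?in_itv /= ?N0 ?leey ?lee_fin ?(ltW eps0) //.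
rewrite L2norm_msq // poweR_EFin powR_mulrn ?(ltW eps0) // => le2.
have := le_trans le2 (leeD ReF ImF).
by rewrite -EFinD lee_fin leNgt ab.
Qed.

Lemma L2norm_fin_msq F : Cmeasurable F -> (L2norm mu F < +oo)%E ->
  (msq mu (fun x => complex.Re (F x)) < +oo)%E /\ (msq mu (fun x => complex.Im (F x)) < +oo)%E.
Proof.
move=> mF fin; have := poweR_lty 2 fin; rewrite L2norm_msq // => lt; split.
  by apply: le_lt_trans lt; rewrite leeDl // msq_ge0.
by apply: le_lt_trans lt; rewrite leeDr // msq_ge0.
Qed.

End Centering.

(** Two distinct values are requested so that the function is still non-zero after subtraction of
    its mean; a small r is added at b when the values at a and b happen to coincide. *)
Lemma rational_approx (R : realType) (T : finType) (v : T -> R) (a b : T) (e : R) :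
  a != b -> 0 < e ->
  exists w : T -> rat, w a != w b /\ forall x, `|v x - ratr (w x)| <= e.
Proof.
move=> ab e0; have e2 : 0 < e / 2 by rewrite divr_gt0.
have near x : exists r : rat, `|v x - ratr r| <= e / 2.
  have lt : v x - e / 2 < v x + e / 2 by rewrite ltrBlDr -addrA ltrDl addr_gt0.
  have [r] := rat_in_itvoo lt; rewrite in_itv /= => /andP[r1 r2]; exists r.
  rewrite distrC ler_norml; apply/andP; split; lra.
have [r] := rat_in_itvoo e2; rewrite in_itv /= => /andP[r0 re].
pose w0 x := projT1 (cid (near x)).
have w0P x : `|v x - ratr (w0 x)| <= e / 2 by exact: (projT2 (cid (near x))).
have rn0 : r != 0 by apply: contraTneq r0 => ->; rewrite rmorph0 ltxx.
exists (fun x => if (x == b) && (w0 a == w0 b) then w0 b + r else w0 x); split.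
  rewrite (negPf ab) eqxx /=; have [->|//] := eqVneq (w0 a) (w0 b).
  by rewrite -subr_eq0 opprD addrA subrr sub0r oppr_eq0.
move=> x; case: ifP => [/andP[/eqP -> _]|_].
  rewrite rmorphD opprD addrA; apply: le_trans (ler_normB _ _) _.
  by rewrite [e]splitr lerD // ger0_norm ltW.
by apply: le_trans (w0P x) _; rewrite ler_piMr ?invf_le1 ?ler1n // ltW.
Qed.

Lemma mean_sqr_gt0 (R : realType) (M : finZmodType) (F : M -> R[i]) a :
  F a != 0 -> 0 < mean_sqr F.
Proof.
move=> Fa; rewrite /mean_sqr /avg divr_gt0 //.
  rewrite (bigD1 a) //=; apply: ltr_pwDl; last by apply: sumr_ge0 => i _; rewrite exprn_ge0 ?nc_ge0.
  by rewrite exprn_gt0 // lt_def nc_ge0 nc_eq0 Fa.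
by rewrite ltr0n; apply/card_gt0P; exists a.
Qed.

Section CylinderDensity.
Variables (R : realType) (d : nat) (S : scales) (alpha : params d S).
Local Notation M := (M d S).
Local Notation X := (X alpha).
Variable mu : probability X R.
Hypothesis mu_ice : is_iceberg_measure mu.

Lemma coord_proj n N : (n <= N)%N ->
  exists p : M N -> M n, forall x : X, p (coord x N) = coord x n.
Proof.
move=> /subnK <-; exists (descend alpha (n0 := n) (k := N - n)%N) => x.
exact: descend_coord.
Qed.

Lemma cylinders_setI : setI_closed (@cylinders d S alpha).
Proof.
move=> _ _ [n [A ->]] [m [B ->]].
have [p pE] := coord_proj (leq_maxl n m); have [p' p'E] := coord_proj (leq_maxr n m).
exists (maxn n m), [set a | (p a \in A) && (p' a \in B)]%SET.
by apply/seteqP; split=> x /=; rewrite inE pE p'E => /andP.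
Qed.

Lemma cylinder_dense (u : X -> R) e : measurable_fun setT u -> (msq mu u < +oo)%E -> 0 < e ->
  exists n (v : M n -> R), (msq mu (fun x => (u x - v (coord x n))%R) <= e%:E)%E.
Proof.
move=> mu_ fin e0.
pose V := [set w : X -> R | exists n (v : M n -> R), w = (fun x => v (coord x n))].
have [|||||_ [n [v ->]] le] := @ms_dense _ _ _ mu (@cylinders d S alpha) V erefl
   cylinders_setI _ _ _ _ _ u mu_ fin e e0; last by exists n, v.
- by move=> _ [n [v ->]]; exact: measurable_fun_coord.
- by exists 0%N, (cst 1).
- move=> _ [n [A ->]]; exists n, (fun a => (a \in A)%:R); apply/funext => x.
  by rewrite indicE mem_setE.
- move=> _ _ [n [v ->]] [m [w ->]].
  have [p pE] := coord_proj (leq_maxl n m); have [p' p'E] := coord_proj (leq_maxr n m).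
  exists (maxn n m), (fun a => v (p a) + w (p' a)); apply/funext => x.
  by rewrite pE p'E.
- by move=> c _ [n [v ->]]; exists n, (fun a => c * v a).
Qed.

Let measurable_coordR n (g : M n -> R) : measurable_fun setT (fun x : X => g (coord x n)).
Proof. exact: measurable_fun_coord. Qed.

Lemma Rintegral_coord n (g : M n -> R) : \int[mu]_x g (coord x n) = avg g.
Proof. by rewrite /Rintegral integral_coord. Qed.

Lemma cylinder_in_L20 n (f : M n -> R[i]) : \sum_a f a = 0 ->
  in_L20 mu (fun x => f (coord x n)).
Proof.
move=> f0; have mf : Cmeasurable (fun x : X => f (coord x n)).
  split; first exact: (@measurable_coordR n (fun a => complex.Re (f a))).
  exact: (@measurable_coordR n (fun a => complex.Im (f a))).
split=> //; last first.
  rewrite /Cintegral (Rintegral_coord (fun a => complex.Re (f a))).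
  rewrite (Rintegral_coord (fun a => complex.Im (f a))).
  by rewrite -Re_avg -Im_avg /avg f0 mul0r.
pose C := \sum_a nc (f a).
have fC a : nc (f a) <= C by rewrite /C (bigD1 a) //= lerDl sumr_ge0 // => i _; exact: nc_ge0.
have C0 : 0 <= C by apply: sumr_ge0 => i _; exact: nc_ge0.
apply: lt_trans (@L2norm_lt _ _ _ mu _ (C ^+ 2) (C ^+ 2) (2 * C + 1) mf _ _ _ _) (ltry _).
- by rewrite ltr_wpDl // mulr_ge0.
- apply: msq_bounded => [|x]; first by case: mf.
  exact: le_trans (Re_le_nc _) (fC _).
- apply: msq_bounded => [|x]; first by case: mf.
  exact: le_trans (Im_le_nc _) (fC _).
by nra.
Qed.

Definition rat_fun n (u : {ffun M n -> rat * rat}) : M n -> R[i] :=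
  fun a => Complex (ratr (u a).1) (ratr (u a).2).

Lemma rational_cylinder_dense (g : X -> R[i]) (eps : R) : (0 < d)%N -> in_L20 mu g -> 0 < eps ->
  exists n (u : {ffun M n -> rat * rat}),
    [/\ \sum_a rat_fun u a = 0, 0 < mean_sqr (rat_fun u) &
        (L2norm mu (fun x => (g x - rat_fun u (coord x n))%R) < eps%:E)%E].
Proof.
move=> d0 [[mRe mIm] gfin gint] eps0.
have [finRe finIm] := L2norm_fin_msq (conj mRe mIm) gfin.
(* Cylindric and rational approximation each cost eps^2 / 16, so by [msqD_le] each of the real and
   imaginary parts is within eps^2 / 4, and the total eps^2 / 2 is below eps^2. *)
have e0 : 0 < eps ^+ 2 / 16 by rewrite divr_gt0 // exprn_gt0.
have [n1 [v1 H1]] := cylinder_dense mRe finRe e0.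
have [n2 [v2 H2]] := cylinder_dense mIm finIm e0.
(* The successor ensures that M_N has two distinct points. *)
pose N := (maxn n1 n2).+1.
have [p1 p1E] : exists p : M N -> M n1, forall x : X, p (coord x N) = coord x n1.
  by apply: coord_proj; rewrite ltnW // ltnS leq_maxl.
have [p2 p2E] : exists p : M N -> M n2, forall x : X, p (coord x N) = coord x n2.
  by apply: coord_proj; rewrite ltnW // ltnS leq_maxr.
have /card_gt1P[a [b [_ _ ab]]] : (1 < #|{: M N}|)%N.
  apply: (@leq_trans (h S N)); first by have := @h2_leS S (maxn n1 n2);
    have := h_gt0 S (maxn n1 n2); rewrite -/N; lia.
  by rewrite card_M -(prednK d0) expnS leq_pmulr // expn_gt0 h_gt0.
have eps4 : 0 < eps / 4 by rewrite divr_gt0.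
have [w1 [w1ab w1v]] := rational_approx (fun a => v1 (p1 a)) ab eps4.
have [w2 [_ w2v]] := rational_approx (fun a => v2 (p2 a)) ab eps4.
(* The mean is subtracted within the rationals, so that the result still belongs to a countable
   family. *)
pose c (w : M N -> rat) a := w a - avg w.
have cE (w : M N -> rat) x : ratr (c w x) = ratr (w x) - avg (fun y => ratr (w y)) :> R.
  by rewrite rmorphB /avg fmorph_div rmorph_sum rmorph_nat.
have c_sum (w : M N -> rat) : \sum_x (ratr (c w x) : R) = 0.
  rewrite (eq_bigr _ (fun x _ => cE w x)) sumrB sumr_const /avg.
  rewrite -[X in _ - X]mulr_natr divfK ?subrr // pnatr_eq0 -lt0n.
  by apply/card_gt0P; exists a.
have approx (u : X -> R) n (v : M n -> R) (p : M N -> M n) (w : M N -> rat) :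
    measurable_fun setT u -> (msq mu u < +oo)%E -> \int[mu]_x u x = 0 ->
    (forall x : X, p (coord x N) = coord x n) ->
    (msq mu (fun x => (u x - v (coord x n))%R) <= (eps ^+ 2 / 16)%:E)%E ->
    (forall x, `|v (p x) - ratr (w x)| <= eps / 4) ->
    (msq mu (fun x => (u x - ratr (c w (coord x N)))%R) <= (eps ^+ 2 / 4)%:E)%E.
  move=> mu_ fin int0 pE uv vw.
  pose z (x : X) : R := u x - ratr (w (coord x N)).
  have mz : measurable_fun setT z.
    by apply: measurable_funB => //; exact: (@measurable_coordR N (fun a => ratr (w a) : R)).
  have zle : (msq mu z <= (eps ^+ 2 / 4)%:E)%E.
    rewrite (_ : z = fun x => (u x - v (coord x n)) + (v (p (coord x N)) - ratr (w (coord x N)))); last first.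
      by apply/funext => x; rewrite pE addrA subrK.
    rewrite (_ : eps ^+ 2 / 4 = 2 * (eps ^+ 2 / 16 + (eps / 4) ^+ 2)); last by field.
    have m2 := @measurable_coordR N (fun a => v (p a) - ratr (w a) : R).
    apply: msqD_le => //.
      by apply: measurable_funB => //; exact: measurable_fun_coord.
    by apply: msq_bounded.
  have := msq_center mz zle.
  rewrite (_ : \int[mu]_x z x = - avg (fun y => ratr (w y) : R)); last first.
    rewrite /z RintegralB //; [|exact: integrable_msq|exact: (@integrable_coord _ _ _ _ mu N (fun a => ratr (w a) : R))].
    by rewrite int0 sub0r (Rintegral_coord (fun a => ratr (w a) : R)).
  rewrite (_ : (fun x => _) = (fun x => u x - ratr (c w (coord x N)))) //.
  by apply/funext => x; rewrite cE /z opprB opprK addrA addrAC.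
pose u : {ffun M N -> rat * rat} := [ffun a => (c w1 a, c w2 a)].
have uRe x : complex.Re (rat_fun u x) = ratr (c w1 x) by rewrite /rat_fun ffunE.
have uIm x : complex.Im (rat_fun u x) = ratr (c w2 x) by rewrite /rat_fun ffunE.
have [gRe gIm] : \int[mu]_x complex.Re (g x) = 0 /\ \int[mu]_x complex.Im (g x) = 0.
  by move: gint; rewrite /Cintegral => /eqP; rewrite eq_complex /= => /andP[/eqP -> /eqP ->].
exists N, u; split.
- apply/eqP; rewrite eq_complex Re_sum Im_sum /=.
  rewrite (eq_bigr _ (fun x _ => uRe x)) (eq_bigr _ (fun x _ => uIm x)).
  by rewrite !c_sum eqxx.
- have [fa|] := eqVneq (rat_fun u a) 0; last exact: mean_sqr_gt0.
  apply: (@mean_sqr_gt0 _ _ _ b); apply: contra_neq w1ab => fb.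
  have : ratr (c w1 a) = ratr (c w1 b) :> R by rewrite -!uRe fa fb.
  by move/fmorph_inj/addIr.
have A1 := approx _ _ _ _ _ mRe finRe gRe p1E H1 w1v.
have A2 := approx _ _ _ _ _ mIm finIm gIm p2E H2 w2v.
have eRe : (fun x : X => complex.Re (g x - rat_fun u (coord x N))) =
    (fun x => complex.Re (g x) - ratr (c w1 (coord x N))).
  by apply/funext => x; rewrite ReD ReN uRe.
have eIm : (fun x : X => complex.Im (g x - rat_fun u (coord x N))) =
    (fun x => complex.Im (g x) - ratr (c w2 (coord x N))).
  by apply/funext => x; rewrite ImD ImN uIm.
apply: (L2norm_lt _ eps0 (a := eps ^+ 2 / 4) (b := eps ^+ 2 / 4)).
- split; [rewrite eRe|rewrite eIm]; apply: measurable_funB => //.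
    exact: (@measurable_coordR N (fun a => ratr (c w1 a) : R)).
  exact: (@measurable_coordR N (fun a => ratr (c w2 a) : R)).
- by rewrite eRe.
- by rewrite eIm.
have : 0 < eps ^+ 2 by rewrite exprn_gt0.
by move: (eps ^+ 2) => E0; lra.
Qed.

End CylinderDensity.

(** In [scales] the sequence q determines h, whereas [fast] prescribes q_n in terms of h_n. The h_n
    are therefore built first by their own recursion and identified with [h S] afterwards. *)
Lemma fast_scales_exist d h0 : (0 < h0)%N -> exists2 S, h1 S = h0 & fast d S.
Proof.
move=> h0_gt0.
pose qq (x n : nat) := (4 ^ (2 ^ (x ^ d + n + d + 40)))%N.
pose fix hh (n : nat) : nat := if n is m.+1 then (qq (hh m) m * hh m)%N else h0.
have qq_gt0 x n : (0 < qq x n)%N by rewrite expn_gt0.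
have hhS n : (hh n <= hh n.+1)%N by rewrite leq_pmull.
have ge2 n : (2 <= qq (hh n) n)%N.
  by rewrite /qq -{1}(expn1 2) -[4%N]/(2 ^ 2)%N -expnM leq_pexp2l // muln_gt0 expn_gt0.
have growth n : (2 * qq (hh n) n < qq (hh n.+1) n.+1)%N.
  apply: (@leq_trans (4 * qq (hh n) n)).
    by rewrite ltn_mul2r qq_gt0.
  rewrite /qq -expnS leq_pexp2l // ltn_exp2l //.
  have := leq_expnW d (hhS n); move: (hh n ^ d)%N (hh n.+1 ^ d)%N => a b; lia.
pose S := Scales h0_gt0 ge2 growth.
have hE n : h S n = hh n by elim: n => // n IHn; rewrite hS IHn.
by exists S => // n; rewrite log4qE /size_exp hE.
Qed.

Lemma q_unbounded (S : scales) : q S n @[n --> \oo] --> \oo.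
Proof.
have qn n : (n <= q S n)%N.
  by elim: n => // n IHn; have := q_growth S n; lia.
apply/cvgnyPge => K; exists K => // n /= Kn.
exact: leq_trans Kn (qn n).
Qed.

Lemma ae_countable (disp : measure_display) (T : measurableType disp) (R : realType)
    (mu : {measure set T -> \bar R}) (I : countType) (Q : I -> T -> Prop) :
  (forall i, {ae mu, forall x, Q i x}) -> {ae mu, forall x, forall i, Q i x}.
Proof.
move=> aeQ.
have : {ae mu, forall x, forall n, if unpickle n is Some i then Q i x else True}.
  by apply: ae_foralln => n; case: (unpickle n) => [i|]; [exact: aeQ|exact: aeW].
by apply: filterS => x H i; have := H (pickle i); rewrite pickleK.
Qed.

Section RationalCylinders.
Variables (R : realType) (d : nat) (S : scales).
Local Notation M := (M d S).

Definition rational_cylinders : set (cyl_data R d S) :=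
  [set c | exists n (u : {ffun M n -> rat * rat}),
    [/\ c = existT _ n (rat_fun R u), \sum_a rat_fun R u a = 0 & 0 < mean_sqr (rat_fun R u)]].

Definition sup_bound n (f : M n -> R[i]) : R := \sum_a nc (f a) + 1.

Lemma sup_bound_gt0 n (f : M n -> R[i]) : 0 < sup_bound f.
Proof. by rewrite ltr_wpDl // sumr_ge0 // => a _; exact: nc_ge0. Qed.

Lemma le_sup_bound n (f : M n -> R[i]) a : nc (f a) <= sup_bound f.
Proof.
rewrite /sup_bound (bigD1 a) //= -addrA lerDl addr_ge0 //.
by apply: sumr_ge0 => b _; exact: nc_ge0.
Qed.

Variables (disp : measure_display) (Omega : measurableType disp) (P : probability Omega R).
Variable alpha : forall n : nat, Gamma_quo d S n -> Omega -> M n.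
Hypothesis alpha_meas : measurable_params alpha.
Hypothesis alpha_indep : independent_params P alpha.
Hypothesis alpha_unif : uniform_params P alpha.
Hypotheses (d_gt0 : (0 < d)%N) (fastS : fast d S).

Lemma ae_rational_good : {ae P, forall w, forall c, rational_cylinders c ->
  0 < mean_sqr (tagged c) /\
  exists k1, forall k, (k1 <= k)%N ->
    good (fun n g => @alpha n g w) (tagged c) (sup_bound (tagged c)) k}.
Proof.
pose Q n (u : {ffun M n -> rat * rat}) w : Prop :=
  \sum_a rat_fun R u a = 0 -> 0 < mean_sqr (rat_fun R u) ->
  exists k1, forall k, (k1 <= k)%N ->
    good (fun n g => @alpha n g w) (rat_fun R u) (sup_bound (rat_fun R u)) k.
have aeQ : {ae P, forall w, forall n, forall u, Q n u w}.
  apply: ae_foralln => n; apply: ae_countable => u.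
  have [u0|u0] := pselect (\sum_a rat_fun R u a = 0 /\ 0 < mean_sqr (rat_fun R u)).
    have := ae_good d_gt0 fastS (sup_bound_gt0 _) (@le_sup_bound _ (rat_fun R u)) u0.2
      alpha_meas alpha_indep alpha_unif u0.1.
    by apply: filterS => w H _ _.
  by apply: aeW => w s0 m0; exfalso; apply: u0.
apply: filterS aeQ => w H _ [n [u [-> s0 m0]]]; split=> //.
exact: H.
Qed.

End RationalCylinders.

Theorem mainTheorem1 (R : realType) (d : nat) (d_gt0 : (0 < d)%N)
    (h0 : nat) (h0_gt0 : (0 < h0)%N) :
  exists S : scales, [/\ h1 S = h0, q S n @[n --> \oo] --> \oo &
  forall (disp : measure_display) (Omega : measurableType disp)
    (P : probability Omega R)
    (alpha : forall n : nat, Gamma_quo d S n -> Omega -> M d S n),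
  measurable_params alpha -> independent_params P alpha ->
  uniform_params P alpha ->
  exists D : set (cyl_data R d S),
  {ae P, forall w : Omega,
    let alphaw : params d S := fun n g => alpha n g w in
    forall mu : probability (X alphaw) R, is_iceberg_measure mu ->
    dense_in_L20 mu [set cyl_fun c | c in D] /\
    forall c : cyl_data R d S, D c ->
    forall sigma : {finite_measure set (torus R d) -> \bar R},
    is_spectral_measure mu (cyl_fun c) sigma ->
    [/\ forall eps : R, 0 < eps -> bigO_power (fourier sigma) (- 2^-1 + eps),
        ~ in_Lp 2 (fourier sigma) &
        forall p : R, 2 < p -> in_Lp p (fourier sigma)]}].
Proof.
have [S hS0 fastS] := fast_scales_exist d h0_gt0.
exists S; split=> //; first exact: q_unbounded.
(* The chosen data are countably many and independent of w, so one null set serves them all. *)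
move=> disp Omega P alpha mea ind uni; exists (@rational_cylinders R d S).
apply: filterS (ae_rational_good mea ind uni d_gt0 fastS) => w H /= mu ice; split.
  split=> [_ [_ [n [u [-> s0 _]]] <-]|g g0 eps eps0].
    exact: (cylinder_in_L20 ice s0).
  have [n [u [s0 m0 le]]] := rational_cylinder_dense ice d_gt0 g0 eps0.
  exists (fun x => rat_fun R u (coord x n)) => //.
  by exists (existT _ n (rat_fun R u)) => //; exists n, u.
move=> c /H[m0 [k1 gd]] sigma spec.
exact: (spectral_asymptotics d_gt0 fastS ice (sup_bound_gt0 _) (@le_sup_bound _ _ _ _ _) m0 gd spec).
Qed.
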